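(* Let $(\mathcal X,d,\mu)$ be an RD-space with $\mu(\mathcal X)=\infty$ and doubling exponent $n$. Let $\epsilon_1\in(0,1]$, $\epsilon_2,\epsilon_3>0$, $\epsilon\in(0,\epsilon_1\wedge\epsilon_2)$, and let $\{S_k\}_{k\in\mathbb Z}$ be an $(\epsilon_1,\epsilon_2,\epsilon_3)$-AOTI. Let $p\in(n/(n+\epsilon),1]$ and $\beta,\gamma\in(n(1/p-1),\epsilon)$. Then there exists a positive constant $C$ such that for all $\ell\in\mathbb Z$ and $f\in(\mathcal G_0^\epsilon(\beta,\gamma))'$, $$\|f-S_\ell(f)\|_{H^p(\mathcal X)}\le C\|G_\ell(f)\|_{L^p(\mathcal X)}.$$
   Context: A triple $(\mathcal X,d,\mu)$, with $(\mathcal X,d)$ a metric space and $\mu$ a Borel regular measure such that every ball $B(x,r)=\{y:d(x,y)<r\}$ has finite positive measure, is a space of homogeneous type if there exist $C_1\ge1$ and $n>0$ with $\mu(B(x,\lambda r))\le C_1\lambda^n\mu(B(x,r))$ for all $x$, $\lambda\ge1$, $r>0$ ($n$ = doubling exponent); it is an RD-space if moreover there are $C_2,C_3>1$ with $\mu(B(x,C_2r))\ge C_3\mu(B(x,r))$ for all $x$ and $0<r<\operatorname{diam}(\mathcal X)$. Write $V_r(x)=\mu(B(x,r))$, $V(x,y)=\mu(B(x,d(x,y)))$, $a\wedge b=\min\{a,b\}$. AOTI: for $\epsilon_1\in(0,1]$, $\epsilon_2,\epsilon_3>0$, an $(\epsilon_1,\epsilon_2,\epsilon_3)$-AOTI is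 a sequence $\{S_k\}_{k\in\mathbb Z}$ of bounded linear integral operators on $L^2(\mathcal X)$ with measurable kernels $S_k(x,y)$ satisfying, for some $C_4>0$ and all $k,x,x',y,y'$: (i) $|S_k(x,y)|\le C_4\frac{1}{V_{2^{-k}}(x)+V(x,y)}\big[\frac{2^{-k}}{2^{-k}+d(x,y)}\big]^{\epsilon_2}$; (ii) $|S_k(x,y)-S_k(x',y)|\le C_4\big[\frac{d(x,x')}{2^{-k}+d(x,y)}\big]^{\epsilon_1}\frac{1}{V_{2^{-k}}(x)+V(x,y)}\big[\frac{2^{-k}}{2^{-k}+d(x,y)}\big]^{\epsilon_2}$ if $d(x,x')\le[2^{-k}+d(x,y)]/2$; (iii) (ii) with $x,y$ interchanged; (iv) $|[S_k(x,y)-S_k(x,y')]-[S_k(x',y)-S_k(x',y')]|\le C_4\big[\frac{d(x,x')}{2^{-k}+d(x,y)}\big]^{\epsilon_1}\big[\frac{d(y,y')}{2^{-k}+d(x,y)}\big]^{\epsilon_1}\frac{1}{V_{2^{-k}}(x)+V(x,y)}\big[\frac{2^{-k}}{2^{-k}+d(x,y)}\big]^{\epsilon_3}$ if $d(x,x'),d(y,y')\le[2^{-k}+d(x,y)]/3$; (v) $\int S_k(x,z)\,d\mu(z)=1=\int S_k(z,y)\,d\mu(z)$. Test functions: for $x\in\mathcal X$, $r>0$, $\beta\in(0,1]$, $\gamma>0$, $\mathcal G(x,r,\beta,\gamma)$ is the set of $f$ with some $C\ge0$ such that $|f(y)|\le C\frac{1}{V_r(x)+V(x,y)}\big(\frac{r}{r+d(x,y)}\big)^\gamma$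 for all $y$ and $|f(z)-f(y)|\le C\big(\frac{d(y,z)}{r+d(x,y)}\big)^\beta\frac{1}{V_r(x)+V(x,y)}\big(\frac{r}{r+d(x,y)}\big)^\gamma$ whenever $d(y,z)\le[r+d(x,y)]/2$; the norm is the infimum of such $C$. Fix $x_1\in\mathcal X$; for $\epsilon\in(0,1]$, $\beta,\gamma\in(0,\epsilon]$, $\mathcal G_0^\epsilon(\beta,\gamma)$ is the closure of $\mathcal G(x_1,1,\epsilon,\epsilon)$ in $\mathcal G(x_1,1,\beta,\gamma)$, and $(\mathcal G_0^\epsilon(\beta,\gamma))'$ its dual. $S_k(f)(x)=\langle f,S_k(x,\cdot)\rangle$. Grand maximal function: $G(f)(x)=\sup\{|\langle f,\varphi\rangle|:\varphi\in\mathcal G_0^\epsilon(\beta,\gamma),\ \|\varphi\|_{\mathcal G(x,r,\beta,\gamma)}\le1\text{ for some }r>0\}$; localized version $G_\ell(f)(x)$: same supremum restricted to $r\in(0,2^{-\ell}]$. $\|f\|_{H^p(\mathcal X)}=\|G(f)\|_{L^p(\mathcal X)}$, and $H^p(\mathcal X)$ is the set of $f\in(\mathcal G_0^\epsilon(\beta,\gamma))'$ for which this is finite. *)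

(* Defs.v *)
From HB Require Import structures.
From mathcomp Require Import all_boot all_order all_algebra.
From mathcomp Require Import all_classical all_reals all_analysis.
Set Implicit Arguments. Unset Strict Implicit. Unset Printing Implicit Defensive.
Import Order.TTheory GRing.Theory Num.Theory.
Local Open Scope classical_set_scope.
Local Open Scope ring_scope.

Section RDspace.
Context {R : realType} {dX : measure_display} {X : measurableType dX}.
Variable (d : X -> X -> R).

Definition is_metric : Prop :=
  (forall x y, 0 <= d x y) /\ (forall x y, d x y = 0 <-> x = y) /\
  (forall x y, d x y = d y x) /\ (forall x y z, d x z <= d x y + d y z).

Definition dball (x : X) (r : R) : set X := [set y | d x y < r].

Definition d_open (A : set X) : Prop :=
  forall x, A x -> exists2 r : R, 0 < r & dball x r `<=` A.

Definition borel_for_metric : Prop :=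
  forall A : set X, measurable A <-> <<s d_open >> A.

Definition diamX : \bar R := ereal_sup [set (d x y)%:E | x in setT & y in setT].

Definition tpow (k : int) : R := 2 `^ (- (k%:~R)).

Variable (mu : {measure set X -> \bar R}).

Definition Vr (r : R) (x : X) : R := fine (mu (dball x r)).
Definition Vxy (x y : X) : R := fine (mu (dball x (d x y))).

Definition balls_finite_pos : Prop :=
  forall x r, 0 < r -> (0 < mu (dball x r))%E /\ (mu (dball x r) < +oo)%E.

Definition doubling (n : R) : Prop :=
  0 < n /\ exists2 C1 : R, 1 <= C1 &
    forall x (lam r : R), 1 <= lam -> 0 < r ->
      Vr (lam * r) x <= C1 * lam `^ n * Vr r x.

Definition reverse_doubling : Prop :=
  exists C2 C3 : R, 1 < C2 /\ 1 < C3 /\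
    forall x (r : R), 0 < r -> (r%:E < diamX)%E ->
      C3 * Vr r x <= Vr (C2 * r) x.

Definition RD_space (n : R) : Prop :=
  is_metric /\ borel_for_metric /\ balls_finite_pos /\ doubling n /\
  reverse_doubling.

Definition sizef (x : X) (r gam : R) (y : X) : R :=
  (Vr r x + Vxy x y)^-1 * (r / (r + d x y)) `^ gam.

Definition AOTI (eps1 eps2 eps3 : R) (S : int -> X -> X -> R) : Prop :=
  (0 < eps1 <= 1) /\ 0 < eps2 /\ 0 < eps3 /\
  (forall k, measurable_fun [set: X * X] (fun xy : X * X => S k xy.1 xy.2)) /\
  exists2 C4 : R, 0 < C4 &
  (forall k x y, `|S k x y| <= C4 * sizef x (tpow k) eps2 y) /\
  (forall k x x' y, d x x' <= (tpow k + d x y) / 2 ->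
     `|S k x y - S k x' y| <=
       C4 * (d x x' / (tpow k + d x y)) `^ eps1 * sizef x (tpow k) eps2 y) /\
  (forall k x y y', d y y' <= (tpow k + d x y) / 2 ->
     `|S k x y - S k x y'| <=
       C4 * (d y y' / (tpow k + d x y)) `^ eps1 * sizef x (tpow k) eps2 y) /\
  (forall k x x' y y', d x x' <= (tpow k + d x y) / 3 ->
     d y y' <= (tpow k + d x y) / 3 ->
     `|(S k x y - S k x y') - (S k x' y - S k x' y')| <=
       C4 * (d x x' / (tpow k + d x y)) `^ eps1
          * (d y y' / (tpow k + d x y)) `^ eps1 * sizef x (tpow k) eps3 y) /\
  (forall k x, (\int[mu]_z (S k x z)%:E = 1)%E) /\
  (forall k y, (\int[mu]_z (S k z y)%:E = 1)%E).

Definition Gbound (x : X) (r beta gam : R) (f : X -> R) (C : R) : Prop :=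
  0 <= C /\
  (forall y, `|f y| <= C * sizef x r gam y) /\
  (forall y z, d y z <= (r + d x y) / 2 ->
     `|f z - f y| <= C * (d y z / (r + d x y)) `^ beta * sizef x r gam y).

Definition inG (x : X) (r beta gam : R) (f : X -> R) : Prop :=
  exists C, Gbound x r beta gam f C.

Definition Gnorm (x : X) (r beta gam : R) (f : X -> R) : R :=
  inf [set C | Gbound x r beta gam f C].

Variable (x1 : X).

Definition G0 (eps beta gam : R) (f : X -> R) : Prop :=
  inG x1 1 beta gam f /\
  forall delta : R, 0 < delta -> exists2 g : X -> R,
    inG x1 1 eps eps g & Gnorm x1 1 beta gam (f \- g) < delta.

(** (G_0^eps(beta,gamma))': continuous linear functionals on G_0^eps(beta,gamma);
    the values of L outside G_0^eps(beta,gamma) are irrelevant *)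
Definition in_dual (eps beta gam : R) (L : (X -> R) -> R) : Prop :=
  (forall (a b : R) (phi psi : X -> R), G0 eps beta gam phi -> G0 eps beta gam psi ->
     L (fun y => a * phi y + b * psi y) = a * L phi + b * L psi) /\
  (exists C : R, forall phi, G0 eps beta gam phi ->
     `|L phi| <= C * Gnorm x1 1 beta gam phi).

Definition grand_max (eps beta gam : R) (rmax : option int)
    (L : (X -> R) -> R) (x : X) : \bar R :=
  ereal_sup [set (`|L phi|)%:E | phi in
    [set phi | G0 eps beta gam phi /\
      exists r : R, 0 < r /\ (if rmax is Some l then r <= tpow l else True) /\
        inG x r beta gam phi /\ Gnorm x r beta gam phi <= 1]].

Definition Sop (S : int -> X -> X -> R) (k : int) (L : (X -> R) -> R) (x : X) : R :=
  L (S k x).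

(** f - S_l(f) as a distribution: the function S_l(f) acts on test functions
    by integration against mu *)
Definition f_minus_Sf (S : int -> X -> X -> R) (l : int) (L : (X -> R) -> R)
    : (X -> R) -> R :=
  fun phi => L phi - Rintegral mu setT (fun x => Sop S l L x * phi x).

End RDspace.

(* Main.v *)
(* Let delta = 2^-l, g(z) = <f, S_l(z, .)>, and let phi be normalised in G(x, r, beta, gam).
   No Calderon reproducing formula is needed: everything is localised at scale delta, on balls
   B_j = B(w_j, delta) around a delta-separated net, where bumps of scale delta are controlled by
   m_j, the infimum over B_j of the localised grand maximal function G.

   If r <= delta, then |<f, phi>| <= G(x), and the integral of g phi is bounded by the sum over j of
   m_j mu(B_j) times the size of G(x, delta, beta, gam) at w_j. If r > delta, the cancellation
   of S_l shows that psi = phi - S_l^* phi gains a factor (delta/r)^beta and is Hoelder at scale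
   delta; a partition of unity subordinate to the B_j bounds <f, psi> by the similar sum for
   scale r, times that factor. Since p <= 1, the p-th power of a sum is at most the sum
   of the p-th powers; summing over dyadic r and integrating in x, the series converge because
   beta and gam exceed n (1/p - 1), and sum_j m_j^p mu(B_j) is at most a multiple of the
   integral of G^p. *)
Require Import Defs.
From HB Require Import structures.
From mathcomp Require Import all_boot all_order all_algebra.
From mathcomp Require Import all_classical all_reals all_analysis.
From mathcomp Require Import measurable_realfun ring lra.
Import Order.TTheory GRing.Theory Num.Theory.
Local Open Scope classical_set_scope.
Local Open Scope ring_scope.

(** What makes the localisation work is that a bump of scale delta is a test function of scale delta
    about every point within a multiple of delta of it, with norm comparable to its height times the
    volume of the ball. One value of the functional is therefore controlled at all points of a ball
    at once, and no maximal operator has to be bounded. The functional [L] is known only through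
    linearity and continuity on the closure of G(x1, 1, eps, eps). It cannot be applied to an
    infinite sum or moved under an integral directly, so test functions are first truncated to
    bounded sets, where the partition of unity is finite and integrals are limits of Riemann sums.
    Truncation converges because elements of the closure are approximated by functions of decay eps,
    and the surplus eps - gamma makes their tails small. For uniformity in l, every estimate that
    reaches the final constant fixes its constant before the scale and the kernel; constants that
    depend on delta occur only in membership statements and in limits. *)

Record doubling_space {R : realType} {dX : measure_display}
    {X : measurableType dX} (d : X -> X -> R)
    (mu : {measure set X -> \bar R}) (n C1 : R) : Prop := {
  ds_metric : is_metric d ;
  ds_borel : forall A, <<s d_open d >> A -> measurable A ;
  ds_balls : balls_finite_pos d mu ;
  ds_n : 0 < n ;
  ds_C1 : 1 <= C1 ;
  ds_dbl : forall x (lam r : R), 1 <= lam -> 0 < r ->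
      Vr d mu (lam * r) x <= C1 * lam `^ n * Vr d mu r x }.

Arguments ds_metric {R dX X d mu n C1} _.
Arguments ds_borel {R dX X d mu n C1} _.
Arguments ds_balls {R dX X d mu n C1} _.
Arguments ds_n {R dX X d mu n C1} _.
Arguments ds_C1 {R dX X d mu n C1} _.
Arguments ds_dbl {R dX X d mu n C1} _.

(** * Balls in a doubling space and the size function of test functions *)

Section Geometry.
Context {R : realType} {dX : measure_display} {X : measurableType dX}.
Context {d : X -> X -> R} {mu : {measure set X -> \bar R}} {n C1 : R}.
Context (H : doubling_space d mu n C1).
Implicit Types (x y z c : X) (s r a : R).

Lemma dist_ge0 x y : 0 <= d x y.
Proof. by case: (ds_metric H). Qed.

Lemma dist_xx x : d x x = 0.
Proof. by case: (ds_metric H) => _ [/(_ x x) [_ ->]]. Qed.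

Lemma distC x y : d x y = d y x.
Proof. by case: (ds_metric H) => _ [_ []]. Qed.

Lemma dist_triangle x y z : d x z <= d x y + d y z.
Proof. by case: (ds_metric H) => _ [_ []]. Qed.

Lemma measurable_open A : d_open d A -> measurable A.
Proof. by move=> oA; apply: (ds_borel H); exact: sub_sigma_algebra. Qed.

Lemma d_open_dball c s : d_open d (dball d c s).
Proof.
move=> x; rewrite /dball /= => xs; exists (s - d c x); first by rewrite subr_gt0.
by move=> y /= yx; have := dist_triangle c x y; lra.
Qed.

Lemma measurable_dball c s : measurable (dball d c s).
Proof. exact/measurable_open/d_open_dball. Qed.

Lemma mu_dball c s : mu (dball d c s) = (Vr d mu s c)%:E.
Proof.
have [s0|s0] := ltP 0 s.
  by rewrite /Vr fineK// ge0_fin_numE//; case: (ds_balls H c s s0).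
suff -> : dball d c s = set0 by rewrite /Vr (_ : dball d c s = set0) ?measure0//;
  apply/seteqP; split => y //=; rewrite /dball /=; have := dist_ge0 c y; lra.
by apply/seteqP; split => y //=; rewrite /dball /=; have := dist_ge0 c y; lra.
Qed.

Lemma Vr_gt0 c s : 0 < s -> 0 < Vr d mu s c.
Proof. by move=> s0; rewrite -lte_fin -mu_dball; case: (ds_balls H c s s0). Qed.

Lemma Vr_ge0 c s : 0 <= Vr d mu s c.
Proof. by rewrite -lee_fin -mu_dball. Qed.

Lemma le_Vr c s c' s' : s + d c c' <= s' -> Vr d mu s c <= Vr d mu s' c'.
Proof.
move=> ss'; rewrite -lee_fin -!mu_dball; apply: le_measure.
- by rewrite inE; exact: measurable_dball.
- by rewrite inE; exact: measurable_dball.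
- by move=> y; rewrite /dball /= => ys; have := dist_triangle c' c y;
    rewrite (distC c' c); lra.
Qed.

Lemma Vr_doubling A c s c' s' : 1 <= A -> 0 < s -> s' + d c' c <= A * s ->
  Vr d mu s' c' <= C1 * A `^ n * Vr d mu s c.
Proof.
move=> A1 s0 ss'; apply: le_trans (ds_dbl H c A s A1 s0).
exact: le_Vr.
Qed.

(** [sizef] with its sum of two volumes replaced by the volume of one ball of radius [s + d c y]. By
    doubling the two agree up to constants, and a single ball can be compared with others by mere
    inclusion. *)
Definition bump c s a y := (Vr d mu (s + d c y) c)^-1 * (s / (s + d c y)) `^ a.

Lemma scale_gt0 c s y : 0 < s -> 0 < s + d c y.
Proof. by move=> s0; have := dist_ge0 c y; lra. Qed.

Lemma scale_ratio c s y : 0 < s -> 0 < s / (s + d c y) <= 1.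
Proof.
move=> s0; have sd := scale_gt0 c s y s0; rewrite divr_gt0//= ler_pdivrMr// mul1r.
by have := dist_ge0 c y; lra.
Qed.

Lemma bump_gt0 c s a y : 0 < s -> 0 < bump c s a y.
Proof.
move=> s0; rewrite /bump mulr_gt0 ?invr_gt0 ?Vr_gt0 ?scale_gt0// powR_gt0//.
by case/andP: (scale_ratio c s y s0).
Qed.

(* All the changes of centre, scale, and argument of a bump that are needed, including the
   exchange of centre and argument, are instances of this comparison. *)
Lemma bump_compare A a : 1 <= A -> 0 <= a -> exists2 K, 1 <= K &
  forall c s y c' s' y', 0 < s -> 0 < s' -> s <= A * s' ->
    s' + d c' y' <= A * (s + d c y) -> d c c' <= A * (s + d c y) ->
    bump c s a y <= K * bump c' s' a y'.
Proof.
move=> A1 a0.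
have A2 : 1 <= 2 * A by lra.
have AA : 1 <= A * A by nra.
have P1 : 1 <= (2 * A) `^ n.
  by rewrite -[leLHS](powRr0 (2 * A)) ler_powR//; exact/ltW/(ds_n H).
have P2 : 1 <= (A * A) `^ a by rewrite -[leLHS](powRr0 (A * A)) ler_powR.
have C11 := ds_C1 H.
exists (C1 * (2 * A) `^ n * (A * A) `^ a).
  have : 1 <= C1 * (2 * A) `^ n by nra.
  by nra.
move=> c s y c' s' y' s0 s'0 ss' h1 h2.
have t0 := scale_gt0 c s y s0; have t'0 := scale_gt0 c' s' y' s'0.
have V : Vr d mu (s' + d c' y') c' <= C1 * (2 * A) `^ n * Vr d mu (s + d c y) c.
  by apply: Vr_doubling => //; rewrite (distC c' c); lra.
have r : (s / (s + d c y)) `^ a <= (A * A) `^ a * (s' / (s' + d c' y')) `^ a.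
  rewrite -powRM; [|nra|by apply: divr_ge0; lra].
  apply: ge0_ler_powR => //; rewrite ?nnegrE.
  - by apply: divr_ge0; lra.
  - by apply: mulr_ge0; [nra|apply: divr_ge0; lra].
  rewrite mulrA ler_pdivlMr// mulrAC ler_pdivrMr//.
  apply: (@le_trans _ _ (A * s' * (s' + d c' y'))); first by rewrite ler_wpM2r//; lra.
  have -> : A * A * s' * (s + d c y) = A * s' * (A * (s + d c y)) by ring.
  by rewrite ler_wpM2l// mulr_ge0//; lra.
rewrite /bump.
have V0 := Vr_gt0 c _ t0; have V'0 := Vr_gt0 c' _ t'0.
set K1 := C1 * _ in V *; set v := Vr d mu _ c in V V0 *.
set v' := Vr d mu _ c' in V V'0 *.
have K10 : 0 < K1 by rewrite /K1; nra.
have Vi : v^-1 <= K1 * v'^-1.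
  by rewrite ler_pdivlMr// mulrC ler_pdivrMr// mulrC.
set q := (s / _) `^ a in r *; set q' := (s' / _) `^ a in r *.
have -> : K1 * (A * A) `^ a * (v'^-1 * q') = (K1 * v'^-1) * ((A * A) `^ a * q') by ring.
apply: ler_pM => //; first by rewrite invr_ge0; exact: ltW.
exact: powR_ge0.
Qed.

(** Twice the larger of [s] and [d c y] exceeds their sum, so one doubling step bounds the large
    ball by one of the two volumes in [sizef]. *)
Lemma sizef_le_bump c s a y : 0 < s ->
  sizef d mu c s a y <= C1 * 2 `^ n * bump c s a y.
Proof.
move=> s0; rewrite /sizef /bump mulrA ler_wpM2r ?powR_ge0//.
have dcy := dist_ge0 c y.
have V0 := Vr_gt0 c _ s0; have V1 : 0 <= Vxy d mu c y := Vr_ge0 c (d c y).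
have V2 := Vr_gt0 c _ (scale_gt0 c s y s0).
rewrite ler_pdivlMr// mulrC ler_pdivrMr; last by lra.
have K0 : 0 < C1 * 2 `^ n.
  by rewrite mulr_gt0 ?powR_gt0//; exact: lt_le_trans (ds_C1 H).
rewrite mulrDr.
have [ds|sd] := leP (d c y) s.
  have := Vr_doubling 2 c s c (s + d c y); rewrite dist_xx => /(_ _ s0 _) h.
  have : 0 <= C1 * 2 `^ n * Vxy d mu c y by rewrite mulr_ge0// ltW.
  by have := h ltac:(lra) ltac:(lra); lra.
have := Vr_doubling 2 c (d c y) c (s + d c y); rewrite dist_xx => h.
have : 0 <= C1 * 2 `^ n * Vr d mu s c by rewrite mulr_ge0// ltW.
by have := h ltac:(lra) ltac:(lra) ltac:(lra); rewrite /Vxy -/(Vr d mu (d c y) c); lra.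
Qed.

Lemma bump_le_sizef c s a y : 0 < s -> bump c s a y <= 2 * sizef d mu c s a y.
Proof.
move=> s0; rewrite /sizef /bump mulrA ler_wpM2r ?powR_ge0//.
have dcy := dist_ge0 c y.
have V0 := Vr_gt0 c _ s0; have V1 : 0 <= Vxy d mu c y := Vr_ge0 c (d c y).
have V2 := Vr_gt0 c _ (scale_gt0 c s y s0).
rewrite ler_pdivlMr; last by lra.
rewrite mulrC ler_pdivrMr//.
have h1 : Vr d mu s c <= Vr d mu (s + d c y) c by apply: le_Vr; rewrite dist_xx; lra.
have h2 : Vr d mu (d c y) c <= Vr d mu (s + d c y) c.
  by apply: le_Vr; rewrite dist_xx; lra.
by rewrite /Vxy -/(Vr d mu (d c y) c); lra.
Qed.

Lemma sizef_ge0 c s a y : 0 < s -> 0 <= sizef d mu c s a y.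
Proof. by move=> s0; have := bump_le_sizef c s a y s0; have := bump_gt0 c s a y s0; lra. Qed.

End Geometry.
Arguments bump {R dX X} d mu.

(** * Powers of ratios and the calculus of [Gbound] *)

Lemma ler_powR_le1 {R : realType} (a b b' : R) :
  0 <= a <= 1 -> 0 < b -> b <= b' -> a `^ b' <= a `^ b.
Proof.
case/andP=> a0 a1 b0 bb'; have [a00|a_neq0] := eqVneq a 0.
  by rewrite a00 !powR0//; apply/eqP; lra.
by apply: ger_powR => //; rewrite lt_neqAle eq_sym a_neq0 a0.
Qed.

Lemma powR_ge1 {R : realType} (a b : R) : 1 <= a -> 0 <= b -> 1 <= a `^ b.
Proof. by move=> a1 b0; rewrite -[leLHS](powRr0 a) ler_powR. Qed.

Lemma powR_le1 {R : realType} (a b : R) : 0 <= a <= 1 -> 0 <= b -> a `^ b <= 1.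
Proof.
case/andP=> a0 a1 b0; rewrite [leRHS](_ : 1 = 1 `^ b); last by rewrite powR1.
by apply: ge0_ler_powR; rewrite ?nnegrE.
Qed.

Section TestFunctions.
Context {R : realType} {dX : measure_display} {X : measurableType dX}.
Context {d : X -> X -> R} {mu : {measure set X -> \bar R}} {n C1 : R}.
Context (H : doubling_space d mu n C1).
Implicit Types (x y z c : X) (s r a : R).

Lemma sizef_compare A a : 1 <= A -> 0 <= a -> exists2 K, 1 <= K &
  forall c s y c' s' y', 0 < s -> 0 < s' -> s <= A * s' ->
    s' + d c' y' <= A * (s + d c y) -> d c c' <= A * (s + d c y) ->
    sizef d mu c s a y <= K * sizef d mu c' s' a y'.
Proof.
move=> A1 a0; have [K K1 HK] := bump_compare H A a A1 a0.
have P1 : 1 <= C1 * 2 `^ n.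
  by have := ds_C1 H; have := powR_ge1 2 n ltac:(lra) (ltW (ds_n H)); nra.
exists (C1 * 2 `^ n * K * 2); first by nra.
move=> c s y c' s' y' s0 s'0 h1 h2 h3.
apply: (le_trans (sizef_le_bump H c s a y s0)).
rewrite -(mulrA _ K) -(mulrA _ (K * 2)) -(mulrA K) ler_wpM2l//; first lra.
apply: (le_trans (HK c s y c' s' y' s0 s'0 h1 h2 h3)).
by rewrite ler_wpM2l ?(bump_le_sizef H)//; lra.
Qed.

Lemma sizef_le_exp c s a b y : 0 < s -> a <= b -> sizef d mu c s b y <= sizef d mu c s a y.
Proof.
move=> s0 ab; rewrite /sizef ler_wpM2l//.
  by rewrite invr_ge0 addr_ge0//; exact: Vr_ge0 H _ _.
by apply: ger_powR => //; exact: scale_ratio H _ _ _ _.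
Qed.

(** Balls are defined by a strict inequality, so [Vxy c c] is the volume of the empty set. The
    identity turns lower bounds for a volume times a [sizef] into instances of [sizef_compare]. *)
Lemma sizef_center c s a : 0 < s -> sizef d mu c s a c = (Vr d mu s c)^-1.
Proof.
move=> s0; rewrite /sizef (dist_xx H) addr0 divff ?gt_eqF// powR1 mulr1.
rewrite /Vxy (dist_xx H) (_ : dball d c 0 = set0) ?measure0 ?addr0//.
by apply/seteqP; split => y //=; rewrite /dball /=; have := dist_ge0 H c y; lra.
Qed.

(** Far from the centre, lowering the decay from [e] to [a] pays a factor that tends to 0 as [N]
    grows. *)
Lemma sizef_tail c s a e N y : 0 < s -> a <= e -> 0 <= N -> s + N <= 2 * (s + d c y) ->
  sizef d mu c s e y <= (2 * s / (s + N)) `^ (e - a) * sizef d mu c s a y.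
Proof.
move=> s0 ae N0 Ny; rewrite /sizef mulrCA ler_wpM2l//.
  by rewrite invr_ge0 addr_ge0//; exact: Vr_ge0 H _ _.
have /andP[r0 r1] := scale_ratio H c s y s0.
have -> : e = (e - a) + a by ring.
rewrite powRD; last by rewrite (gt_eqF r0) implybT.
rewrite [_ + a - a](_ : _ = e - a); last by ring.
rewrite ler_wpM2r ?powR_ge0//; apply: ge0_ler_powR; rewrite ?nnegrE.
- by lra.
- exact: ltW.
- by rewrite divr_ge0//; lra.
rewrite ler_pdivlMr; last by lra.
rewrite mulrAC ler_pdivrMr; last exact: scale_gt0 H _ _ _ _.
by nra.
Qed.

Lemma ratio_le1 c s y z : 0 < s -> d y z <= (s + d c y) / 2 ->
  0 <= d y z / (s + d c y) <= 1.
Proof.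
move=> s0 yz; have t0 := scale_gt0 H c s y s0.
rewrite divr_ge0 ?(dist_ge0 H)//=; last exact: ltW.
by rewrite ler_pdivrMr// mul1r; lra.
Qed.

Lemma Gbound_le c s b a f C C' : 0 < s -> C <= C' ->
  Gbound d mu c s b a f C -> Gbound d mu c s b a f C'.
Proof.
move=> s0 CC' [C0 [h1 h2]]; split; first exact: le_trans CC'.
split=> [y|y z yz]; first by apply: (le_trans (h1 y)); rewrite ler_wpM2r// (sizef_ge0 H).
apply: (le_trans (h2 y z yz)); rewrite ler_wpM2r ?(sizef_ge0 H)//.
by rewrite ler_wpM2r// powR_ge0.
Qed.

Lemma Gbound_exp c s b a b' a' f C : 0 < s -> 0 < b -> b <= b' -> a <= a' ->
  Gbound d mu c s b' a' f C -> Gbound d mu c s b a f C.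
Proof.
move=> s0 b0 bb' aa' [C0 [h1 h2]]; split => //; split=> [y|y z yz].
  by apply: (le_trans (h1 y)); rewrite ler_wpM2l// sizef_le_exp.
apply: (le_trans (h2 y z yz)); apply: ler_pM.
- by rewrite mulr_ge0// powR_ge0.
- exact: (sizef_ge0 H).
- by rewrite ler_wpM2l// ler_powR_le1// ratio_le1.
- exact: sizef_le_exp.
Qed.

Lemma Gbound_lin c s b a f g C C' k k' : 0 < s ->
  Gbound d mu c s b a f C -> Gbound d mu c s b a g C' ->
  Gbound d mu c s b a (fun y => k * f y + k' * g y) (`|k| * C + `|k'| * C').
Proof.
move=> s0 [C0 [f1 f2]] [C'0 [g1 g2]]; split; first by rewrite addr_ge0// mulr_ge0.
split=> [y|y z yz].
  apply: (le_trans (ler_normD _ _)); rewrite !normrM mulrDl -!mulrA.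
  by apply: lerD; rewrite ler_wpM2l.
have -> : k * f z + k' * g z - (k * f y + k' * g y) =
  k * (f z - f y) + k' * (g z - g y) by ring.
apply: (le_trans (ler_normD _ _)); rewrite !normrM !mulrDl -!mulrA.
by apply: lerD; rewrite ler_wpM2l// [leRHS]mulrA; [exact: f2|exact: g2].
Qed.

Lemma Gbound_continuous c s b a f C y e : 0 < s -> 0 < b -> Gbound d mu c s b a f C ->
  0 < e -> exists2 h, 0 < h & forall z, d y z < h -> `|f z - f y| < e.
Proof.
move=> s0 b0 [C0 [_ h2]] e0; have t0 := scale_gt0 H c s y s0.
have S0 := sizef_ge0 H c s a y s0.
set S := sizef _ _ _ _ _ _ in S0 h2 *; set t := s + d c y in t0 h2 *.
pose e' := e / (C * S + 1).
have e'0 : 0 < e' by rewrite divr_gt0// ltr_wpDl// mulr_ge0.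
exists (Num.min (t / 2) (t * e' `^ b^-1)).
  by rewrite lt_min divr_gt0//= mulr_gt0// powR_gt0.
move=> z; rewrite lt_min => /andP[z1 z2].
apply: (le_lt_trans (h2 y z (ltW z1))).
rewrite -/t -/S.
have : (d y z / t) `^ b <= e'.
  have -> : e' = (e' `^ b^-1) `^ b by rewrite -powRrM mulVf ?powRr1 ?gt_eqF// ltW.
  apply: ge0_ler_powR; rewrite ?nnegrE ?powR_ge0 ?divr_ge0 ?(dist_ge0 H)//; try exact: ltW.
  by rewrite ler_pdivrMr// mulrC ltW.
move=> h; apply: (@le_lt_trans _ _ (C * S * e')).
  by rewrite mulrAC ler_wpM2l// mulr_ge0.
have CS0 : 0 <= C * S by rewrite mulr_ge0.
by rewrite /e' mulrA ltr_pdivrMr; nra.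
Qed.

(* The Hoelder condition at distances comparable with [s + d c y] follows from the size
   condition. *)
Lemma Gbound_ext th b a : 0 < th -> 0 <= b -> 0 <= a -> exists2 K, 1 <= K &
  forall c s f C, 0 < s -> 0 <= C ->
    (forall y, `|f y| <= C * sizef d mu c s a y) ->
    (forall y z, d y z <= th * (s + d c y) -> d y z <= (s + d c y) / 2 ->
       `|f z - f y| <= C * (d y z / (s + d c y)) `^ b * sizef d mu c s a y) ->
    Gbound d mu c s b a f (K * C).
Proof.
move=> th0 b0 a0; have [K1 K11 HK] := sizef_compare 2 a ltac:(lra) a0.
have tb0 : 0 < th `^ b by rewrite powR_gt0.
pose K := 1 + (1 + K1) / th `^ b.
have K0 : 1 <= K by rewrite lerDl divr_ge0//; lra.
have KC C : 0 <= C -> C <= K * C by move=> ?; nra.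
exists K => // c s f C s0 C0 h1 h2; split; first by rewrite mulr_ge0//; lra.
have S0 y := sizef_ge0 H c s a y s0.
split=> [y|y z yz]; first by apply: (le_trans (h1 y)); rewrite ler_wpM2r ?KC.
have t0 := scale_gt0 H c s y s0; have yz0 := dist_ge0 H y z.
have [yz'|yz'] := leP (d y z) (th * (s + d c y)).
  apply: (le_trans (h2 y z yz' yz)).
  by rewrite ler_wpM2r// ler_wpM2r ?powR_ge0 ?KC.
have h : `|f z - f y| <= C * ((1 + K1) * sizef d mu c s a y).
  apply: (le_trans (ler_normB _ _)); rewrite mulrDl mul1r mulrDr addrC lerD//.
  apply: (le_trans (h1 z)); rewrite ler_wpM2l//; apply: HK => //; first lra.
    by have := dist_triangle H c z y; rewrite (distC H z y); lra.
  by rewrite (dist_xx H); have := dist_ge0 H c z; lra.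
apply: (le_trans h).
have q : th `^ b <= (d y z / (s + d c y)) `^ b.
  apply: ge0_ler_powR => //; rewrite ?nnegrE ?divr_ge0//; try exact: ltW.
  by rewrite ler_pdivlMr// ltW.
have : 1 + K1 <= K * (d y z / (s + d c y)) `^ b.
  apply: (@le_trans _ _ (K * th `^ b)); last by rewrite ler_wpM2l//; lra.
  by rewrite /K mulrDl mul1r divfK ?gt_eqF//; lra.
move=> h'.
have -> : K * C * (d y z / (s + d c y)) `^ b * sizef d mu c s a y =
  C * (K * (d y z / (s + d c y)) `^ b * sizef d mu c s a y) by ring.
by rewrite ler_wpM2l// ler_wpM2r.
Qed.

Lemma Gbound_recenter A b a : 1 <= A -> 0 <= b -> 0 <= a -> exists2 K, 1 <= K &
  forall c s c' s' f C, 0 < s -> 0 < s' -> s <= A * s' -> s' <= A * s ->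
    d c c' <= A * s -> Gbound d mu c s b a f C -> Gbound d mu c' s' b a f (K * C).
Proof.
move=> A1 b0 a0; have [K1 K11 HK1] := sizef_compare (2 * A) a ltac:(lra) a0.
(* The new scale [s' + d c' y] is at most [2 * A] times the old one, so below this fraction of it
   the increment stays within half of the old scale, where the given Hoelder bound applies. *)
have th0 : 0 < (4 * A)^-1 by rewrite invr_gt0; lra.
have [K2 K21 HK2] := Gbound_ext (4 * A)^-1 b a th0 b0 a0.
have Ab : 1 <= (2 * A) `^ b by apply: powR_ge1; lra.
exists (K2 * ((2 * A) `^ b * K1)); first by rewrite !mulr_ege1.
move=> c s c' s' f C s0 s'0 ss' s's cc' [C0 [h1 h2]].
have As : 0 <= A * s by rewrite mulr_ge0//; lra.
have sA : s <= 2 * A * s' by lra.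
have dd y : s' + d c' y <= 2 * A * (s + d c y).
  have := dist_triangle H c' c y; rewrite (distC H c' c) => ?.
  by have := dist_ge0 H c y; nra.
have S y : sizef d mu c s a y <= K1 * sizef d mu c' s' a y.
  by apply: HK1 => //; have := dist_ge0 H c y; nra.
have S' y := sizef_ge0 H c' s' a y s'0.
rewrite -mulrA; apply: HK2 => //; first by rewrite mulr_ge0//; nra.
  move=> y; apply: (le_trans (h1 y)).
  apply: (@le_trans _ _ (C * (K1 * sizef d mu c' s' a y))); first by rewrite ler_wpM2l.
  rewrite mulrA ler_wpM2r//.
  have : C * K1 <= (2 * A) `^ b * (C * K1) by rewrite ler_peMl// mulr_ge0//; lra.
  by lra.
move=> y z yz _; have t0 := scale_gt0 H c s y s0; have t'0 := scale_gt0 H c' s' y s'0.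
have yz0 := dist_ge0 H y z.
have yz2 : d y z <= (s + d c y) / 2.
  apply: (le_trans yz); apply: (@le_trans _ _ ((4 * A)^-1 * (2 * A * (s + d c y)))).
    by rewrite ler_wpM2l// ltW.
  rewrite le_eqVlt; apply/orP; left; apply/eqP; field; lra.
apply: (le_trans (h2 y z yz2)).
have q : (d y z / (s + d c y)) `^ b <= (2 * A) `^ b * (d y z / (s' + d c' y)) `^ b.
  rewrite -powRM; [|lra|by rewrite divr_ge0// ltW].
  apply: ge0_ler_powR => //; rewrite ?nnegrE ?divr_ge0//; try exact: ltW.
    by rewrite mulr_ge0 ?divr_ge0//; [lra|exact: ltW].
  rewrite mulrCA ler_wpM2l// ler_pdivlMr// mulrC ler_pdivrMr//.
have -> : (2 * A) `^ b * K1 * C * (d y z / (s' + d c' y)) `^ b * sizef d mu c' s' a y =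
  C * ((2 * A) `^ b * (d y z / (s' + d c' y)) `^ b) * (K1 * sizef d mu c' s' a y) by ring.
apply: ler_pM => //; first by rewrite mulr_ge0 ?powR_ge0.
  exact: (sizef_ge0 H).
by rewrite ler_wpM2l.
Qed.

(** If [k] differs at [y] and [z], one of them lies in the support of [k], which forces
    [s + d c y <= 2 * A * L]. The Lipschitz bound [d y z / L] is then at most [2 * A] times the
    ratio in the Hoelder condition, and a ratio below 1 is at most its power [b]. The exponents stay
    free because the lemma serves both (eps, eps) and (beta, gamma). *)
Lemma Gbound_mul_cutoff A c s b a f C k x1 rho L : 1 <= A -> 0 < s -> 0 < b <= 1 ->
  Gbound d mu c s b a f C -> 0 < L ->
  (forall y, 0 <= k y <= 1) -> (forall y z, `|k z - k y| <= d y z / L) ->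
  (forall y, k y != 0 -> d x1 y <= rho) -> s + d c x1 + rho <= A * L ->
  Gbound d mu c s b a (fun y => f y * k y) ((1 + 2 * A) * C).
Proof.
move=> A1 s0 /andP[b0 b1] [C0 [h1 h2]] L0 k01 kL ks AL.
have S0 y := sizef_ge0 H c s a y s0.
split; first by rewrite mulr_ge0//; lra.
have kn y : `|k y| <= 1 by rewrite ger0_norm; case/andP: (k01 y).
split=> [y|y z yz].
  rewrite normrM; apply: (@le_trans _ _ (C * sizef d mu c s a y * 1)).
    by apply: ler_pM.
  by rewrite mulr1 ler_wpM2r// ler_peMl//; lra.
have t0 := scale_gt0 H c s y s0; have yz0 := dist_ge0 H y z.
have q1 : d y z / (s + d c y) <= (d y z / (s + d c y)) `^ b.
  have q0 := ratio_le1 c s y z s0 yz.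
  rewrite -[leLHS]powRr1; [exact: ler_powR_le1|by case/andP: q0].
have q0 := powR_ge0 (d y z / (s + d c y)) b.
set q := _ `^ b in q0 q1 h2 *.
have -> : f z * k z - f y * k y = (f z - f y) * k z + f y * (k z - k y) by ring.
apply: (le_trans (ler_normD _ _)); rewrite !normrM.
have -> : (1 + 2 * A) * C * q * sizef d mu c s a y =
  C * q * sizef d mu c s a y + 2 * A * C * q * sizef d mu c s a y by ring.
apply: lerD.
  apply: (@le_trans _ _ (C * q * sizef d mu c s a y * 1)); last by rewrite mulr1.
  by apply: ler_pM => //; exact: h2.
have [|kyz] := boolP ((k y == 0) && (k z == 0)).
  case/andP=> /eqP -> /eqP ->; rewrite subrr normr0 mulr0.
  by rewrite mulr_ge0// !mulr_ge0//; lra.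
have tL : s + d c y <= 2 * A * L.
  rewrite negb_and in kyz; have := dist_triangle H c x1 y => cy.
  case/orP: kyz => /ks; first by have := dist_ge0 H c x1; lra.
  by have := dist_triangle H c z y; have := dist_triangle H c x1 z;
    rewrite (distC H z y); lra.
have kd : `|k z - k y| <= 2 * A * q.
  apply: (le_trans (kL y z)); apply: (@le_trans _ _ (2 * A * (d y z / (s + d c y)))).
    rewrite mulrCA ler_wpM2l// ler_pdivlMr// mulrC ler_pdivrMr//.
  by rewrite ler_wpM2l//; lra.
have -> : 2 * A * C * q * sizef d mu c s a y = (C * sizef d mu c s a y) * (2 * A * q) by ring.
by apply: ler_pM.
Qed.

(** Whenever [f y] or [f z] is nonzero, [s + N <= 2 * (s + d c y)], so [sizef_tail] applies at [y].
    This is the source of convergence for truncations. *)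
Lemma Gbound_tail c s b a e f C N : 0 < s -> 0 < b -> b <= e -> a <= e -> 0 <= N ->
  Gbound d mu c s e e f C -> (forall y, d c y < N -> f y = 0) ->
  Gbound d mu c s b a f (C * (2 * s / (s + N)) `^ (e - a)).
Proof.
move=> s0 b0 be ae N0 [C0 [h1 h2]] f0.
have S0 y := sizef_ge0 H c s a y s0.
have S y : s + N <= 2 * (s + d c y) ->
    sizef d mu c s e y <= (2 * s / (s + N)) `^ (e - a) * sizef d mu c s a y.
  exact: sizef_tail.
split; first by rewrite mulr_ge0// powR_ge0.
split=> [y|y z yz].
  have [yN|yN] := ltP (d c y) N.
    by rewrite f0// normr0 mulr_ge0// mulr_ge0// powR_ge0.
  by apply: (le_trans (h1 y)); rewrite -mulrA ler_wpM2l// S//; lra.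
have t0 := scale_gt0 H c s y s0; have yz0 := dist_ge0 H y z.
have [/andP[yN zN]|] := boolP ((d c y < N) && (d c z < N)).
  by rewrite !f0// subrr normr0 mulr_ge0// mulr_ge0 ?powR_ge0// mulr_ge0 ?powR_ge0.
rewrite negb_and -!leNgt => yN.
have yN' : s + N <= 2 * (s + d c y).
  by case/orP: yN => ?; [lra|have := dist_triangle H c y z; lra].
apply: (le_trans (h2 y z yz)).
have q : (d y z / (s + d c y)) `^ e <= (d y z / (s + d c y)) `^ b.
  by apply: ler_powR_le1 => //; exact: ratio_le1.
have -> : C * (2 * s / (s + N)) `^ (e - a) * (d y z / (s + d c y)) `^ b * sizef d mu c s a y =
  C * ((d y z / (s + d c y)) `^ b * ((2 * s / (s + N)) `^ (e - a) * sizef d mu c s a y)) by ring.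
rewrite -(mulrA C) ler_wpM2l//; apply: ler_pM => //.
- exact: powR_ge0.
- exact: (sizef_ge0 H).
exact: S.
Qed.

(** On the relevant neighbourhood of the support, [Vr d mu s w * sizef d mu c s a y] is bounded
    below by [sizef_center]. Hence a function of height [B] at scale [s] is a test function about
    any nearby centre [c], with norm of order [B] times the volume. *)
Lemma Gbound_bump A b a : 1 <= A -> 0 <= b -> 0 <= a -> exists2 K, 1 <= K &
  forall c w s f B, 0 < s -> 0 <= B -> d c w <= A * s ->
    (forall y, f y != 0 -> d w y <= A * s) -> (forall y, `|f y| <= B) ->
    (forall y z, d y z <= s / 2 -> `|f z - f y| <= B * (d y z / s) `^ b) ->
    Gbound d mu c s b a f (K * (B * Vr d mu s w)).
Proof.
move=> A1 b0 a0; have [K1 K11 HK1] := sizef_compare (5 * A) a ltac:(lra) a0.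
(* With increments below this fraction, [y] remains within a multiple of [s] of the support even if
   only [f z] is nonzero: [s + d c y <= 4 * A * s], and then [d y z <= s / 2]. *)
have th0 : 0 < (8 * A)^-1 by rewrite invr_gt0; lra.
have [K2 K21 HK2] := Gbound_ext (8 * A)^-1 b a th0 b0 a0.
have Ab : 1 <= (4 * A) `^ b by apply: powR_ge1; lra.
exists (K2 * ((4 * A) `^ b * K1)); first by rewrite !mulr_ege1.
move=> c w s f B s0 B0 cw fs f1 f2.
have S0 y := sizef_ge0 H c s a y s0.
have V0 := Vr_gt0 H w s s0.
have As : s <= A * s by nra.
have S y : s + d c y <= 4 * A * s -> 1 <= K1 * (Vr d mu s w * sizef d mu c s a y).
  move=> cy; rewrite mulrCA -(ler_pdivrMl _ _ V0) mulr1 -(sizef_center w s a s0).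
  by apply: HK1 => //; rewrite ?(dist_xx H) ?(distC H w c); nra.
rewrite -mulrA; apply: HK2 => //; first by rewrite !mulr_ge0//; lra.
  move=> y; have [->|/fs fy] := eqVneq (f y) 0.
    by rewrite normr0 mulr_ge0// !mulr_ge0//; lra.
  apply: (le_trans (f1 y)).
  have cy : 1 <= K1 * (Vr d mu s w * sizef d mu c s a y).
    by apply: S; have := dist_triangle H c w y; lra.
  have : 1 <= (4 * A) `^ b * (K1 * (Vr d mu s w * sizef d mu c s a y)) by nra.
  by move=> h; rewrite -[leLHS]mulr1; apply: (le_trans (ler_wpM2l B0 h)); lra.
move=> y z yz _; have t0 := scale_gt0 H c s y s0; have yz0 := dist_ge0 H y z.
have yz' : 8 * A * d y z <= s + d c y.
  by move: yz; rewrite mulrC ler_pdivlMr; lra.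
have [|fyz] := boolP ((f y == 0) && (f z == 0)).
  case/andP=> /eqP -> /eqP ->; rewrite subrr normr0.
  by rewrite mulr_ge0// !mulr_ge0 ?powR_ge0//; lra.
have cy : s + d c y <= 4 * A * s.
  rewrite negb_and in fyz; case/orP: fyz => /fs; first by have := dist_triangle H c w y; lra.
  have := dist_triangle H c z y; have := dist_triangle H c w z; rewrite (distC H z y).
  have : 8 * d y z <= 8 * A * d y z by nra.
  by lra.
have yz2 : d y z <= s / 2.
  have : 8 * A * d y z <= 4 * A * s by lra.
  by rewrite ler_pdivlMr//; nra.
apply: (le_trans (f2 y z yz2)).
have q : (d y z / s) `^ b <= (4 * A) `^ b * (d y z / (s + d c y)) `^ b.
  rewrite -powRM; [|lra|by rewrite divr_ge0// ltW].
  apply: ge0_ler_powR => //; rewrite ?nnegrE ?divr_ge0//; try exact: ltW.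
    by rewrite mulr_ge0 ?divr_ge0//; [lra|exact: ltW].
  by rewrite mulrCA ler_wpM2l// ler_pdivlMr// mulrC ler_pdivrMr.
have -> : (4 * A) `^ b * K1 * (B * Vr d mu s w) * (d y z / (s + d c y)) `^ b * sizef d mu c s a y =
  B * ((4 * A) `^ b * (d y z / (s + d c y)) `^ b) * (K1 * (Vr d mu s w * sizef d mu c s a y)) by ring.
rewrite -[leLHS]mulr1; apply: ler_pM => //; [by rewrite mulr_ge0 ?powR_ge0| |exact: S].
by rewrite ler_wpM2l.
Qed.

End TestFunctions.

(** * Dyadic series that dominate powers of the size function *)

Lemma nneseries_le_bound {R : realType} (u : nat -> \bar R) (b : \bar R) :
  (forall i, 0 <= u i)%E -> (forall N, \sum_(0 <= i < N) u i <= b)%E ->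
  (\sum_(i <oo) u i <= b)%E.
Proof.
move=> u0 ub; apply: lime_le; first by apply: is_cvg_nneseries => k _ _; exact: u0.
exact: nearW.
Qed.

Lemma nneseries_ge_term {R : realType} (u : nat -> \bar R) k :
  (forall i, 0 <= u i)%E -> (u k <= \sum_(i <oo) u i)%E.
Proof.
move=> u0; apply: le_trans (nneseries_lim_ge k.+1 _) => //.
by rewrite big_nat_recr//= leeDr// sume_ge0.
Qed.

Lemma nneseries_geometric_le {R : realType} (q : R) : 0 <= q < 1 ->
  (\sum_(i <oo) (q ^+ i)%:E <= ((1 - q)^-1)%:E)%E.
Proof.
case/andP=> q0 q1; apply: nneseries_le_bound => [i|N].
  by rewrite lee_fin exprn_ge0.
rewrite sumEFin lee_fin -[leRHS]mul1r ler_pdivlMr ?subr_gt0//.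
have -> : (\sum_(0 <= i < N) q ^+ i) * (1 - q) = 1 - q ^+ N.
  elim: N => [|N IH]; first by rewrite big_geq// mul0r expr0 subrr.
  by rewrite big_nat_recr//= mulrDl IH exprS; ring.
by have := exprn_ge0 N q0; lra.
Qed.

Section Dyadic.
Context {R : realType} {dX : measure_display} {X : measurableType dX}.
Context {d : X -> X -> R} {mu : {measure set X -> \bar R}} {n C1 : R}.
Context (H : doubling_space d mu n C1).
Implicit Types (x y z c : X) (s r a : R).

(** The [p]-th power of the size function on the dyadic layer of radius [2 ^+ i * s], spread over
    the whole ball. A series of multiples of indicators of balls is measurable and is integrated
    term by term. *)
Definition dyadic_term p c s a (i : nat) y : R :=
  (2 ^- i) `^ (a * p) * (Vr d mu (2 ^+ i * s) c) `^ (- p) *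
  \1_(dball d c (2 ^+ i * s)) y.

Definition dyadic p c s a y : \bar R := (\sum_(i <oo) (dyadic_term p c s a i y)%:E)%E.

Lemma dyadic_term_ge0 p c s a i y : 0 <= dyadic_term p c s a i y.
Proof. by rewrite !mulr_ge0 ?powR_ge0. Qed.

Lemma dyadic_ge0 p c s a y : (0 <= dyadic p c s a y)%E.
Proof. by apply: nneseries_ge0 => i _ _; rewrite lee_fin dyadic_term_ge0. Qed.

Lemma measurable_dyadic_term p c s a i :
  measurable_fun [set: X] (EFin \o dyadic_term p c s a i).
Proof.
apply/measurable_EFinP; apply: measurable_funM; first exact: measurable_cst.
exact/measurable_indic/(measurable_dball H).
Qed.

Lemma measurable_dyadic p c s a : measurable_fun [set: X] (dyadic p c s a).
Proof.
apply: ge0_emeasurable_sum => [k x _ _|k _]; last exact: measurable_dyadic_term.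
by rewrite lee_fin dyadic_term_ge0.
Qed.

Lemma exists_dyadic_scale s (t : R) : 0 < s -> 0 <= t ->
  exists i : nat, t < 2 ^+ i * s /\ 2 ^+ i * s <= 2 * (s + t).
Proof.
move=> s0 t0.
have ex : exists i, t < 2 ^+ i * s.
  exists (Num.truncn (t / s)).+1; rewrite -ltr_pdivrMr//.
  apply: (lt_trans (truncnS_gt _)).
  by rewrite -natrX ltr_nat; exact: ltn_expl.
exists (ex_minn ex); case: ex_minnP => -[|i] ti mi; split => //.
  by rewrite expr0; lra.
rewrite exprS; have [h|h] := ltP t (2 ^+ i * s); last by lra.
by have := mi i h; rewrite ltnn.
Qed.

Lemma sizef_le_dyadic_term a : 0 <= a -> exists2 K, 1 <= K &
  forall c s y, 0 < s -> exists i : nat, d c y < 2 ^+ i * s /\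
    sizef d mu c s a y <= K * ((2 ^- i) `^ a * (Vr d mu (2 ^+ i * s) c)^-1).
Proof.
move=> a0; have C11 := ds_C1 H.
have K1 : 1 <= C1 * 2 `^ n by rewrite mulr_ege1// powR_ge1//; [lra|exact/ltW/(ds_n H)].
have K2 : 1 <= (2 : R) `^ a by rewrite powR_ge1//; lra.
exists (C1 * 2 `^ n * (C1 * 2 `^ n * 2 `^ a)); first by rewrite mulr_ege1// mulr_ege1.
move=> c s y s0; have [i [i1 i2]] := exists_dyadic_scale s _ s0 (dist_ge0 H c y).
exists i; split => //; apply: (le_trans (sizef_le_bump H c s a y s0)).
rewrite -[leRHS]mulrA ler_wpM2l//; first lra.
have t0 := scale_gt0 H c s y s0.
have i0 : 0 < (2 : R) ^+ i by rewrite exprn_gt0.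
have h1 : Vr d mu (2 ^+ i * s) c <= C1 * 2 `^ n * Vr d mu (s + d c y) c.
  by apply: (Vr_doubling H) => //; [lra|rewrite (dist_xx H); lra].
have h2 : (s / (s + d c y)) `^ a <= 2 `^ a * (2 ^- i) `^ a.
  rewrite -powRM; [|lra|by rewrite invr_ge0 ltW].
  apply: ge0_ler_powR => //; rewrite ?nnegrE.
  - by rewrite divr_ge0// ltW.
  - by rewrite mulr_ge0// invr_ge0 ltW.
  by rewrite ler_pdivrMr// mulrAC ler_pdivlMr// mulrC.
have V0 := Vr_gt0 H c _ t0.
have V1 := Vr_gt0 H c (2 ^+ i * s) (mulr_gt0 i0 s0).
rewrite /bump; set v := Vr d mu (s + _) c in h1 V0 *.
set v' := Vr d mu _ c in h1 V1 *.
have h3 : v^-1 <= C1 * 2 `^ n * v'^-1.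
  by rewrite ler_pdivlMr// mulrC ler_pdivrMr// mulrC.
have -> : C1 * 2 `^ n * 2 `^ a * ((2 ^- i) `^ a * v'^-1) =
  (C1 * 2 `^ n * v'^-1) * (2 `^ a * (2 ^- i) `^ a) by ring.
by apply: ler_pM; rewrite ?powR_ge0 ?invr_ge0 ?(ltW V0).
Qed.

Lemma sizef_powR_le_dyadic p a : 0 <= p -> 0 <= a -> exists2 K, 1 <= K &
  forall c s y, 0 < s -> ((sizef d mu c s a y `^ p)%:E <= K%:E * dyadic p c s a y)%E.
Proof.
move=> p0 a0; have [K K1 HK] := sizef_le_dyadic_term a a0.
exists (K `^ p); first exact: powR_ge1.
move=> c s y s0; have [i [i1 i2]] := HK c s y s0.
have V1 := Vr_ge0 H c (2 ^+ i * s).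
apply: (@le_trans _ _ ((K `^ p)%:E * (dyadic_term p c s a i y)%:E)%E).
  rewrite -EFinM lee_fin /dyadic_term indicE mem_set// mulr1.
  apply: (@le_trans _ _ ((K * ((2 ^- i) `^ a * (Vr d mu (2 ^+ i * s) c)^-1)) `^ p)).
    apply: ge0_ler_powR; rewrite ?nnegrE ?(sizef_ge0 H)//.
    by rewrite !mulr_ge0 ?powR_ge0 ?invr_ge0//; lra.
  rewrite powRM; [|lra|by rewrite mulr_ge0 ?powR_ge0 ?invr_ge0].
  rewrite ler_wpM2l ?powR_ge0// powRM ?powR_ge0 ?invr_ge0// -powRrM.
  by rewrite -(powR_inv1 V1) -powRrM mulN1r.
rewrite lee_wpmul2l ?lee_fin ?powR_ge0//.
by apply: nneseries_ge_term => j; rewrite lee_fin dyadic_term_ge0.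
Qed.

(** The [i]-th term integrates to [(2 ^- i)]^ (a * p)[times the volume of the ball to the power]1 -
    p[. Doubling lets that volume power grow at most like]2 [^ (i * n * (1 - p))], so the integrals
    are dominated by a geometric series of ratio [q < 1] exactly because [n * (1 - p) < a * p]. *)
Lemma integral_dyadic_le p a : 0 < p <= 1 -> n * (1 - p) < a * p ->
  exists2 K, 1 <= K & forall c s, 0 < s ->
    (\int[mu]_y dyadic p c s a y <= (K * Vr d mu s c `^ (1 - p))%:E)%E.
Proof.
move=> /andP[p0 p1] ap; have C11 := ds_C1 H.
pose q : R := 2 `^ (- (a * p - n * (1 - p))).
have q0 : 0 <= q := powR_ge0 _ _.
have q1 : q < 1.
  rewrite /q powRN invf_lt1 ?powR_gt0//.
  rewrite ltNge; apply/negP => h; have : (2 : R) `^ 0 < 2 `^ (a * p - n * (1 - p)).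
    by rewrite /powR pnatr_eq0/= ltr_expR mul0r mulr_gt0 ?ln_gt0//; lra.
  by rewrite powRr0 ltNge h.
have qi : 1 <= (1 - q)^-1 by rewrite invf_ge1; lra.
exists (C1 `^ (1 - p) * (1 - q)^-1).
  by rewrite mulr_ege1// powR_ge1//; lra.
move=> c s s0; have V0 := Vr_gt0 H c s s0.
rewrite integral_nneseries//.
- have W0 : 0 <= C1 `^ (1 - p) * Vr d mu s c `^ (1 - p) by rewrite mulr_ge0 ?powR_ge0.
  apply: (@le_trans _ _ ((C1 `^ (1 - p) * Vr d mu s c `^ (1 - p))%:E *
      \sum_(i <oo) (q ^+ i)%:E)%E); last first.
    rewrite (_ : C1 `^ (1 - p) * (1 - q)^-1 * _ =
      (C1 `^ (1 - p) * Vr d mu s c `^ (1 - p)) * (1 - q)^-1); last by ring.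
    by rewrite [leRHS]EFinM lee_wpmul2l ?lee_fin ?nneseries_geometric_le ?q0.
  rewrite -nneseriesZl; last by move=> i _; rewrite lee_fin exprn_ge0.
  apply: lee_nneseries => [i _ _|i _].
    by apply: integral_ge0 => x _; rewrite lee_fin dyadic_term_ge0.
  have i0 : 0 < (2 : R) ^+ i by rewrite exprn_gt0.
  have i1 : 1 <= (2 : R) ^+ i by rewrite exprn_ege1//; lra.
  have Vi := Vr_gt0 H c (2 ^+ i * s) (mulr_gt0 i0 s0).
  set B := dball d c (2 ^+ i * s); have mB : measurable B := measurable_dball H _ _.
  set k := (2 ^- i) `^ (a * p) * Vr d mu (2 ^+ i * s) c `^ (- p).
  have -> : (\int[mu]_x (dyadic_term p c s a i x)%:E = k%:E * \int[mu]_x (\1_B x)%:E)%E.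
    rewrite -ge0_integralZl//.
    - exact/measurable_EFinP/measurable_indic.
    - by rewrite lee_fin mulr_ge0 ?powR_ge0.
  rewrite integral_indic// setIT (mu_dball H) -!EFinM lee_fin /k -mulrA.
  rewrite (_ : _ `^ (- p) * _ = Vr d mu (2 ^+ i * s) c `^ (1 - p)); last first.
    by rewrite mulrC powRD ?powRr1 ?ltW// (gt_eqF Vi) implybT.
  apply: (@le_trans _ _ ((2 ^- i) `^ (a * p) * (C1 * (2 ^+ i) `^ n * Vr d mu s c) `^ (1 - p))).
    rewrite ler_wpM2l ?powR_ge0//; apply: ge0_ler_powR; rewrite ?nnegrE; first by lra.
    - exact: ltW.
    - by rewrite !mulr_ge0 ?powR_ge0 ?(ltW V0)//; lra.
    by apply: (Vr_doubling H) => //; rewrite (dist_xx H); lra.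
  rewrite powRM; [|by rewrite mulr_ge0 ?powR_ge0//; lra|exact: ltW].
  rewrite powRM; [|lra|exact: powR_ge0].
  rewrite le_eqVlt; apply/orP; left; apply/eqP.
  have -> : q ^+ i = (2 ^- i) `^ (a * p) * ((2 ^+ i) `^ n) `^ (1 - p).
    rewrite -powR_mulrn// -powR_mulrn; last lra.
    rewrite -powRN /q -!powRrM -powRD; last by rewrite (_ : 2 == 0 = false) ?implybT//; apply/eqP; lra.
    by congr (_ `^ _); ring.
  by ring.
- by move=> i; exact: measurable_dyadic_term.
- by move=> i x _; rewrite lee_fin dyadic_term_ge0.
Qed.

(** The case [p = 1], in which the volume drops out. Two size functions are allowed because the
    oscillation estimate used for cancellation produces a sum with different centres and scales. *)
Lemma integrable_le_sizef a : 0 < a -> exists2 K, 1 <= K &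
  forall (f : X -> R) c s c' s' A A', 0 < s -> 0 < s' -> 0 <= A -> 0 <= A' ->
    measurable_fun [set: X] f ->
    (forall y, `|f y| <= A * sizef d mu c s a y + A' * sizef d mu c' s' a y) ->
    mu.-integrable [set: X] (EFin \o f) /\
    Rintegral mu [set: X] (fun y => `|f y|) <= K * (A + A').
Proof.
move=> a0; have [K K1 HK] := sizef_powR_le_dyadic 1 a ltac:(lra) (ltW a0).
have [K' K'1 HK'] := integral_dyadic_le 1 a ltac:(lra) ltac:(lra).
exists (K * K'); first exact: mulr_ege1.
move=> f c s c' s' A A' s0 s'0 A0 A'0 mf fA.
pose D y : \bar R := ((A * K)%:E * dyadic 1 c s a y + (A' * K)%:E * dyadic 1 c' s' a y)%E.
have AK : (0 <= (A * K)%:E)%E by rewrite lee_fin mulr_ge0//; lra.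
have A'K : (0 <= (A' * K)%:E)%E by rewrite lee_fin mulr_ge0//; lra.
have fD y : ((`|f y|)%:E <= D y)%E.
  apply: (@le_trans _ _ ((A * sizef d mu c s a y + A' * sizef d mu c' s' a y)%:E)).
    by rewrite lee_fin.
  rewrite EFinD leeD// !EFinM -muleA lee_wpmul2l ?lee_fin//.
    by have := HK c s y s0; rewrite powRr1// (sizef_ge0 H).
  by have := HK c' s' y s'0; rewrite powRr1// (sizef_ge0 H).
have mD1 : measurable_fun [set: X] (fun y => (A * K)%:E * dyadic 1 c s a y)%E.
  exact/measurable_funeM/measurable_dyadic.
have mD2 : measurable_fun [set: X] (fun y => (A' * K)%:E * dyadic 1 c' s' a y)%E.
  exact/measurable_funeM/measurable_dyadic.
have iD : (\int[mu]_y D y <= (K * K' * (A + A'))%:E)%E.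
  rewrite ge0_integralD//; last 2 first.
  - by move=> x _; rewrite mule_ge0// dyadic_ge0.
  - by move=> x _; rewrite mule_ge0// dyadic_ge0.
  rewrite !ge0_integralZl//; try exact: measurable_dyadic;
    try by move=> x _; exact: dyadic_ge0.
  have := HK' c s s0; have := HK' c' s' s'0; rewrite subrr !powRr0 mulr1 => h2 h1.
  rewrite (_ : K * K' * (A + A') = A * K * K' + A' * K * K'); last by ring.
  by rewrite EFinD; apply: leeD; rewrite [leRHS]EFinM lee_wpmul2l.
have ifD : (\int[mu]_y (`|f y|)%:E <= (K * K' * (A + A'))%:E)%E.
  apply: le_trans iD; apply: ge0_le_integral => //.
  - exact/measurable_EFinP/measurableT_comp.
  - exact: emeasurable_funD.
have iff : mu.-integrable [set: X] (EFin \o f).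
  apply/integrableP; split; first exact/measurable_EFinP.
  by under eq_integral do rewrite abse_EFin; apply: (le_lt_trans ifD); rewrite ltry.
split => //; rewrite -lee_fin /Rintegral fineK//.
rewrite ge0_fin_numE; last by apply: integral_ge0 => y _; rewrite lee_fin.
by apply: (le_lt_trans ifD); rewrite ltry.
Qed.

End Dyadic.

(** * Subadditivity of powers, and integrals of functions that need not be measurable *)

Lemma powR_subadd {R : realType} (p a b : R) : 0 < p <= 1 -> 0 <= a -> 0 <= b ->
  (a + b) `^ p <= a `^ p + b `^ p.
Proof.
case/andP=> p0 p1 a0 b0.
have [ab0|ab_neq0] := eqVneq (a + b) 0.
  by rewrite ab0 powR0 ?gt_eqF// addr_ge0 ?powR_ge0.
have ab : 0 < a + b by rewrite lt_neqAle eq_sym ab_neq0 addr_ge0.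
(* A fraction in [0, 1] is at most its [p]-th power. Applied to the shares of [a] and [b] in
   [a + b], which add up to 1, this gives subadditivity. *)
have h c : 0 <= c -> c <= a + b -> (a + b) `^ p * (c / (a + b)) <= c `^ p.
  move=> c0 cab; have r : 0 <= c / (a + b) <= 1.
    by rewrite divr_ge0 ?(ltW ab)//= ler_pdivrMr// mul1r.
  have : c / (a + b) <= (c / (a + b)) `^ p.
    by rewrite -[leLHS]powRr1; [exact: ler_powR_le1|case/andP: r].
  move=> h; apply: (le_trans (ler_wpM2l (powR_ge0 _ _) h)).
  by rewrite -powRM ?(ltW ab)//; [rewrite mulrC divfK|case/andP: r].
have -> : (a + b) `^ p = (a + b) `^ p * (a / (a + b)) + (a + b) `^ p * (b / (a + b)).
  by rewrite -mulrDr -mulrDl divff// mulr1.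
by apply: lerD; apply: h => //; lra.
Qed.

Lemma powR_sum_le {R : realType} (p : R) (u : nat -> R) N : 0 < p <= 1 ->
  (forall i, 0 <= u i) -> (\sum_(0 <= i < N) u i) `^ p <= \sum_(0 <= i < N) u i `^ p.
Proof.
move=> p01 u0; elim: N => [|N IH].
  by rewrite !big_geq// powR0//; case/andP: p01 => p0 _; rewrite gt_eqF.
rewrite !big_nat_recr//=; apply: (le_trans (powR_subadd p _ _ p01 _ _)) => //.
  exact: sumr_ge0.
by rewrite lerD2r.
Qed.

(* Below, the grand maximal function need not be measurable: its integral is a lower integral,
   which is monotone but in general only superadditive. *)
Section LowerIntegral.
Import HBNNSimple.
Context {R : realType} {dX : measure_display} {X : measurableType dX}.
Context (mu : {measure set X -> \bar R}).
Local Open Scope ereal_scope.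

Lemma le_lower_integral (f g : X -> \bar R) :
  (forall x, 0 <= f x) -> (forall x, f x <= g x) ->
  \int[mu]_x f x <= \int[mu]_x g x.
Proof.
move=> f0 fg; have g0 x : 0 <= g x := le_trans (f0 x) (fg x).
rewrite !ge0_integralTE//; apply: le_ereal_sup => _ [h hf <-].
by exists h => // x; apply: le_trans (hf x) (fg x).
Qed.

(** Measurability of one summand is enough: for a simple function [s] below [g + h], the positive
    part [t] of [s - h] is measurable and below [g], and [s <= t + h] has a genuinely additive
    right-hand side. *)
Lemma le_lower_integralD (f g h : X -> \bar R) :
  (forall x, 0 <= f x) -> (forall x, 0 <= g x) -> (forall x, 0 <= h x) ->
  measurable_fun [set: X] h -> (forall x, f x <= g x + h x) ->
  \int[mu]_x f x <= \int[mu]_x g x + \int[mu]_x h x.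
Proof.
move=> f0 g0 h0 mh fgh; rewrite [leLHS]ge0_integralTE//.
apply: ge_ereal_sup => _ [s sf <-].
pose t x : \bar R := maxe ((s x)%:E - h x) 0.
have ms : measurable_fun [set: X] (fun x => (s x)%:E).
  exact/measurable_EFinP.
have mt : measurable_fun [set: X] t.
  by apply: measurable_maxe => //; exact: emeasurable_funB.
have t0 x : 0 <= t x by rewrite /t le_max lexx orbT.
have tg x : t x <= g x.
  rewrite /t ge_max g0 andbT.
  have := le_trans (sf x) (fgh x); have := h0 x; have := g0 x.
  case: (h x) => [hx| |]//=; case: (g x) => [gx| |]//=; rewrite ?leey ?leNye//.
  by rewrite -EFinD -EFinB !lee_fin => _ _; lra.
have sth x : (s x)%:E <= t x + h x.
  rewrite /t; have := h0 x; case: (h x) => [hx| |]//= _.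
    rewrite -EFinB -EFin_max -EFinD lee_fin.
    have : ((s x - hx)%R <= Num.max (s x - hx) 0)%R by rewrite le_max lexx.
    by lra.
  by rewrite addey ?leey//; apply/negP => /eqP; case: leP.
have -> : sintegral mu s = \int[mu]_x (s x)%:E by rewrite integral_nnsfun// patch_setT.
apply: (@le_trans _ _ (\int[mu]_x (t x + h x))).
  by apply: le_lower_integral => // x; rewrite lee_fin.
rewrite ge0_integralD//; apply: leeD => //; exact: le_lower_integral.
Qed.

End LowerIntegral.

(** * Separated nets *)

Section Nets.
Context {R : realType} {dX : measure_display} {X : measurableType dX}.
Context {d : X -> X -> R} {mu : {measure set X -> \bar R}} {n C1 : R}.
Context (H : doubling_space d mu n C1).
Implicit Types (x y z c : X) (s r a : R).

Lemma measurable_continuous (f : X -> R) :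
  (forall y e, 0 < e -> exists2 h, 0 < h & forall z, d y z < h -> `|f z - f y| < e) ->
  measurable_fun [set: X] f.
Proof.
move=> cf mD; apply: (measurability _ (RGenOInfty.measurableE R)) => //.
move=> /= _ [_ [a ->] <-]; rewrite setTI; apply: (measurable_open H) => y /=.
rewrite in_itv/= andbT => ay; have [h h0 hf] := cf y (f y - a) ltac:(lra).
exists h => // z yz /=; rewrite in_itv/= andbT.
by have := hf z yz; rewrite ltr_norml => /andP[? _]; lra.
Qed.

(** A volume count: the balls of radius [h / 2] about the points are disjoint and lie in one ball of
    finite measure, while doubling bounds each of their volumes below by a fixed fraction of that of
    [dball d c 1]. *)
Lemma separated_seq_unbounded (f : nat -> X) c rho h : 0 < h ->
  (forall i j, i <> j -> h <= d (f i) (f j)) -> ~ (forall i, d c (f i) < rho).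
Proof.
move=> h0 fh frho.
have rho0 : 0 < rho by apply: le_lt_trans (frho 0%N); exact: (dist_ge0 H).
pose A := Num.max 1 ((1 + rho) / (h / 2)).
have h20 : 0 < h / 2 by rewrite divr_gt0.
have A1 : 1 <= A by rewrite le_max lexx.
have A2 : 1 + rho <= A * (h / 2) by rewrite -ler_pdivrMr// le_max lexx orbT.
pose K := C1 * A `^ n.
have K0 : 0 < K by rewrite mulr_gt0 ?powR_gt0//; [have := ds_C1 H|]; lra.
have V1 := Vr_gt0 H c 1 ltac:(lra).
have vB i : Vr d mu 1 c / K <= Vr d mu (h / 2) (f i).
  rewrite ler_pdivrMr// mulrC; apply: (Vr_doubling H) => //.
  by have := frho i; lra.
pose N := (Num.truncn (Vr d mu (rho + h) c / (Vr d mu 1 c / K))).+1.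
have : (mu (\big[setU/set0]_(i < N) dball d (f i) (h / 2)) <= mu (dball d c (rho + h)))%E.
  apply: le_measure; rewrite ?inE; try exact: (measurable_dball H).
    by apply: bigsetU_measurable => i _; exact: (measurable_dball H).
  move=> y /(@bigsetU_bigcup _ (fun i => dball d (f i) (h / 2)) N)[i _]; rewrite /dball /= => iy.
  by have := dist_triangle H c (f i) y; have := frho i; lra.
have tB : trivIset [set: nat] (fun i => dball d (f i) (h / 2)).
  apply/trivIsetP => i j _ _ ij; apply/seteqP; split => // y []; rewrite /dball /= => iy jy.
  have := fh i j (elimN eqP ij); have := dist_triangle H (f i) y (f j).
  by rewrite (distC H y (f j)); lra.
rewrite (measure_bigsetU mu (fun i => measurable_dball H (f i) (h / 2)) tB N).
rewrite (eq_bigr (fun i : 'I_N => (Vr d mu (h / 2) (f i))%:E)); last first.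
  by move=> i _; exact: (mu_dball H).
rewrite sumEFin (mu_dball H) lee_fin => hN.
have : \sum_(i < N) (Vr d mu 1 c / K) <= Vr d mu (rho + h) c.
  by apply: le_trans hN; apply: ler_sum.
rewrite sumr_const card_ord -mulr_natl -ler_pdivlMr ?divr_gt0//.
by rewrite leNgt truncnS_gt.
Qed.

Lemma infinite_set_seq (T : pointedType) (A : set T) : infinite_set A ->
  exists f : nat -> T, injective f /\ forall i, A (f i).
Proof.
move=> /infiniteP /pcard_leP /unsquash f; exists f; split.
  by move=> i j; apply: (@inj _ _ _ f); rewrite inE.
by move=> i; exact: (@funS _ _ _ _ f).
Qed.

(** A maximal separated set, given by Zorn's lemma, covers by maximality. The volume count makes it
    finite in every ball, hence countable; it is infinite because otherwise the space would be a
    ball, of finite measure. It can therefore be enumerated by [nat], and the last clause expresses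
    its local finiteness. *)
Lemma exists_net h (x1 : X) : mu [set: X] = +oo%E -> 0 < h ->
  exists w : nat -> X, (forall i j, i <> j -> h <= d (w i) (w j)) /\
    (forall x, exists j, d (w j) x < h) /\
    (forall c rho, exists J, forall j, (J <= j)%N -> rho <= d c (w j)).
Proof.
move=> muX h0; pose sep (A : set X) := forall x y, A x -> A y -> x <> y -> h <= d x y.
have [|D [sepD maxD]] := @Zorn_bigcup X sep.
  move=> F Fsep Ftot x y [A FA Ax] [B FB By].
  have [AB|BA] := Ftot A B FA FB; first by apply: (Fsep B) => //; exact: AB.
  by apply: (Fsep A) => //; exact: BA.
have covD x : exists2 y, D y & d y x < h.
  have [Dx|Dx] := pselect (D x); first by exists x; rewrite ?(dist_xx H).
  apply: contrapT => hx; apply: (maxD (D `|` [set x])).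
    split; first by move=> y; left.
    by move=> /(_ x (or_intror erefl)).
  have far y : D y -> h <= d y x by move=> Dy; rewrite leNgt; apply/negP => yx; apply: hx; exists y.
  move=> y z [Dy|->] [Dz|->] yz //; [exact: sepD|exact: far|].
  by rewrite (distC H); exact: far.
have finD c rho : finite_set (D `&` dball d c rho).
  apply: contrapT => /infinite_set_seq[f [finj fD]].
  apply: (separated_seq_unbounded f c rho h h0).
    by move=> i j ij; apply: sepD; [case: (fD i)|case: (fD j)|move=> /finj].
  by move=> i; case: (fD i).
have cntD : countable D.
  rewrite (_ : D = \bigcup_(k in [set: nat]) (D `&` dball d x1 k%:R)).
    by apply: bigcup_countable => // k _; exact: finite_set_countable.
  apply/seteqP; split => [x Dx|x [k _ []]//].
  exists (Num.truncn (d x1 x)).+1 => //; split => //.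
  by rewrite /dball /=; exact: truncnS_gt.
have infD : ~ finite_set D.
  move=> /finite_seqP[s Ds].
  have [rho srho] : exists rho, forall y, y \in s -> d x1 y <= rho.
    elim: s {Ds} => [|y s [rho IH]]; first by exists 0.
    exists (Num.max rho (d x1 y)) => z; rewrite inE => /orP[/eqP ->|/IH].
      by rewrite le_max lexx orbT.
    by move=> h'; rewrite le_max h'.
  have : [set: X] = dball d x1 (rho + h).
    apply/seteqP; split => // x _; have [y Dy yx] := covD x; rewrite /dball /=.
    have := srho y; rewrite Ds /= in Dy; move=> /(_ Dy).
    by have := dist_triangle H x1 y x; lra.
  by move=> XB; have := muX; rewrite XB (mu_dball H).
have /card_esym/pcard_eqP/unsquash w := eq_card_nat cntD infD.
have winj : injective w by move=> i j; apply: (@inj _ _ _ w); rewrite inE.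
have wD i : D (w i) by exact: (@funS _ _ _ _ w).
exists w; split; first by move=> i j ij; apply: sepD => //; move=> /winj.
split.
  move=> x; have [y Dy yx] := covD x.
  have [j _ wj] := @surj _ _ _ _ w y Dy.
  by exists j; rewrite wj.
move=> c rho.
have : finite_set (w @^-1` dball d c rho).
  apply: contrapT => /infinite_set_seq[f [finj fD]].
  apply: (separated_seq_unbounded (w \o f) c rho h h0) => //.
  by move=> i j ij; apply: sepD; [exact: wD|exact: wD|move=> /winj /finj].
move=> /finite_seqP[s Hs]; exists (\max_(i <- s) i).+1%N => j Jj.
rewrite leNgt; apply/negP => wj.
have : j \in s by have : [set` s] j by rewrite -Hs.
move=> js; have : (j <= \max_(i <- s) i)%N by exact: leq_bigmax_seq.
by rewrite leqNgt Jj.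
Qed.

Lemma measurable_seqDU_dball (w : nat -> X) s j :
  measurable (seqDU (fun i => dball d (w i) s) j).
Proof.
apply: measurableD; first exact: (measurable_dball H).
by apply: bigsetU_measurable => i _; exact: (measurable_dball H).
Qed.

End Nets.

(** * The closure [G0], its dual, and truncation *)

Section Duality.
Context {R : realType} {dX : measure_display} {X : measurableType dX}.
Context {d : X -> X -> R} {mu : {measure set X -> \bar R}} {n C1 : R}.
Context (H : doubling_space d mu n C1).
Implicit Types (x y z c : X) (s r a : R).

Lemma Gnorm_le c s b a f C : Gbound d mu c s b a f C -> Gnorm d mu c s b a f <= C.
Proof. by move=> fC; apply: ge_inf => //; exists 0 => B []. Qed.

(** The strict inequality makes it unnecessary to know that the infimum is attained. The hypothesis
    [inG] excludes the empty set, whose [inf] is 0 by convention. *)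
Lemma Gbound_gt_Gnorm c s b a f C : 0 < s -> inG d mu c s b a f ->
  Gnorm d mu c s b a f < C -> Gbound d mu c s b a f C.
Proof.
move=> s0 [B fB] fC.
have : has_inf [set C | Gbound d mu c s b a f C].
  by split; [exists B|exists 0 => D []].
move=> /(inf_adherent (eps := C - Gnorm d mu c s b a f)).
rewrite subr_gt0 => /(_ fC)[D fD]; rewrite /Gnorm addrC subrK => /ltW DC.
exact: (Gbound_le H _ _ _ _ _ _ _ s0 DC fD).
Qed.

Lemma Gbound0 c s b a : Gbound d mu c s b a (fun=> 0) 0.
Proof. by split => //; split => [y|y z _]; rewrite ?subrr normr0 !mul0r. Qed.

Context {x1 : X} {eps beta gam : R}.

(** The Lipschitz constant [1 / N] matches the radius of the support, so that multiplication by it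
    is bounded on test functions uniformly in large [N]. *)
Definition cutoff (N : R) y : R := Num.max 0 (Num.min 1 (2 - d x1 y / N)).

Lemma cutoff01 N y : 0 <= cutoff N y <= 1.
Proof. by rewrite /cutoff le_max lexx/= ge_max ler01 ge_min lexx. Qed.

Lemma max_min_lipschitz (u v : R) :
  `|Num.max 0 (Num.min 1 u) - Num.max 0 (Num.min 1 v)| <= `|u - v|.
Proof.
rewrite ler_norml; have := ler_norm (u - v); have := ler_norm (v - u).
rewrite (distrC v u); set D := `|u - v|; move=> h1 h2.
apply/andP; split; rewrite !maxEle !minEle; do !case: ifPn => //; rewrite -?ltNge; lra.
Qed.

Lemma dist_lipschitz c y z : `|d c z - d c y| <= d y z.
Proof.
rewrite ler_norml; have := dist_triangle H c y z; have := dist_triangle H c z y.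
by rewrite (distC H z y); lra.
Qed.

Lemma cutoff_lipschitz N y z : 0 < N -> `|cutoff N z - cutoff N y| <= d y z / N.
Proof.
move=> N0; apply: (le_trans (max_min_lipschitz _ _)).
have -> : 2 - d x1 z / N - (2 - d x1 y / N) = - ((d x1 z - d x1 y) / N) by ring.
rewrite normrN normrM normfV (gtr0_norm N0) ler_wpM2r ?invr_ge0 ?(ltW N0)//.
exact: dist_lipschitz.
Qed.

Lemma cutoff_support N y : 0 < N -> cutoff N y != 0 -> d x1 y <= 2 * N.
Proof.
move=> N0; apply: contraR; rewrite -ltNge => yN; rewrite /cutoff.
have h : 2 - d x1 y / N <= 0 by rewrite subr_le0 ler_pdivlMr// ltW.
by apply/eqP/max_idPl; rewrite ge_min h orbT.
Qed.

Lemma cutoff1 N y : 0 < N -> d x1 y <= N -> cutoff N y = 1.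
Proof.
move=> N0 yN; rewrite /cutoff.
have h' : d x1 y / N <= 1 by rewrite ler_pdivrMr ?mul1r.
have h : 1 <= 2 - d x1 y / N by lra.
by rewrite (min_idPl h); apply/max_idPr.
Qed.

Context (b0 : 0 < beta) (be : beta <= eps) (e1 : eps <= 1) (ge : gam < eps).

Lemma Gbound_eps c s f C : 0 < s ->
  Gbound d mu c s eps eps f C -> Gbound d mu c s beta gam f C.
Proof. by move=> s0; apply: (Gbound_exp H) => //; exact: ltW. Qed.

Let Gtest := G0 d mu x1 eps beta gam.

Lemma inG_G0 f : inG d mu x1 1 eps eps f -> Gtest f.
Proof.
move=> fG; have [C fC] := fG; split; first by exists C; exact: Gbound_eps.
move=> e e0; exists f => //; apply: (@le_lt_trans _ _ 0) => //.
apply: Gnorm_le.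
have -> : f \- f = (fun=> 0) by apply/funext => y /=; ring.
exact: Gbound0.
Qed.

Lemma G0_lin k k' f g : Gtest f -> Gtest g -> Gtest (fun y => k * f y + k' * g y).
Proof.
move=> [[Cf fC] fA] [[Cg gC] gA]; split.
  by exists (`|k| * Cf + `|k'| * Cg); exact: Gbound_lin.
move=> e e0; pose e' := e / (2 * (`|k| + `|k'| + 1)).
have D0 : 0 < `|k| + `|k'| + 1 by have := normr_ge0 k; have := normr_ge0 k'; lra.
have e'0 : 0 < e' by rewrite divr_gt0// mulr_gt0.
have [f' [Cf' f'C] ff'] := fA e' e'0; have [g' [Cg' g'C] gg'] := gA e' e'0.
exists (fun y => k * f' y + k' * g' y).
  by exists (`|k| * Cf' + `|k'| * Cg'); exact: Gbound_lin.
have sub u C u' C' : Gbound d mu x1 1 beta gam u C -> Gbound d mu x1 1 eps eps u' C' ->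
    inG d mu x1 1 beta gam (u \- u').
  move=> h h'; exists (`|1| * C + `|-1| * C').
  have -> : u \- u' = (fun y => 1 * u y + (-1) * u' y) by apply/funext => y /=; ring.
  by apply: Gbound_lin => //; exact: Gbound_eps.
have hf : Gbound d mu x1 1 beta gam (f \- f') e' by apply: Gbound_gt_Gnorm => //; exact: sub fC f'C.
have hg : Gbound d mu x1 1 beta gam (g \- g') e' by apply: Gbound_gt_Gnorm => //; exact: sub gC g'C.
apply: (@le_lt_trans _ _ (`|k| * e' + `|k'| * e')).
  apply: Gnorm_le.
  rewrite (_ : (fun y => k * f y + k' * g y) \- (fun y => k * f' y + k' * g' y) =
    (fun y => k * (f \- f') y + k' * (g \- g') y)); last by apply/funext => y /=; ring.
  exact: Gbound_lin.
rewrite -mulrDl /e' mulrA ltr_pdivrMr ?mulr_gt0//.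
have : 0 <= `|k| + `|k'| by rewrite addr_ge0.
by nra.
Qed.

Lemma G0_0 : Gtest (fun=> 0).
Proof. by apply: inG_G0; exists 0; exact: Gbound0. Qed.

Lemma G0_sum (F : nat -> X -> R) N : (forall i, Gtest (F i)) ->
  Gtest (fun y => \sum_(0 <= i < N) F i y).
Proof.
move=> FG; elim: N => [|N IH].
  rewrite (_ : (fun y => _) = fun=> 0); first exact: G0_0.
  by apply/funext => y; rewrite big_geq.
rewrite (_ : (fun y => _) = (fun y => 1 * (\sum_(0 <= i < N) F i y) + 1 * F N y)).
  exact: G0_lin.
by apply/funext => y; rewrite big_nat_recr//= !mul1r.
Qed.

(** Multiplication by [k] is bounded in both norms, so it maps approximants from G(x1, 1, eps, eps)
    to approximants. *)
Lemma G0_mul_cutoff f k rho Lk : Gtest f -> 0 < Lk ->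
  (forall y, 0 <= k y <= 1) -> (forall y z, `|k z - k y| <= d y z / Lk) ->
  (forall y, k y != 0 -> d x1 y <= rho) -> Gtest (fun y => f y * k y).
Proof.
move=> [[C fC] fA] L0 k01 kL krho.
pose A := Num.max 1 ((1 + rho) / Lk); pose K := 1 + 2 * A.
have A1 : 1 <= A by rewrite le_max lexx.
have A2 : 1 + d x1 x1 + rho <= A * Lk.
  by rewrite (dist_xx H) addr0 -ler_pdivrMr// le_max lexx orbT.
have K0 : 0 < K by rewrite /K; lra.
have mul b a u B : 0 < b <= 1 -> Gbound d mu x1 1 b a u B ->
    Gbound d mu x1 1 b a (fun y => u y * k y) (K * B).
  by move=> b01 uB; apply: (Gbound_mul_cutoff H A x1 1 b a u B k x1 rho Lk) => //; lra.
have b01 : 0 < beta <= 1 by rewrite b0 (le_trans be).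
have e01 : 0 < eps <= 1 by rewrite (lt_le_trans b0 be).
split; first by exists (K * C); exact: mul.
move=> e e0; have [|g [Cg gC] fg] := fA (e / (2 * K)).
  by rewrite divr_gt0// mulr_gt0.
exists (fun y => g y * k y); first by exists (K * Cg); exact: mul.
have hfg : Gbound d mu x1 1 beta gam (f \- g) (e / (2 * K)).
  apply: Gbound_gt_Gnorm => //; exists (`|1| * C + `|-1| * Cg).
  have -> : f \- g = (fun y => 1 * f y + (-1) * g y) by apply/funext => y /=; ring.
  by apply: Gbound_lin => //; exact: Gbound_eps.
apply: (@le_lt_trans _ _ (K * (e / (2 * K)))).
  apply: Gnorm_le; rewrite (_ : _ \- _ = (fun y => (f \- g) y * k y)).
    exact: mul.
  by apply/funext => y /=; ring.
have -> : K * (e / (2 * K)) = e / 2 by field; lra.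
by lra.
Qed.

Context {L : (X -> R) -> R} (dL : in_dual d mu x1 eps beta gam L).

Lemma dual_bound : exists2 M, 0 < M & forall f C, Gtest f ->
  Gbound d mu x1 1 beta gam f C -> `|L f| <= M * C.
Proof.
have [_ [M HM]] := dL; exists (`|M| + 1) => [|f C fG fC].
  by have := normr_ge0 M; lra.
have C0 : 0 <= C by case: fC.
have N0 : 0 <= Gnorm d mu x1 1 beta gam f.
  apply: lb_le_inf; first by exists C.
  by move=> B [].
apply: (le_trans (HM f fG)); apply: (@le_trans _ _ ((`|M| + 1) * Gnorm d mu x1 1 beta gam f)).
  by rewrite ler_wpM2r//; have := ler_norm M; lra.
by rewrite ler_wpM2l ?Gnorm_le//; have := normr_ge0 M; lra.
Qed.

Lemma dual_lin k k' f g : Gtest f -> Gtest g ->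
  L (fun y => k * f y + k' * g y) = k * L f + k' * L g.
Proof. by case: dL => + _; exact. Qed.

Lemma dual_sub f g : Gtest f -> Gtest g -> L (fun y => f y - g y) = L f - L g.
Proof.
move=> fG gG; rewrite (_ : (fun y => _) = (fun y => 1 * f y + (-1) * g y)).
  by rewrite dual_lin// mul1r mulN1r.
by apply/funext => y; rewrite mul1r mulN1r.
Qed.

Lemma G0_sub f g : Gtest f -> Gtest g -> Gtest (fun y => f y - g y).
Proof.
move=> fG gG; rewrite (_ : (fun y => _) = (fun y => 1 * f y + (-1) * g y)).
  exact: G0_lin.
by apply/funext => y; rewrite mul1r mulN1r.
Qed.

Lemma dual_sum (F : nat -> X -> R) N : (forall i, Gtest (F i)) ->
  L (fun y => \sum_(0 <= i < N) F i y) = \sum_(0 <= i < N) L (F i).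
Proof.
move=> FG; elim: N => [|N IH].
  rewrite big_geq// (_ : (fun y => _) = (fun y => 0 * 0 + 0 * 0)).
    by rewrite (dual_lin 0 0 (fun=> 0) (fun=> 0)) ?mul0r ?addr0//; exact: G0_0.
  by apply/funext => y; rewrite big_geq// mul0r addr0.
rewrite big_nat_recr//= -IH (_ : (fun y => _) =
    (fun y => 1 * (\sum_(0 <= i < N) F i y) + 1 * F N y)).
  by rewrite (dual_lin 1 1 (fun y => \sum_(0 <= i < N) F i y) (F N)) ?mul1r//; exact: G0_sum.
by apply/funext => y; rewrite big_nat_recr//= !mul1r.
Qed.

Lemma G0_cutoff f N : 0 < N -> Gtest f -> Gtest (fun y => f y * cutoff N y).
Proof.
move=> N0 fG; apply: (G0_mul_cutoff _ _ (2 * N) N fG N0).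
- exact: cutoff01.
- by move=> y z; exact: cutoff_lipschitz.
- by move=> y; exact: cutoff_support.
Qed.

Lemma Gbound_cutoff c s b a f C N : 0 < s -> 0 < b <= 1 -> s + d c x1 <= N ->
  Gbound d mu c s b a f C -> Gbound d mu c s b a (fun y => f y * cutoff N y) (7 * C).
Proof.
move=> s0 b01 sN fC; have N0 : 0 < N by have := dist_ge0 H c x1; lra.
(* [A = 3]: the support has radius [2 * N], and [s + d c x1] is at most [N]. *)
have -> : 7 * C = (1 + 2 * 3) * C by ring.
apply: (Gbound_mul_cutoff H 3 c s b a f C _ x1 (2 * N) N) => //; try lra.
- exact: cutoff01.
- by move=> y z; exact: cutoff_lipschitz.
- by move=> y; exact: cutoff_support.
Qed.

(** Split [f] as [(f - g) + g] with [g] in G(x1, 1, eps, eps). Truncation acts on the small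
    difference with a norm independent of [N], and the removed tail of [g] is small in the norm with
    decay [gam < eps] by [Gbound_tail]. *)
Lemma dual_cutoff_limit f e : Gtest f -> 0 < e ->
  exists N0, forall N, N0 <= N -> `|L f - L (fun y => f y * cutoff N y)| <= e.
Proof.
move=> fG e0; have [M M0 HM] := dual_bound; have [[C fC] fA] := fG.
have [|g [Cg gC] fg] := fA (e / (16 * M)); first by rewrite divr_gt0// mulr_gt0.
have gG : Gtest g by apply: inG_G0; exists Cg.
have Cg0 : 0 <= Cg by case: gC.
have eg : 0 < eps - gam by rewrite subr_gt0.
pose t := e / (16 * M * (Cg + 1)).
have t0 : 0 < t by rewrite divr_gt0// !mulr_gt0//; lra.
pose T := t `^ (eps - gam)^-1; have T0 : 0 < T by rewrite powR_gt0.
exists (1 + 2 / T) => N TN.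
have T2 : 0 < 2 / T by rewrite divr_gt0.
have N1 : 1 <= N by lra.
have N0 : 0 < N by lra.
have e01 : 0 < eps <= 1 by rewrite (lt_le_trans b0 be).
have b01 : 0 < beta <= 1 by rewrite b0 (le_trans be).
have cut b u B : 0 < b <= 1 -> forall a, Gbound d mu x1 1 b a u B ->
    Gbound d mu x1 1 b a (fun y => u y - u y * cutoff N y) (8 * B).
  move=> b1 a uB.
  have -> : (fun y => u y - u y * cutoff N y) = (fun y => 1 * u y + (-1) * (u y * cutoff N y)).
    by apply/funext => y; ring.
  have -> : 8 * B = `|1| * B + `|-1| * (7 * B) by rewrite normrN normr1; ring.
  apply: Gbound_lin => //; apply: Gbound_cutoff => //.
  by rewrite (dist_xx H) addr0.
have hfg : Gbound d mu x1 1 beta gam (fun y => f y - g y) (e / (16 * M)).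
  apply: Gbound_gt_Gnorm => //; exists (`|1| * C + `|-1| * Cg).
  have -> : (fun y => f y - g y) = (fun y => 1 * f y + (-1) * g y) by apply/funext => y /=; ring.
  by apply: Gbound_lin => //; exact: Gbound_eps.
have fgG := G0_sub _ _ fG gG.
have := cut _ _ _ b01 _ hfg => /(HM _ _ (G0_sub _ _ fgG (G0_cutoff _ _ N0 fgG))) h1.
have /(Gbound_tail H x1 1 beta gam eps _ (8 * Cg) N ltac:(lra) b0 be (ltW ge) (ltW N0)) h2 :=
  cut _ _ _ e01 _ gC.
have {}h2 := h2 ltac:(by move=> y /ltW yN; rewrite cutoff1// mulr1 subrr).
have h3 := HM _ _ (G0_sub _ _ gG (G0_cutoff _ _ N0 gG)) h2.
rewrite -dual_sub//; last exact: G0_cutoff.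
have -> : (fun y => f y - f y * cutoff N y) =
   (fun y => 1 * (f y - g y - (f y - g y) * cutoff N y) + 1 * (g y - g y * cutoff N y)).
  by apply/funext => y; ring.
rewrite (dual_lin 1 1 (fun y => f y - g y - (f y - g y) * cutoff N y)
  (fun y => g y - g y * cutoff N y)); last 2 first.
- exact: (G0_sub _ _ fgG (G0_cutoff _ _ N0 fgG)).
- exact: (G0_sub _ _ gG (G0_cutoff _ _ N0 gG)).
rewrite !mul1r; apply: (le_trans (ler_normD _ _)).
have -> : e = M * (8 * (e / (16 * M))) + e / 2 by field; lra.
apply: lerD; first exact: h1.
apply: (le_trans h3).
have : (2 * 1 / (1 + N)) `^ (eps - gam) <= t.
  have -> : t = T `^ (eps - gam).
    by rewrite /T -powRrM mulVf ?gt_eqF// powRr1// ltW.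
  apply: ge0_ler_powR; rewrite ?nnegrE ?(ltW eg) ?(ltW T0)//.
    by rewrite divr_ge0; lra.
  rewrite mulr1 ler_pdivrMr; last lra.
  have : 2 / T <= 1 + N by lra.
  by rewrite ler_pdivrMr// mulrC.
set q := _ `^ _ => qt.
have q0 : 0 <= q := powR_ge0 _ _.
have : M * (8 * Cg * q) <= M * (8 * (Cg + 1) * t).
  by rewrite ler_wpM2l ?(ltW M0)//; apply: ler_pM => //; lra.
move=> h4; apply: (le_trans h4); rewrite /t le_eqVlt; apply/orP; left; apply/eqP.
by field; apply/andP; split; lra.
Qed.

End Duality.
Arguments cutoff {R dX X} d x1 N y.

(** * The kernel at one scale: its regularity, and the exchange of the functional with integrals *)

Lemma le_interpolate {R : realType} (t B p q th : R) : 0 < t -> 0 <= B -> 0 <= p -> 0 <= q ->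
  0 <= th <= 1 -> t <= B * p -> t <= B * q -> t <= B * (p `^ th * q `^ (1 - th)).
Proof.
move=> t0 B0 p0 q0 /andP[th0 th1] tp tq.
have Bgt0 : 0 < B.
  by rewrite lt_neqAle B0 andbT; apply/eqP => B00; move: tp; rewrite -B00 mul0r; lra.
have split u : 0 < u -> u = u `^ th * u `^ (1 - th).
  move=> u0; rewrite -powRD; last by rewrite (gt_eqF u0) implybT.
  by rewrite addrC subrK powRr1// ltW.
rewrite [leLHS](split _ t0) (split _ Bgt0).
have -> : B `^ th * B `^ (1 - th) * (p `^ th * q `^ (1 - th)) =
  (B `^ th * p `^ th) * (B `^ (1 - th) * q `^ (1 - th)) by ring.
rewrite -!powRM//; apply: ler_pM; rewrite ?powR_ge0//.
  by apply: ge0_ler_powR; rewrite ?nnegrE ?mulr_ge0// ltW.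
by apply: ge0_ler_powR; rewrite ?nnegrE ?subr_ge0 ?mulr_ge0// ltW.
Qed.

Lemma Rintegral_sum {R : realType} {dX : measure_display} {X : measurableType dX}
    (mu : {measure set X -> \bar R}) (F : nat -> X -> R) N :
  (forall i, mu.-integrable [set: X] (EFin \o F i)) ->
  mu.-integrable [set: X] (EFin \o (fun z => \sum_(0 <= i < N) F i z)) /\
  Rintegral mu [set: X] (fun z => \sum_(0 <= i < N) F i z) =
  \sum_(0 <= i < N) Rintegral mu [set: X] (F i).
Proof.
move=> iF; elim: N => [|N [IH1 IH2]].
  rewrite big_geq// (_ : (fun z => _) = cst 0); last by apply/funext => z; rewrite big_geq.
  by split; [exact: integrable0|rewrite Rintegral_cst// mul0r].
rewrite big_nat_recr//= -IH2 (_ : (fun z => \sum_(0 <= i < N.+1) F i z) =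
    (fun z => \sum_(0 <= i < N) F i z + F N z)).
  by split; [exact: (integrableD _ IH1 (iF N))|rewrite RintegralD].
by apply/funext => z; rewrite big_nat_recr.
Qed.

Lemma integrable_bounded_mul {R : realType} {dX : measure_display} {X : measurableType dX}
    (mu : {measure set X -> \bar R}) (f ps : X -> R) B :
  0 <= B -> measurable_fun [set: X] f -> mu.-integrable [set: X] (EFin \o ps) ->
  (forall z, ps z != 0 -> `|f z| <= B) ->
  mu.-integrable [set: X] (EFin \o (fun z => f z * ps z)) /\
  `|Rintegral mu [set: X] (fun z => f z * ps z)| <=
    B * Rintegral mu [set: X] (fun z => `|ps z|).
Proof.
move=> B0 mf ips fB.
have mps : measurable_fun [set: X] ps by apply/measurable_EFinP; exact: measurable_int ips.
have inps : mu.-integrable [set: X] (EFin \o (fun z => `|ps z|)) by exact: integrable_norm.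
have fB' z : `|f z * ps z| <= B * `|ps z|.
  have [->|/fB h] := eqVneq (ps z) 0; first by rewrite mulr0 normr0 mulr0.
  by rewrite normrM ler_wpM2r.
have iB : mu.-integrable [set: X] (EFin \o (fun z => B * `|ps z|)).
  exact: (integrableZl _ B inps).
have i1 : mu.-integrable [set: X] (EFin \o (fun z => f z * ps z)).
  apply: (le_integrable _ _ _ iB) => //.
    exact/measurable_EFinP/measurable_funM.
  move=> z _ /=; rewrite lee_fin; apply: (le_trans (fB' z)); exact: ler_norm.
split => //; apply: (le_trans (le_normr_Rintegral _ _)) => //.
rewrite -RintegralZl//; apply: le_Rintegral => //.
exact: (integrable_norm i1).
Qed.

(** One level of the approximation of the identity, with a free scale [del]. Statements that choose
    their constant before [del] and [T] are automatically uniform in the level, as [C4] is shared by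
    all levels. *)
Record approx_kernel {R : realType} {dX : measure_display} {X : measurableType dX}
    (d : X -> X -> R) (mu : {measure set X -> \bar R})
    (eps1 eps2 eps3 C4 del : R) (T : X -> X -> R) : Prop := {
  ak_scale : 0 < del ;
  ak_eps1 : 0 < eps1 <= 1 ;
  ak_eps2 : 0 < eps2 ;
  ak_eps3 : 0 < eps3 ;
  ak_C4 : 0 < C4 ;
  ak_size : forall x y, `|T x y| <= C4 * sizef d mu x del eps2 y ;
  ak_holder1 : forall x x' y, d x x' <= (del + d x y) / 2 ->
     `|T x y - T x' y| <=
       C4 * (d x x' / (del + d x y)) `^ eps1 * sizef d mu x del eps2 y ;
  ak_holder2 : forall x y y', d y y' <= (del + d x y) / 2 ->
     `|T x y - T x y'| <=
       C4 * (d y y' / (del + d x y)) `^ eps1 * sizef d mu x del eps2 y ;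
  ak_holder12 : forall x x' y y', d x x' <= (del + d x y) / 3 ->
     d y y' <= (del + d x y) / 3 ->
     `|(T x y - T x y') - (T x' y - T x' y')| <=
       C4 * (d x x' / (del + d x y)) `^ eps1
          * (d y y' / (del + d x y)) `^ eps1 * sizef d mu x del eps3 y ;
  ak_measurable : forall y, measurable_fun [set: X] (fun z => T z y) ;
  ak_integral : forall y, (\int[mu]_z (T z y)%:E = 1)%E }.

Arguments ak_scale {R dX X d mu eps1 eps2 eps3 C4 del T} _.
Arguments ak_eps1 {R dX X d mu eps1 eps2 eps3 C4 del T} _.
Arguments ak_eps2 {R dX X d mu eps1 eps2 eps3 C4 del T} _.
Arguments ak_eps3 {R dX X d mu eps1 eps2 eps3 C4 del T} _.
Arguments ak_C4 {R dX X d mu eps1 eps2 eps3 C4 del T} _.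
Arguments ak_size {R dX X d mu eps1 eps2 eps3 C4 del T} _.
Arguments ak_holder1 {R dX X d mu eps1 eps2 eps3 C4 del T} _.
Arguments ak_holder2 {R dX X d mu eps1 eps2 eps3 C4 del T} _.
Arguments ak_holder12 {R dX X d mu eps1 eps2 eps3 C4 del T} _.
Arguments ak_measurable {R dX X d mu eps1 eps2 eps3 C4 del T} _.
Arguments ak_integral {R dX X d mu eps1 eps2 eps3 C4 del T} _.

Section Kernel.
Context {R : realType} {dX : measure_display} {X : measurableType dX}.
Context {d : X -> X -> R} {mu : {measure set X -> \bar R}} {n C1 : R}.
Context (H : doubling_space d mu n C1).
Implicit Types (x y z c : X) (s r a : R).

(** Test-function bounds pass to averages: the size and Hoelder bounds of [F z], uniform over the
    support of [phi], integrate against the absolute value of [phi]. *)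
Lemma Gbound_Rintegral c s b a (F : X -> X -> R) (phi : X -> R) K :
  0 < s -> 0 <= K -> (forall y, measurable_fun [set: X] (fun z => F z y)) ->
  mu.-integrable [set: X] (EFin \o phi) ->
  (forall z, phi z != 0 -> Gbound d mu c s b a (F z) K) ->
  (forall y, mu.-integrable [set: X] (EFin \o (fun z => F z y * phi z))) /\
  Gbound d mu c s b a (fun y => Rintegral mu [set: X] (fun z => F z y * phi z))
    (K * Rintegral mu [set: X] (fun z => `|phi z|)).
Proof.
move=> s0 K0 mF iphi FG.
have iFphi y : mu.-integrable [set: X] (EFin \o (fun z => F z y * phi z)).
  apply: (integrable_bounded_mul mu (fun z => F z y) phi (K * sizef d mu c s a y) _ (mF y) _ _).1 => //.
    by rewrite mulr_ge0 ?(sizef_ge0 H).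
  by move=> z /FG [_ [h _]]; exact: h.
split=> //; split.
  by rewrite mulr_ge0// Rintegral_ge0.
split=> [y|y y' yy'].
  rewrite mulrAC; apply: (integrable_bounded_mul mu (fun z => F z y) phi (K * sizef d mu c s a y) _ (mF y) _ _).2 => //.
    by rewrite mulr_ge0 ?(sizef_ge0 H).
  by move=> z /FG [_ [h _]]; exact: h.
rewrite -RintegralB//.
have -> : (fun z => F z y' * phi z - F z y * phi z) = (fun z => (F z y' - F z y) * phi z).
  by apply/funext => z; ring.
set q := _ `^ _; have q0 : 0 <= q := powR_ge0 _ _.
have -> : K * Rintegral mu [set: X] (fun z => `|phi z|) * q * sizef d mu c s a y =
  (K * q * sizef d mu c s a y) * Rintegral mu [set: X] (fun z => `|phi z|) by ring.
apply: (integrable_bounded_mul mu (fun z => F z y' - F z y) phi _ _ _ _ _).2 => //.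
- by rewrite mulr_ge0 ?(sizef_ge0 H)// mulr_ge0.
- exact: measurable_funB.
by move=> z /FG [_ [_ h]]; exact: h.
Qed.

Context {eps1 eps2 eps3 C4 del : R} {T : X -> X -> R}.
Context (HT : approx_kernel d mu eps1 eps2 eps3 C4 del T).
Context {x1 : X} {eps beta gam : R}.
Context (b0 : 0 < beta) (be : beta <= eps) (e1 : eps < eps1).
Context (g0 : 0 < gam) (ge : gam < eps) (e2 : eps < eps2).

Lemma kernel_Gbound z b a : 0 < b <= eps1 -> a <= eps2 -> Gbound d mu z del b a (T z) C4.
Proof.
case/andP=> b0' b1 a2; have del0 := ak_scale HT; have C40 := ak_C4 HT.
apply: (Gbound_exp H _ _ _ _ eps1 eps2) => //; split; first exact: ltW.
split=> [y|y y' yy']; first exact: (ak_size HT).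
by rewrite distrC; exact: (ak_holder2 HT).
Qed.

(** The constant depends on [del] and [rho]. This is harmless, since the bound serves only for
    membership in [G0] and for justifying limits. *)
Lemma kernel_Gbound_base rho : exists2 K, 0 < K & forall z, d x1 z <= rho ->
  Gbound d mu x1 1 eps eps (T z) K.
Proof.
have del0 := ak_scale HT; have C40 := ak_C4 HT.
pose A := Num.max 1 (Num.max del (Num.max del^-1 (rho / del))).
have A1 : 1 <= A by rewrite le_max lexx.
have A2 : del <= A * 1 by rewrite mulr1 !le_max lexx !orbT.
have A3 : 1 <= A * del by rewrite -ler_pdivrMr// mul1r !le_max lexx !orbT.
have A4 : rho <= A * del by rewrite -ler_pdivrMr// !le_max lexx !orbT.
have eps0 : 0 <= eps by exact: le_trans (ltW b0) be.
have [K K1 HK] := Gbound_recenter H A eps eps A1 eps0 eps0.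
exists (K * C4) => [|z zrho]; first by rewrite mulr_gt0//; lra.
apply: (HK z del) => //; first by rewrite (distC H); exact: le_trans A4.
by apply: kernel_Gbound; rewrite ?(lt_le_trans b0 be) ?(ltW e1) ?(ltW e2).
Qed.

(* The mixed difference (iv) only has decay [eps3], possibly smaller than [gam]; interpolating
   with the single differences restores the decay [gam] at the price of a smaller power. *)
Lemma kernel_modulus_local : exists2 K, 0 < K & exists2 k, 0 < k &
  forall z z', d z z' <= del / 3 ->
    Gbound d mu z del beta gam (fun y => T z y - T z' y) (K * (d z z' / del) `^ k).
Proof.
have del0 := ak_scale HT; have C40 := ak_C4 HT; have /andP[eps10 eps11] := ak_eps1 HT.
have eps20 := ak_eps2 HT; have eps30 := ak_eps3 HT.
have hb0 := b0; have hbe := be; have he1 := e1; have hg0 := g0; have hge := ge; have he2 := e2.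
have [K1 K11 HK1] := sizef_compare H 2 eps2 ltac:(lra) (ltW eps20).
have third0 : 0 < 1 / 3 :> R by lra.
have [K2 K21 HK2] := Gbound_ext H (1 / 3) beta gam third0 (ltW b0) (ltW g0).
(* Chosen so that [(1 - th) * eps2 = gam]: the single differences alone then provide the decay
   [gam], and the mixed difference only has to contribute the power [eps1 * th] of the modulus. *)
pose th := (eps2 - gam) / eps2.
have th0 : 0 < th by rewrite divr_gt0; lra.
have th1 : th <= 1 by rewrite ler_pdivrMr// mul1r; lra.
have thE : (1 - th) * eps2 = gam by rewrite /th; field; lra.
pose K := C4 + C4 * (2 * K1).
have K0 : 0 < K by rewrite /K; nra.
exists (K2 * K); first by rewrite mulr_gt0//; lra.
exists (eps1 * th) => [|z z' zz']; first exact: mulr_gt0.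
have zz0 := dist_ge0 H z z'.
set q := (d z z' / del) `^ (eps1 * th).
have q0 : 0 <= q := powR_ge0 _ _.
have tau y : 0 <= d z z' / (del + d z y) <= d z z' / del.
  have t0 := scale_gt0 H z del y del0.
  rewrite divr_ge0 ?(ltW t0)//= ler_wpM2l// lef_pV2 ?posrE//.
  by have := dist_ge0 H z y; lra.
have tau1 : d z z' / del <= 1 by rewrite ler_pdivrMr// mul1r; lra.
have tq y : (d z z' / (del + d z y)) `^ eps1 `^ th <= q.
  rewrite -powRrM; have /andP[t1 t2] := tau y.
  apply: ge0_ler_powR; rewrite ?nnegrE//; [by rewrite mulr_ge0// ltW|exact: le_trans t2].
rewrite -mulrA; apply: HK2 => //; first by rewrite mulr_ge0// ltW.
  move=> y; have zy := dist_ge0 H z y; have /andP[t1 t2] := tau y.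
  apply: (le_trans (ak_holder1 HT z z' y _)); first lra.
  apply: ler_pM => //; [by rewrite mulr_ge0 ?powR_ge0// ltW|exact: (sizef_ge0 H)| |].
    apply: ler_pM; rewrite ?powR_ge0//; [exact: ltW|rewrite /K; nra|].
    apply: le_trans (tq y); rewrite -powRrM; apply: ler_powR_le1.
    - by rewrite t1 (le_trans t2).
    - exact: mulr_gt0.
    - by rewrite ler_piMr// ltW.
  by apply: (sizef_le_exp H) => //; lra.
move=> y y' yy' _; have zy := dist_ge0 H z y; have yy0 := dist_ge0 H y y'.
have t0 := scale_gt0 H z del y del0; have t'0 := scale_gt0 H z' del y del0.
have /andP[t1 t2] := tau y.
set u := d y y' / (del + d z y).
have u0 : 0 <= u by rewrite divr_ge0// ltW.
have u1 : u <= 1 by rewrite ler_pdivrMr// mul1r; lra.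
set D := `|_|.
have D1 : D <= C4 * (d z z' / (del + d z y)) `^ eps1 * u `^ eps1 * sizef d mu z del eps3 y.
  rewrite /D (_ : _ - _ = - (T z y - T z y' - (T z' y - T z' y'))); last by ring.
  by rewrite normrN; apply: (ak_holder12 HT); lra.
have z'y : d z y <= d z z' + d z' y := dist_triangle H z z' y.
have D2 : D <= K * u `^ eps1 * sizef d mu z del eps2 y.
  rewrite /D (_ : _ - _ = (T z' y - T z' y') - (T z y - T z y')); last by ring.
  apply: (le_trans (ler_normB _ _)).
  have h1 := ak_holder2 HT z y y' ltac:(lra).
  have h2 := ak_holder2 HT z' y y' ltac:(lra).
  have h3 : (d y y' / (del + d z' y)) `^ eps1 <= 2 * u `^ eps1.
    apply: (@le_trans _ _ ((2 * u) `^ eps1)).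
      apply: ge0_ler_powR; rewrite ?nnegrE ?(ltW eps10)//.
      - by rewrite divr_ge0// ltW.
      - by rewrite mulr_ge0.
      rewrite /u mulrA ler_pdivlMr// mulrAC ler_pdivrMr//.
      have : d y y' * (del + d z y) <= d y y' * (2 * (del + d z' y)).
        by rewrite ler_wpM2l//; lra.
      by lra.
    rewrite powRM// ler_wpM2r ?powR_ge0//.
    by rewrite -[leRHS]powRr1 ?ler_powR//; lra.
  have h4 : sizef d mu z' del eps2 y <= K1 * sizef d mu z del eps2 y.
    have := dist_triangle H z' z y; rewrite (distC H z' z) => ?.
    by apply: HK1 => //; rewrite ?(distC H z' z); lra.
  apply: (@le_trans _ _ (C4 * (2 * u `^ eps1) * (K1 * sizef d mu z del eps2 y) +
      C4 * u `^ eps1 * sizef d mu z del eps2 y)).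
    apply: lerD => //; apply: (le_trans h2); apply: ler_pM.
    - by rewrite mulr_ge0 ?powR_ge0// ltW.
    - exact: (sizef_ge0 H).
    - by rewrite ler_wpM2l// ltW.
    - exact: h4.
  by rewrite /K le_eqVlt; apply/orP; left; apply/eqP; ring.
have ub : u `^ eps1 <= u `^ beta by apply: ler_powR_le1; [rewrite u0|exact: b0|lra].
have [r0 r1] := andP (scale_ratio H z del y del0).
set ra := del / (del + d z y) in r0 r1.
have V0 : 0 <= (Vr d mu del z + Vxy d mu z y)^-1.
  by rewrite invr_ge0 addr_ge0//; exact: (Vr_ge0 H).
have [D0|Dgt0] := leP D 0.
  apply: (le_trans D0); rewrite mulr_ge0 ?(sizef_ge0 H)// mulr_ge0 ?powR_ge0//.
  by rewrite mulr_ge0// ltW.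
have := le_interpolate D (K * u `^ eps1 * (Vr d mu del z + Vxy d mu z y)^-1)
  ((d z z' / (del + d z y)) `^ eps1 * ra `^ eps3) (ra `^ eps2) th.
rewrite (ltW th0) th1 => h.
have {}h : D <= K * u `^ eps1 * (Vr d mu del z + Vxy d mu z y)^-1 *
    (((d z z' / (del + d z y)) `^ eps1 * ra `^ eps3) `^ th * (ra `^ eps2) `^ (1 - th)).
  apply: h => //.
  - by rewrite mulr_ge0// mulr_ge0 ?powR_ge0// ltW.
  - by rewrite mulr_ge0 ?powR_ge0.
  - exact: powR_ge0.
  - apply: (le_trans D1); rewrite /sizef -/ra.
    set p := _ `^ eps1; set p' := u `^ eps1; set v := _^-1 in V0 *.
    have -> : K * p' * v * (p * ra `^ eps3) = K * (p' * v * (p * ra `^ eps3)) by ring.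
    have -> : C4 * p * p' * (v * ra `^ eps3) = C4 * (p' * v * (p * ra `^ eps3)) by ring.
    rewrite ler_wpM2r//; last by rewrite /K; nra.
    by rewrite !mulr_ge0 ?powR_ge0.
  - by apply: (le_trans D2); rewrite /sizef -/ra mulrA.
apply: (le_trans h); rewrite -powRrM (mulrC eps2) thE.
rewrite [sizef _ _ _ _ _ _]/sizef -/ra -/u.
have -> : K * q * u `^ beta * ((Vr d mu del z + Vxy d mu z y)^-1 * ra `^ gam) =
  (K * u `^ beta * (Vr d mu del z + Vxy d mu z y)^-1) * (q * ra `^ gam) by ring.
apply: ler_pM.
- by rewrite mulr_ge0// mulr_ge0 ?powR_ge0// ltW.
- by rewrite mulr_ge0 ?powR_ge0.
- by rewrite ler_wpM2r// ler_wpM2l// ltW.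
rewrite ler_wpM2r ?powR_ge0// powRM ?powR_ge0//.
apply: le_trans (tq y); rewrite ler_piMr ?powR_ge0//.
apply: powR_le1; rewrite ?(ltW th0)// powR_ge0/=.
by apply: powR_le1; rewrite ?(ltW r0) ?(ltW eps30).
Qed.

(** Uniform continuity on bounded sets of [T] as a map from points to test functions. It makes
    [L (T z)] continuous in [z], hence measurable, and lets Riemann sums converge in the norm for
    which [L] is continuous. *)
Lemma kernel_modulus rho e : 0 < e -> exists2 h, 0 < h & forall z z', d x1 z <= rho ->
  d z z' < h -> Gbound d mu x1 1 beta gam (fun y => T z y - T z' y) e.
Proof.
move=> e0; have del0 := ak_scale HT.
have [K K0 [k k0 HK]] := kernel_modulus_local.
pose A := Num.max 1 (Num.max del (Num.max del^-1 (rho / del))).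
have A1 : 1 <= A by rewrite le_max lexx.
have A2 : del <= A * 1 by rewrite mulr1 !le_max lexx !orbT.
have A3 : 1 <= A * del by rewrite -ler_pdivrMr// mul1r !le_max lexx !orbT.
have A4 : rho <= A * del by rewrite -ler_pdivrMr// !le_max lexx !orbT.
have [K' K'1 HK'] := Gbound_recenter H A beta gam A1 (ltW b0) (ltW g0).
pose t := e / (K' * K).
have K'0 : 0 < K' by lra.
have t0 : 0 < t by rewrite divr_gt0// mulr_gt0.
exists (Num.min (del / 3) (del * t `^ k^-1)).
  by rewrite lt_min divr_gt0//= mulr_gt0 ?powR_gt0.
move=> z z' zrho; rewrite lt_min => /andP[/ltW z1 /ltW z2].
have h : K' * (K * (d z z' / del) `^ k) <= e.
  have : (d z z' / del) `^ k <= t.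
    rewrite (_ : t = (t `^ k^-1) `^ k); last by rewrite -powRrM mulVf ?gt_eqF// powRr1// ltW.
    apply: ge0_ler_powR; rewrite ?nnegrE ?powR_ge0 ?(ltW k0)//.
      by rewrite divr_ge0 ?(dist_ge0 H)// ltW.
    by rewrite ler_pdivrMr// mulrC.
  rewrite mulrA => ht; apply: (le_trans (ler_wpM2l _ ht)); first by rewrite mulr_ge0// ltW.
  by rewrite /t mulrC divfK// gt_eqF// mulr_gt0.
apply: (Gbound_le H _ _ _ _ _ _ _ _ h) => //.
apply: (HK' z del) => //; last exact: HK.
by rewrite (distC H); exact: le_trans A4.
Qed.

Context {L : (X -> R) -> R} (dL : in_dual d mu x1 eps beta gam L).

Lemma kernel_G0 z : G0 d mu x1 eps beta gam (T z).
Proof.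
have [K K0 HK] := kernel_Gbound_base (d x1 z).
by apply: (inG_G0 H b0 be ge); exists K; exact: HK.
Qed.

Lemma kernel_dual_modulus rho e : 0 < e -> exists2 h, 0 < h & forall z z', d x1 z <= rho ->
  d z z' < h -> Gbound d mu x1 1 beta gam (fun y => T z y - T z' y) e /\
  `|L (T z) - L (T z')| <= e.
Proof.
move=> e0; have [M M0 HM] := dual_bound dL.
have e'0 : 0 < Num.min e (e / M) by rewrite lt_min e0 divr_gt0.
have [h h0 Hh] := kernel_modulus rho _ e'0.
exists h => // z z' zrho zz'; have hG := Hh z z' zrho zz'.
split; first by apply: (Gbound_le H _ _ _ _ _ _ _ _ _ hG) => //; rewrite ge_min lexx.
rewrite -(dual_sub dL); try exact: kernel_G0.
have := HM _ _ (G0_sub H b0 be ge _ _ (kernel_G0 z) (kernel_G0 z')) hG.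
move=> h'; apply: (le_trans h'); rewrite mulrC -ler_pdivlMr//.
by rewrite ge_min lexx orbT.
Qed.

Lemma measurable_kernel_dual : measurable_fun [set: X] (fun z => L (T z)).
Proof.
apply: (measurable_continuous H) => y e e0.
have [h h0 Hh] := kernel_dual_modulus (d x1 y) (e / 2) ltac:(lra).
exists h => // z yz; have [_] := Hh y z (lexx _) yz.
by rewrite distrC; lra.
Qed.

Definition adjoint (phi : X -> R) y : R := Rintegral mu [set: X] (fun z => T z y * phi z).

Lemma adjoint_G0 phi rho : mu.-integrable [set: X] (EFin \o phi) ->
  (forall y, phi y != 0 -> d x1 y <= rho) -> G0 d mu x1 eps beta gam (adjoint phi).
Proof.
move=> iphi phirho; have [K K0 HK] := kernel_Gbound_base rho.
apply: (inG_G0 H b0 be ge).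
exists (K * Rintegral mu [set: X] (fun z => `|phi z|)).
apply: (Gbound_Rintegral x1 1 eps eps T phi K _ _ _ iphi _).2 => //; first exact: ltW.
  exact: (ak_measurable HT).
by move=> z /phirho; exact: HK.
Qed.

(** A Fubini exchange for a functional that is not an integral. The support of [phi] meets finitely
    many cells of a fine net; on each cell [T z] is replaced by [T (w j)], which commutes with [L]
    by linearity, and continuity of [L] bounds the error. *)
Lemma dual_adjoint phi rho : mu [set: X] = +oo%E ->
  mu.-integrable [set: X] (EFin \o phi) ->
  (forall y, phi y != 0 -> d x1 y <= rho) ->
  mu.-integrable [set: X] (EFin \o (fun z => L (T z) * phi z)) /\
  L (adjoint phi) = Rintegral mu [set: X] (fun z => L (T z) * phi z).
Proof.
move=> muX iphi phirho.
have [M M0 HM] := dual_bound dL.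
have [K K0 HK] := kernel_Gbound_base rho.
have mphi : measurable_fun [set: X] phi by apply/measurable_EFinP; exact: measurable_int iphi.
have inphi : mu.-integrable [set: X] (EFin \o (fun z => `|phi z|)) by exact: integrable_norm.
have mg := measurable_kernel_dual.
have gK z : phi z != 0 -> `|L (T z)| <= M * K.
  move=> /phirho zrho; apply: HM; first exact: kernel_G0.
  exact: (Gbound_eps H b0 be ge _ _ _ _ _ (HK z zrho)).
have [ig _] := integrable_bounded_mul mu _ phi (M * K) (ltW (mulr_gt0 M0 K0)) mg iphi gK.
split=> //; apply/eqP; rewrite -subr_eq0 -normr_le0; apply/ler_addgt0Pr => e e0.
rewrite add0r; set I := Rintegral mu [set: X] (fun z => `|phi z|).
have I0 : 0 <= I by exact: Rintegral_ge0.
pose e' : R := e / ((M + 1) * (I + 1)).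
have e'0 : 0 < e' by rewrite divr_gt0// mulr_gt0//; lra.
have [h h0 Hh] := kernel_dual_modulus rho e' e'0.
have [w [_ [wcov wfar]]] := exists_net H h x1 muX h0.
(* From index [J] on, no cell meets the support of [phi]. *)
have [J HJ] := wfar x1 (rho + h).
pose A := seqDU (fun i => dball d (w i) h).
have mA j : measurable (A j) by exact: (measurable_seqDU_dball H).
have sumA z : phi z != 0 -> \sum_(0 <= j < J) \1_(A j) z = 1 :> R.
  move=> /phirho zrho.
  have : (\bigcup_k A k) z by rewrite -seqDU_bigcup_eq; have [j jz] := wcov z; exists j.
  move=> [j _ Ajz].
  have jJ : (j < J)%N.
    rewrite ltnNge; apply/negP => /HJ; have := subset_seqDU Ajz; rewrite /dball /= => jz.
    by have := dist_triangle H x1 z (w j); rewrite (distC H z (w j)); lra.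
  rewrite big_mkord (bigD1 (Ordinal jJ))//= indicE mem_set// big1 ?addr0// => i ij.
  rewrite indicE memNset// => Aiz; move/eqP: ij; apply; apply/val_inj => /=.
  by apply: (@trivIset_seqDU _ (fun i => dball d (w i) h)) => //; exists z.
pose ps j z := phi z * \1_(A j) z.
have phiE z : phi z = \sum_(0 <= j < J) ps j z.
  have [p0|/sumA h1] := eqVneq (phi z) 0; first by rewrite p0 big1// => j _; rewrite /ps p0 mul0r.
  by rewrite /ps -big_distrr/= h1 mulr1.
have nphiE z : `|phi z| = \sum_(0 <= j < J) `|ps j z|.
  rewrite [in LHS]phiE -[in LHS](phiE z).
  have [p0|/sumA h1] := eqVneq (phi z) 0.
    by rewrite p0 normr0 big1// => j _; rewrite /ps p0 mul0r normr0.
  rewrite (eq_bigr (fun j => `|phi z| * \1_(A j) z)); first by rewrite -big_distrr/= h1 mulr1.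
  by move=> j _; rewrite /ps normrM (ger0_norm (_ : 0 <= \1_(A j) z)).
have m1A j : measurable_fun [set: X] (\1_(A j) : X -> R) by exact: measurable_indic.
have ips j : mu.-integrable [set: X] (EFin \o ps j).
  rewrite (_ : ps j = (fun z => \1_(A j) z * phi z)); last by apply/funext => z; rewrite /ps mulrC.
  apply: (integrable_bounded_mul mu _ phi 1 ler01 (m1A j) iphi _).1 => z _.
  by rewrite ger0_norm// indicE; case: (_ \in _).
have psz j z : ps j z != 0 -> d x1 z <= rho /\ d z (w j) < h.
  rewrite /ps mulf_eq0 negb_or => /andP[/phirho zrho]; rewrite indicE.
  have [/set_mem Az _|] := boolP (z \in A j); last by rewrite eqxx.
  by split => //; have := subset_seqDU Az; rewrite /dball /= (distC H).
have mT := ak_measurable HT.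
have iTj j y : mu.-integrable [set: X] (EFin \o (fun z => T z y * ps j z)).
  apply: (Gbound_Rintegral x1 1 eps eps T (ps j) K ltr01 (ltW K0) mT (ips j) _).1.
  by move=> z /psz[zrho _]; exact: HK.
have adjG j : G0 d mu x1 eps beta gam (adjoint (ps j)).
  by apply: (adjoint_G0 _ rho (ips j)) => z /psz[].
have -> : adjoint phi = (fun y => \sum_(0 <= j < J) adjoint (ps j) y).
  apply/funext => y; rewrite /adjoint -(Rintegral_sum mu _ J (fun j => iTj j y)).2.
  by apply: eq_Rintegral => z _; rewrite [in LHS]phiE big_distrr.
rewrite (dual_sum H b0 be ge dL _ _ adjG).
have igj j : mu.-integrable [set: X] (EFin \o (fun z => L (T z) * ps j z)).
  apply: (integrable_bounded_mul mu _ (ps j) (M * K) (ltW (mulr_gt0 M0 K0)) mg (ips j) _).1.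
  by move=> z pz; apply: gK; apply: contraNN pz => /eqP p0; rewrite /ps p0 mul0r.
have -> : Rintegral mu [set: X] (fun z => L (T z) * phi z) =
    \sum_(0 <= j < J) Rintegral mu [set: X] (fun z => L (T z) * ps j z).
  rewrite -(Rintegral_sum mu _ J igj).2.
  by apply: eq_Rintegral => z _; rewrite [in LHS]phiE big_distrr.
rewrite -sumrB; apply: (le_trans (ler_norm_sum _ _ _)).
have inps j : mu.-integrable [set: X] (EFin \o (fun z => `|ps j z|)) by exact: integrable_norm.
have piece j : `|L (adjoint (ps j)) - Rintegral mu [set: X] (fun z => L (T z) * ps j z)| <=
    (M + 1) * e' * Rintegral mu [set: X] (fun z => `|ps j z|).
  (* Both quantities are compared with [c * L (T (w j))]: the first differs by at most [M * e']
     times the mass of the piece, by continuity of [L], the second by at most [e'] times it, by the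
     modulus of [L (T z)]. *)
  set c := Rintegral mu [set: X] (ps j).
  have cE k : c * k = Rintegral mu [set: X] (fun z => k * ps j z) by rewrite mulrC /c -RintegralZl//; exact: (ips j).
  have -> : L (adjoint (ps j)) - Rintegral mu [set: X] (fun z => L (T z) * ps j z) =
    (L (adjoint (ps j)) - c * L (T (w j))) -
    (Rintegral mu [set: X] (fun z => L (T z) * ps j z) - c * L (T (w j))) by ring.
  apply: (le_trans (ler_normB _ _)); rewrite -mulrA mulrDl mul1r; apply: lerD.
    have -> : L (adjoint (ps j)) - c * L (T (w j)) =
        L (fun y => 1 * adjoint (ps j) y + (- c) * T (w j) y).
      by rewrite (dual_lin dL) ?mul1r ?mulNr//; exact: kernel_G0.
    apply: HM; first by apply: (G0_lin H b0 be ge) => //; exact: kernel_G0.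
    rewrite (_ : (fun y => _) = (fun y => Rintegral mu [set: X] (fun z => (T z y - T (w j) y) * ps j z))).
      apply: (Gbound_Rintegral x1 1 beta gam (fun z y => T z y - T (w j) y) (ps j) e' _ _ _ (ips j) _).2 => //.
      - exact: ltW.
      - by move=> y; apply: measurable_funB => //; exact: measurable_cst.
      - by move=> z /psz[zrho zw]; case: (Hh z (w j) zrho zw).
    apply/funext => y; rewrite /adjoint mul1r mulNr cE -RintegralB//.
      by apply: eq_Rintegral => z _; rewrite mulrBl.
    exact: (integrableZl _ (T (w j) y) (ips j)).
  rewrite cE -RintegralB//; last first.
    exact: (integrableZl _ (L (T (w j))) (ips j)).
  rewrite (_ : Rintegral _ _ _ = Rintegral mu [set: X] (fun z => (L (T z) - L (T (w j))) * ps j z)).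
    apply: (integrable_bounded_mul mu _ (ps j) e' (ltW e'0) _ (ips j) _).2.
      by apply: measurable_funB => //; exact: measurable_cst.
    by move=> z /psz[zrho zw]; case: (Hh z (w j) zrho zw).
  by apply: eq_Rintegral => z _; rewrite mulrBl.
apply: (le_trans (ler_sum _ (fun j _ => piece j))).
rewrite -big_distrr/= -(Rintegral_sum mu _ J inps).2.
rewrite (_ : Rintegral _ _ _ = I); last by apply: eq_Rintegral => z _; rewrite [in RHS]nphiE.
have D0 : 0 < (M + 1) * (I + 1) by rewrite mulr_gt0//; lra.
have -> : e = e' * ((M + 1) * (I + 1)) by rewrite /e' divfK// gt_eqF.
have : 0 <= (M + 1) * e' by rewrite mulr_ge0 ?(ltW e'0)//; lra.
by lra.
Qed.

End Kernel.

(** * The gain from the cancellation of the kernel *)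

Section Cancellation.
Context {R : realType} {dX : measure_display} {X : measurableType dX}.
Context {d : X -> X -> R} {mu : {measure set X -> \bar R}} {n C1 : R}.
Context (H : doubling_space d mu n C1).
Implicit Types (x y z c : X) (s r a : R).

Lemma sizef_le_Vr c s a y : 0 < s -> 0 <= a -> sizef d mu c s a y <= (Vr d mu s c)^-1.
Proof.
move=> s0 a0; have V0 := Vr_gt0 H c s s0; have V1 : 0 <= Vxy d mu c y := Vr_ge0 H c (d c y).
rewrite /sizef -[leRHS]mulr1; apply: ler_pM.
- by rewrite invr_ge0 addr_ge0// ltW.
- exact: powR_ge0.
- by rewrite lef_pV2 ?posrE//; lra.
have /andP[r0 r1] := scale_ratio H c s y s0.
by apply: powR_le1 => //; rewrite (ltW r0).
Qed.

Lemma Gbound_measurable c s b a f C : 0 < s -> 0 < b -> Gbound d mu c s b a f C ->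
  measurable_fun [set: X] f.
Proof.
move=> s0 b0 fC; apply: (measurable_continuous H) => y e e0.
exact: (Gbound_continuous H c s b a f C).
Qed.

Context {eps1 eps2 eps3 C4 : R} {x1 : X} {eps beta gam : R}.
Context (b0 : 0 < beta) (be : beta <= eps) (e1 : eps < eps1) (e11 : eps1 <= 1).
Context (g0 : 0 < gam) (ge : gam < eps) (e2 : eps < eps2) (C40 : 0 < C4).

(** The decay left for integration: [eps2 - beta] once a power [beta] of the kernel's decay has been
    spent on the gain, or [gam] where [phi z] itself is integrated. *)
Let a0 := Num.min (eps2 - beta) gam.

(** If [z] is near [y] on the scale of [phi], the Hoelder ratio of [phi] times [del / (del + d y z)]
    is at most [del / r], and the power [beta] of this is the gain. If [z] is far, the size bounds
    for [phi z] and [phi y] are used separately and the gain comes from the smallness of the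
    kernel. *)
Lemma sizef_oscillation : exists2 K, 1 <= K & forall del c r (phi : X -> R) B y z,
  0 < del -> del <= r -> Gbound d mu c r beta gam phi B ->
  sizef d mu y del eps2 z * `|phi z - phi y| <=
    K * (B * (del / r) `^ beta * sizef d mu c r gam y) *
      (sizef d mu y del a0 z + sizef d mu c r a0 z).
Proof.
have hb0 := b0; have hbe := be; have he1 := e1; have he11 := e11.
have hg0 := g0; have hge := ge; have he2 := e2.
have C11 := ds_C1 H; have n0 := ds_n H.
have P2 : 1 <= (2 : R) `^ n by apply: powR_ge1; lra.
have P4 : 1 <= (4 : R) `^ n by apply: powR_ge1; lra.
have P2e : 1 <= (2 : R) `^ eps2 by apply: powR_ge1; lra.
pose K1 := C1 * 2 `^ n * (C1 * 4 `^ n * 2 `^ eps2 * 2).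
have K11 : 1 <= K1.
  have c2 : 1 <= C1 * 2 `^ n by rewrite mulr_ege1.
  have c4 : 1 <= C1 * 4 `^ n by rewrite mulr_ege1.
  have c4e : 1 <= C1 * 4 `^ n * 2 `^ eps2 by rewrite mulr_ege1.
  by rewrite /K1 mulr_ege1// mulr_ege1//; lra.
exists (2 + K1) => [|del c r phi B y z del0 dr [B0 [p1 p2]]]; first by lra.
have r0 : 0 < r by lra.
have t0 := scale_gt0 H c r y r0; have yz0 := dist_ge0 H y z; have cy := dist_ge0 H c y.
have ly0 := scale_gt0 H y del z del0.
have [ra0 ra1] := andP (scale_ratio H y del z del0).
have Sy := sizef_ge0 H c r gam y r0.
have Sz := sizef_ge0 H c r gam z r0.
have Sa : 0 <= sizef d mu y del (eps2 - beta) z := sizef_ge0 H _ _ _ _ del0.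
have aS1 : sizef d mu y del (eps2 - beta) z <= sizef d mu y del a0 z.
  by apply: (sizef_le_exp H) => //; rewrite /a0 ge_min lexx.
have aS2 : sizef d mu c r gam z <= sizef d mu c r a0 z.
  by apply: (sizef_le_exp H) => //; rewrite /a0 ge_min lexx orbT.
set q := (del / r) `^ beta; have q0 : 0 <= q := powR_ge0 _ _.
have dr1 : 0 <= del / r <= 1 by rewrite divr_ge0 ?(ltW del0) ?(ltW r0)//= ler_pdivrMr// mul1r.
have V0 : 0 <= (Vr d mu del y + Vxy d mu y z)^-1.
  by rewrite invr_ge0 addr_ge0//; exact: (Vr_ge0 H).
set ra := del / (del + d y z) in ra0 ra1.
have sp m : 0 <= m -> ra `^ beta <= m -> sizef d mu y del eps2 z <= m * sizef d mu y del (eps2 - beta) z.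
  move=> m0 rm; rewrite /sizef -/ra.
  have -> : ra `^ eps2 = ra `^ beta * ra `^ (eps2 - beta).
    by rewrite -powRD ?(gt_eqF ra0) ?implybT//; congr (_ `^ _); ring.
  by rewrite mulrCA ler_wpM2r// mulr_ge0// powR_ge0.
have [near|far] := leP (d y z) ((r + d c y) / 2).
  set u := (d y z / (r + d c y)) `^ beta.
  have u0 : 0 <= u := powR_ge0 _ _.
  have h1 : sizef d mu y del eps2 z * u <= q * sizef d mu y del (eps2 - beta) z.
    rewrite /sizef -/ra.
    have -> : ra `^ eps2 = ra `^ beta * ra `^ (eps2 - beta).
      by rewrite -powRD ?(gt_eqF ra0) ?implybT//; congr (_ `^ _); ring.
    set V := _^-1 in V0 *; set ra' := ra `^ (eps2 - beta).
    have -> : V * (ra `^ beta * ra') * u = (ra `^ beta * u) * (V * ra') by ring.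
    rewrite ler_wpM2r//.
    rewrite /u /q -powRM ?(ltW ra0)//; last by rewrite divr_ge0// ltW.
    apply: ge0_ler_powR; rewrite ?nnegrE ?(ltW hb0)//.
    - by rewrite mulr_ge0 ?(ltW ra0)// divr_ge0// ltW.
    - by case/andP: dr1.
    rewrite /ra mulf_div ler_pdivrMr ?mulr_gt0// mulrAC ler_pdivlMr// -!mulrA.
    rewrite ler_wpM2l ?(ltW del0)//.
    have : d y z * r <= (del + d y z) * (r + d c y) by nra.
    by [].
  apply: (@le_trans _ _ (sizef d mu y del eps2 z * (B * u * sizef d mu c r gam y))).
    by rewrite ler_wpM2l ?(sizef_ge0 H)//; exact: p2.
  have -> : sizef d mu y del eps2 z * (B * u * sizef d mu c r gam y) =
    (B * sizef d mu c r gam y) * (sizef d mu y del eps2 z * u) by ring.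
  have -> : (2 + K1) * (B * q * sizef d mu c r gam y) * (sizef d mu y del a0 z + sizef d mu c r a0 z)
    = (B * sizef d mu c r gam y) * (q * ((2 + K1) * (sizef d mu y del a0 z + sizef d mu c r a0 z))) by ring.
  rewrite ler_wpM2l//; first by rewrite mulr_ge0.
  apply: (le_trans h1); rewrite ler_wpM2l//.
  by nra.
(* In the far case the kernel's ratio is bounded by the gain times the decay ratio of [phi] at [y].
   Against [phi y] only its power [beta] is used; against [phi z] the full power [eps2] is converted
   into both the gain and the decay of [phi] at [y], leaving [sizef d mu c r gam z] to be
   integrated. *)
have rat : ra <= 2 * (del / r) * (r / (r + d c y)).
  have -> : 2 * (del / r) * (r / (r + d c y)) = 2 * del / (r + d c y) by field; lra.
  rewrite /ra ler_pdivrMr// mulrAC ler_pdivlMr//.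
  have : del * (r + d c y) <= del * (2 * (del + d y z)) by rewrite ler_wpM2l//; lra.
  by lra.
have [rc0 rc1] := andP (scale_ratio H c r y r0).
set rc := r / (r + d c y) in rat rc0 rc1.
have dr0 : 0 < del / r by rewrite divr_gt0.
have h1 : sizef d mu y del eps2 z <= (2 * q) * sizef d mu y del (eps2 - beta) z.
  apply: sp; first by rewrite mulr_ge0.
  apply: (@le_trans _ _ ((2 * (del / r)) `^ beta)).
    apply: ge0_ler_powR; rewrite ?nnegrE ?(ltW hb0) ?(ltW ra0)//; first by lra.
    by apply: (le_trans rat); rewrite ler_piMr//; lra.
  rewrite powRM//; last exact: ltW.
  rewrite ler_wpM2r//; rewrite -[leRHS]powRr1//; apply: ler_powR; lra.
have h2 : sizef d mu y del eps2 z <= K1 * (q * sizef d mu c r gam y).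
  apply: (le_trans (sizef_le_bump H y del eps2 z del0)).
  rewrite /K1 -[leRHS]mulrA; apply: ler_wpM2l; first by rewrite mulr_ge0 ?powR_ge0//; lra.
  rewrite /bump -/ra.
  have W0 := Vr_gt0 H c _ t0; have W'0 := Vr_gt0 H y _ ly0.
  have hV : (Vr d mu (del + d y z) y)^-1 <= C1 * 4 `^ n * (Vr d mu (r + d c y) c)^-1.
    rewrite ler_pdivlMr// mulrC ler_pdivrMr//.
    rewrite mulrC; have := Vr_doubling H 4 y (del + d y z) c (r + d c y).
    by rewrite mulrC; apply; lra.
  have hr : ra `^ eps2 <= 2 `^ eps2 * (q * rc `^ gam).
    apply: (@le_trans _ _ ((2 * (del / r) * rc) `^ eps2)).
      apply: ge0_ler_powR; rewrite ?nnegrE ?(ltW ra0)//; first by lra.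
      by rewrite mulr_ge0 ?(ltW rc0)//; lra.
    rewrite powRM ?(ltW rc0)//; last by lra.
    rewrite powRM ?(ltW dr0)// -mulrA ler_wpM2l ?powR_ge0//.
    apply: ler_pM; rewrite ?powR_ge0//; apply: ler_powR_le1; rewrite ?(ltW dr0) ?(ltW rc0)//; lra.
  have hb := bump_le_sizef H c r gam y r0.
  rewrite /bump -/rc in hb.
  set v := (Vr d mu (r + d c y) c)^-1 in hV hb.
  have -> : C1 * 4 `^ n * 2 `^ eps2 * 2 * (q * sizef d mu c r gam y) =
    C1 * 4 `^ n * 2 `^ eps2 * q * (2 * sizef d mu c r gam y) by ring.
  apply: (@le_trans _ _ (C1 * 4 `^ n * 2 `^ eps2 * q * (v * rc `^ gam))); last first.
    by rewrite ler_wpM2l// !mulr_ge0 ?powR_ge0//; lra.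
  have -> : C1 * 4 `^ n * 2 `^ eps2 * q * (v * rc `^ gam) =
    (C1 * 4 `^ n * v) * (2 `^ eps2 * (q * rc `^ gam)) by ring.
  by apply: ler_pM => //; rewrite ?powR_ge0// invr_ge0 ltW.
apply: (@le_trans _ _ (sizef d mu y del eps2 z * (B * sizef d mu c r gam z + B * sizef d mu c r gam y))).
  rewrite ler_wpM2l ?(sizef_ge0 H)//; apply: (le_trans (ler_normB _ _)).
  by apply: lerD.
rewrite mulrDr.
have g1 : sizef d mu y del eps2 z * (B * sizef d mu c r gam z) <=
   K1 * (q * sizef d mu c r gam y) * (B * sizef d mu c r gam z).
  by rewrite ler_wpM2r// mulr_ge0.
have g2 : sizef d mu y del eps2 z * (B * sizef d mu c r gam y) <=
   2 * q * sizef d mu y del (eps2 - beta) z * (B * sizef d mu c r gam y).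
  by rewrite ler_wpM2r// mulr_ge0.
apply: (le_trans (lerD g1 g2)).
set sy := sizef d mu c r gam y in Sy *; set sz := sizef d mu c r gam z in Sz aS2 *.
set sa := sizef d mu y del (eps2 - beta) z in Sa aS1 *.
have -> : K1 * (q * sy) * (B * sz) + 2 * q * sa * (B * sy) =
  (B * q * sy) * (K1 * sz + 2 * sa) by ring.
rewrite (mulrC (2 + K1)) -[leRHS]mulrA; apply: ler_wpM2l; first by rewrite mulr_ge0// mulr_ge0.
by nra.
Qed.

(** As [T z y] has integral 1 in [z], [phi y] can be moved under the integral. For the increment,
    the difference of [T z y] and [T z y'] has integral 0, so the same constant [phi y] may be
    subtracted at both points. Both cases reduce to the claim [osc]. *)
Lemma cancellation_size : exists2 K, 1 <= K & forall del (T : X -> X -> R),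
  approx_kernel d mu eps1 eps2 eps3 C4 del T -> forall c r (phi : X -> R) B,
  del <= r -> Gbound d mu c r beta gam phi B ->
  (forall y, `|phi y - adjoint (mu := mu) (T := T) phi y| <=
     K * (B * (del / r) `^ beta * sizef d mu c r gam y)) /\
  (forall y y', d y y' <= del / 2 ->
    `|(phi y' - adjoint (mu := mu) (T := T) phi y') - (phi y - adjoint (mu := mu) (T := T) phi y)|
     <= K * (B * (del / r) `^ beta * sizef d mu c r gam y) * (d y y' / del) `^ beta).
Proof.
have hb0 := b0; have hbe := be; have he1 := e1; have he11 := e11.
have hg0 := g0; have hge := ge; have he2 := e2; have hC4 := C40.
have a00 : 0 < a0 by rewrite /a0 lt_min; apply/andP; split; lra.
have eps20 : 0 < eps2 by lra.
have [K1 K11 HK1] := sizef_oscillation.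
have [K2 K21 HK2] := sizef_compare H 2 eps2 ltac:(lra) (ltW eps20).
have [K3 K31 HK3] := integrable_le_sizef H a0 a00.
have [K4 K41 HK4] := integrable_le_sizef H eps2 eps20.
(* The 1 accounts for the increment of [phi] itself, and [K - 1] for the integral; its 2 counts the
   two size functions in the oscillation bound. *)
pose K := 1 + K3 * (2 * (C4 * K2 * K1)).
have K0 : 1 <= K.
  by rewrite lerDl mulr_ge0//; [lra|rewrite mulr_ge0// !mulr_ge0//; lra].
exists K => // del T HT c r phi B dr pB; have [B0 [p1 p2]] := pB.
have del0 := ak_scale HT; have r0 : 0 < r by lra.
have V0 := Vr_gt0 H c r r0.
have mphi : measurable_fun [set: X] phi by exact: (Gbound_measurable c r beta gam phi B).
have mT := ak_measurable HT.
have TS z y : `|T z y| <= C4 * K2 * sizef d mu y del eps2 z.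
  apply: (le_trans (ak_size HT z y)); rewrite -(mulrA C4) ler_wpM2l//; first exact: ltW.
  have zy := dist_ge0 H z y.
  by apply: HK2 => //; rewrite ?(distC H y z); lra.
have C4K2 : 0 <= C4 * K2 by rewrite mulr_ge0 ?(ltW hC4)//; lra.
have iT y : mu.-integrable [set: X] (EFin \o (fun z => T z y)).
  apply: (HK4 (fun z => T z y) y del y del (C4 * K2) 0 _ _ _ _ _ _).1 => // z.
  by rewrite mul0r addr0.
have phiB z : `|phi z| <= B * (Vr d mu r c)^-1.
  by apply: (le_trans (p1 z)); rewrite ler_wpM2l// sizef_le_Vr// ltW.
have BV : 0 <= B * (Vr d mu r c)^-1 by rewrite mulr_ge0// invr_ge0 ltW.
have iTphi y : mu.-integrable [set: X] (EFin \o (fun z => T z y * phi z)).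
  rewrite (_ : (fun z => T z y * phi z) = (fun z => phi z * T z y)); last by apply/funext => z; ring.
  exact: (integrable_bounded_mul mu phi (fun z => T z y) _ BV mphi (iT y) _).1.
have T1 y : Rintegral mu [set: X] (fun z => T z y) = 1 by rewrite /Rintegral (ak_integral HT).
have iTk y k : mu.-integrable [set: X] (EFin \o (fun z => T z y * k)).
  exact: (integrableZr _ k (iT y)).
have osc (f : X -> R) y q : 0 <= q -> measurable_fun [set: X] f ->
    (forall z, `|f z| <= q * (C4 * sizef d mu z del eps2 y)) ->
    `|Rintegral mu [set: X] (fun z => f z * (phi z - phi y))| <=
    (K - 1) * (B * (del / r) `^ beta * sizef d mu c r gam y) * q.
  move=> q0 mf fq.
  pose D := q * (C4 * K2 * (K1 * (B * (del / r) `^ beta * sizef d mu c r gam y))).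
  have W0 : 0 <= B * (del / r) `^ beta * sizef d mu c r gam y.
    by rewrite mulr_ge0 ?(sizef_ge0 H)// mulr_ge0 ?powR_ge0.
  have D0 : 0 <= D by rewrite mulr_ge0// mulr_ge0// mulr_ge0//; lra.
  have fB z : `|f z * (phi z - phi y)| <=
      D * sizef d mu y del a0 z + D * sizef d mu c r a0 z.
    rewrite normrM -mulrDr /D -mulrA; set S := _ + _.
    apply: (@le_trans _ _ (q * (C4 * K2 * sizef d mu y del eps2 z) * `|phi z - phi y|)).
      rewrite ler_wpM2r//; apply: (le_trans (fq z)); rewrite ler_wpM2l// -(mulrA C4).
      rewrite ler_wpM2l ?(ltW hC4)//; have zy := dist_ge0 H z y.
      by apply: HK2 => //; rewrite ?(distC H y z); lra.
    rewrite -(mulrA q) ler_wpM2l// -(mulrA (C4 * K2)) -[leRHS]mulrA ler_wpM2l//.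
    exact: (HK1 del c r phi B y z del0 dr pB).
  have mfp : measurable_fun [set: X] (fun z => f z * (phi z - phi y)).
    by apply: measurable_funM => //; apply: measurable_funB => //; exact: measurable_cst.
  have [i1 i2] := HK3 _ y del c r D D del0 r0 D0 D0 mfp fB.
  apply: (le_trans (le_normr_Rintegral _ i1)) => //; apply: (le_trans i2).
  rewrite /D /K le_eqVlt; apply/orP; left; apply/eqP; ring.
split=> [y|y y' yy'].
  have -> : phi y - adjoint (mu := mu) (T := T) phi y =
      - Rintegral mu [set: X] (fun z => T z y * (phi z - phi y)).
    rewrite -[X in X - _]mul1r -(T1 y) -RintegralZr// /adjoint -opprB -RintegralB//.
    by congr (- _); apply: eq_Rintegral => z _; rewrite mulrBr.
  rewrite normrN; apply: (le_trans (osc (fun z => T z y) y 1 ler01 (mT y) _)).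
    by move=> z; rewrite mul1r; exact: (ak_size HT).
  rewrite mulr1 ler_wpM2r//; last by lra.
  by rewrite mulr_ge0 ?(sizef_ge0 H)// mulr_ge0 ?powR_ge0.
have yy0 := dist_ge0 H y y'; have cy0 := dist_ge0 H c y.
set u := (d y y' / del) `^ beta; have u0 : 0 <= u := powR_ge0 _ _.
have -> : phi y' - adjoint (mu := mu) (T := T) phi y' - (phi y - adjoint (mu := mu) (T := T) phi y) =
   (phi y' - phi y) + Rintegral mu [set: X] (fun z => (T z y - T z y') * (phi z - phi y)).
  have -> : Rintegral mu [set: X] (fun z => (T z y - T z y') * (phi z - phi y)) =
     Rintegral mu [set: X] (fun z => T z y * phi z - T z y * phi y) -
     Rintegral mu [set: X] (fun z => T z y' * phi z - T z y' * phi y).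
    rewrite -RintegralB//.
    - by apply: eq_Rintegral => z _; ring.
    - exact: (integrableB _ (iTphi y) (iTk y (phi y))).
    - exact: (integrableB _ (iTphi y') (iTk y' (phi y))).
  rewrite !RintegralB// !RintegralZr// !T1 /adjoint; ring.
have -> : K * (B * (del / r) `^ beta * sizef d mu c r gam y) * u =
  B * (del / r) `^ beta * sizef d mu c r gam y * u +
  (K - 1) * (B * (del / r) `^ beta * sizef d mu c r gam y) * u by ring.
apply: (le_trans (ler_normD _ _)); apply: lerD.
  apply: (le_trans (p2 y y' _)); first lra.
  have t0 := scale_gt0 H c r y r0.
  have -> : B * (del / r) `^ beta * sizef d mu c r gam y * u =
    B * ((del / r) `^ beta * u) * sizef d mu c r gam y by ring.
  rewrite ler_wpM2r ?(sizef_ge0 H)// ler_wpM2l// /u -powRM; last 2 first.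
  - by rewrite divr_ge0// ltW.
  - by rewrite divr_ge0// ltW.
  have -> : del / r * (d y y' / del) = d y y' / r by field; apply/andP; split; lra.
  apply: ge0_ler_powR; rewrite ?nnegrE ?divr_ge0 ?(ltW t0) ?(ltW r0) ?(ltW hb0)//.
  by rewrite ler_wpM2l// lef_pV2 ?posrE//; lra.
apply: osc => //; first exact: measurable_funB.
move=> z; have zy := dist_ge0 H z y; have t0 := scale_gt0 H z del y del0.
apply: (le_trans (ak_holder2 HT z y y' _)); first lra.
have -> : u * (C4 * sizef d mu z del eps2 y) = C4 * u * sizef d mu z del eps2 y by ring.
rewrite ler_wpM2r ?(sizef_ge0 H)// ler_wpM2l ?(ltW hC4)//.
apply: (@le_trans _ _ ((d y y' / del) `^ eps1)).
  apply: ge0_ler_powR; rewrite ?nnegrE ?divr_ge0 ?(ltW t0) ?(ltW del0)//; first by lra.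
  by rewrite ler_wpM2l// lef_pV2 ?posrE//; lra.
apply: ler_powR_le1 => //; last by lra.
by rewrite divr_ge0 ?(ltW del0)//= ler_pdivrMr// mul1r; lra.
Qed.

End Cancellation.

(** * Truncated integrals, partition of unity, and bounds on a single ball *)

Section Localization.
Context {R : realType} {dX : measure_display} {X : measurableType dX}.
Context {d : X -> X -> R} {mu : {measure set X -> \bar R}} {n C1 : R}.
Context (H : doubling_space d mu n C1).
Implicit Types (x y z c : X) (s r a : R).

Lemma measurable_cutoff x1 N : 0 < N -> measurable_fun [set: X] (cutoff d x1 N).
Proof.
move=> N0; apply: (measurable_continuous H) => y e e0.
exists (e * N) => [|z yz]; first exact: mulr_gt0.
by apply: (le_lt_trans (cutoff_lipschitz H N y z N0)); rewrite ltr_pdivrMr.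
Qed.

(** Dominated convergence runs along integer radii, so past each [N] only some good [N'] is
    supplied. That suffices to pick one radius that also meets other lower bounds. *)
Lemma Rintegral_cutoff_limit x1 (f : X -> R) (e : R) :
  mu.-integrable [set: X] (EFin \o f) -> 0 < e ->
  exists N0 : R, forall N, N0 <= N -> exists2 N', N <= N' &
   `|Rintegral mu [set: X] f - Rintegral mu [set: X] (fun z => f z * cutoff d x1 N' z)| <= e.
Proof.
move=> iff e0; have mf : measurable_fun [set: X] f by apply/measurable_EFinP; exact: measurable_int iff.
pose fk (k : nat) z := f z * cutoff d x1 k.+1%:R z.
have mfk k : measurable_fun [set: X] (EFin \o fk k).
  by apply/measurable_EFinP; apply: measurable_funM => //; exact: measurable_cutoff.
have inf : mu.-integrable [set: X] (EFin \o (fun z => `|f z|)) by exact: integrable_norm.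
have fkf k z : `|fk k z| <= `|f z|.
  rewrite normrM ler_piMr// ger0_norm; last by case/andP: (cutoff01 (d := d) (x1 := x1) k.+1%:R z).
  by case/andP: (cutoff01 (d := d) (x1 := x1) k.+1%:R z).
have ifk k : mu.-integrable [set: X] (EFin \o fk k).
  by apply: (le_integrable _ _ _ inf) => // z _; rewrite /= lee_fin normr_id.
have cvgf : {ae mu, forall z, [set: X] z -> (fun k => (EFin \o fk k) z) @ \oo --> (EFin \o f) z}.
  apply/aeW => z _; apply: cvg_near_cst; near=> k.
  rewrite /= /fk cutoff1 ?mulr1//; apply: ltW.
  apply: (lt_trans (truncnS_gt (d x1 z))).
  by rewrite ltr_nat ltnS; near: k; exact: nbhs_infty_ge.
have mfE : measurable_fun [set: X] (EFin \o f) by exact/measurable_EFinP.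
have fkf' : {ae mu, forall z k, [set: X] z ->
    (`|(EFin \o fk k) z| <= (EFin \o (fun z => `|f z|)%R) z)%E}.
  by apply/aeW => z k _; rewrite /= lee_fin.
have [_ _ lim] := dominated_convergence measurableT mfk mfE cvgf inf fkf'.
have finf : (\int[mu]_z (EFin \o f) z)%E \is a fin_num by exact: integrable_fin_num.
move: lim; rewrite -(fineK finf) => /fine_cvgP[_].
move=> /cvgrPdist_le/(_ e e0)[K _ HK].
exists 0 => N _; pose k := maxn K (Num.truncn N).
exists k.+1%:R.
  apply/ltW/(lt_le_trans (truncnS_gt _)); rewrite ler_nat ltnS.
  exact: leq_maxr.
exact: (HK k (leq_maxl _ _)).
Unshelve. all: by end_near. Qed.

(* Telescoping the running maximum [tentmax w s j] of the tents gives a partition of unity whose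
   Lipschitz constants do not involve the overlap of the balls. *)
Fixpoint tentmax (w : nat -> X) s (j : nat) y : R :=
  if j is j'.+1 then Num.max (tentmax w s j' y) (cutoff d (w j') s y) else 0.

Definition tent (w : nat -> X) s j y : R := tentmax w s j.+1 y - tentmax w s j y.

Lemma tentmax01 w s j y : 0 <= tentmax w s j y <= 1.
Proof.
elim: j => [|j IH] /=; first by rewrite lexx ler01.
have := cutoff01 (d := d) (x1 := w j) s y; move: IH => /andP[h1 h2] /andP[h3 h4].
by rewrite le_max h1/= ge_max h2.
Qed.

Lemma tent01 w s j y : 0 <= tent w s j y <= 1.
Proof.
have := tentmax01 w s j.+1 y; have := tentmax01 w s j y; rewrite /tent.
move=> /andP[h1 h2] /andP[h3 h4]; rewrite subr_ge0 /= le_max lexx/=.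
by move: h4 => /= h4; lra.
Qed.

Lemma tent_support w s j y : 0 < s -> tent w s j y != 0 -> d (w j) y <= 2 * s.
Proof.
move=> s0 ty; apply: (cutoff_support (x1 := w j)) => //; apply: contraNN ty => /eqP h.
rewrite /tent /= h; have /andP[h1 _] := tentmax01 w s j y.
by rewrite (max_idPl h1) subrr.
Qed.

Lemma tentmax_lipschitz w s j y z : 0 < s ->
  `|tentmax w s j z - tentmax w s j y| <= d y z / s.
Proof.
move=> s0; have yz := dist_ge0 H y z.
elim: j => [|j IH] /=; first by rewrite subrr normr0 divr_ge0// ltW.
have := cutoff_lipschitz H (x1 := w j) s y z s0.
move: IH; set A := tentmax _ _ _ _; set B := tentmax _ _ _ _; set A' := cutoff _ _ _ _.
set B' := cutoff _ _ _ _; set D := d y z / s.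
rewrite !ler_norml => /andP[h1 h2] /andP[h3 h4]; apply/andP.
by split; rewrite !maxEle; do !case: ifPn; rewrite -?ltNge; lra.
Qed.

Lemma tent_lipschitz w s j y z : 0 < s -> `|tent w s j z - tent w s j y| <= 2 * (d y z / s).
Proof.
move=> s0; have h1 := tentmax_lipschitz w s j y z s0.
have h2 := tentmax_lipschitz w s j.+1 y z s0.
have -> : tent w s j z - tent w s j y = (tentmax w s j.+1 z - tentmax w s j.+1 y) -
  (tentmax w s j z - tentmax w s j y) by rewrite /tent; ring.
by apply: (le_trans (ler_normB _ _)); lra.
Qed.

Lemma sum_tent w s J y : \sum_(0 <= j < J) tent w s j y = tentmax w s J y.
Proof.
elim: J => [|J IH]; first by rewrite big_geq.
by rewrite big_nat_recr//= IH /tent [LHS]addrC subrK.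
Qed.

Lemma tentmax1 w s J y : 0 < s -> (exists2 j, (j < J)%N & d (w j) y <= s) ->
  tentmax w s J y = 1.
Proof.
move=> s0 [j jJ jy]; apply/eqP; rewrite eq_le; have /andP[_ ->] := tentmax01 w s J y.
rewrite /=; elim: J jJ => // J IH; rewrite ltnS leq_eqVlt => /orP[/eqP <-|/IH h] /=.
  by rewrite le_max cutoff1// lexx orbT.
by rewrite le_max h.
Qed.

Context {eps1 eps2 eps3 C4 : R} {x1 : X} {eps beta gam : R}.
Context (b0 : 0 < beta) (be : beta <= eps) (e1 : eps < eps1) (e11 : eps1 <= 1).
Context (g0 : 0 < gam) (ge : gam < eps) (e2 : eps < eps2) (C40 : 0 < C4).

(** Cancellation bounds height and Hoelder constant at scale [del] by those at [y]; as [del <= r],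
    the size of [phi] at [y] is comparable to its size at [w] on the support of [k]. The product is
    then a bump in the sense of [Gbound_bump], and the factor [Vr d mu del w] is its
    normalisation. *)
Lemma Gbound_localized : exists2 K, 1 <= K & forall del (T : X -> X -> R),
  approx_kernel d mu eps1 eps2 eps3 C4 del T -> forall c r (phi : X -> R) B,
  del <= r -> Gbound d mu c r beta gam phi B ->
  forall w (k : X -> R) x, (forall y, 0 <= k y <= 1) ->
    (forall y z, `|k z - k y| <= 3 * (d y z / del)) ->
    (forall y, k y != 0 -> d w y <= 2 * del) -> d x w <= del ->
    Gbound d mu x del beta gam
      (fun y => (phi y - adjoint (mu := mu) (T := T) phi y) * k y)
      (K * (B * (del / r) `^ beta * (sizef d mu c r gam w * Vr d mu del w))).
Proof.
have hb0 := b0; have hbe := be; have he1 := e1; have he11 := e11.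
have hg0 := g0; have hge := ge; have he2 := e2; have hC4 := C40.
have [K1 K11 HK1] := cancellation_size (eps3 := eps3) H b0 be e1 e11 g0 ge e2 C40.
have [K2 K21 HK2] := sizef_compare H 4 gam ltac:(lra) (ltW g0).
have [K3 K31 HK3] := Gbound_bump H 2 beta gam ltac:(lra) (ltW b0) (ltW g0).
exists (K3 * (4 * (K1 * K2))).
  by rewrite mulr_ege1//; have : 1 <= K1 * K2 by [rewrite mulr_ege1]; lra.
move=> del T HT c r phi B dr pB w k x k01 kL ks xw.
have [B0 _] := pB; have [ps1 ps2] := HK1 del T HT c r phi B dr pB.
have del0 := ak_scale HT; have r0 : 0 < r by lra.
set W := B * (del / r) `^ beta in ps1 ps2 *.
pose psi y := phi y - adjoint (mu := mu) (T := T) phi y.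
have {}ps1 y : `|psi y| <= K1 * (W * sizef d mu c r gam y) := ps1 y.
have {}ps2 y z : d y z <= del / 2 ->
  `|psi z - psi y| <= K1 * (W * sizef d mu c r gam y) * (d y z / del) `^ beta := ps2 y z.
rewrite [X in Gbound _ _ _ _ _ _ X _](_ : _ = (fun y => psi y * k y))//.
have W0 : 0 <= W by rewrite mulr_ge0 ?powR_ge0.
have Sw := sizef_ge0 H c r gam w r0.
have SS y : d w y <= 3 * del -> sizef d mu c r gam y <= K2 * sizef d mu c r gam w.
  move=> wy; have := dist_triangle H c y w; rewrite (distC H y w) => h.
  have cy := dist_ge0 H c y.
  by apply: HK2 => //; rewrite ?(dist_xx H); lra.
have psB y : d w y <= 3 * del -> K1 * (W * sizef d mu c r gam y) <=
    K1 * K2 * (W * sizef d mu c r gam w).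
  move=> /SS h.
  have -> : K1 * K2 * (W * sizef d mu c r gam w) = K1 * (W * (K2 * sizef d mu c r gam w)) by ring.
  by rewrite ler_wpM2l ?ler_wpM2l//; lra.
set Q := K1 * K2 * (W * sizef d mu c r gam w) in psB.
have Q0 : 0 <= Q by rewrite mulr_ge0// mulr_ge0//; lra.
rewrite (_ : _ * (W * _) = K3 * (4 * Q * Vr d mu del w)); last by rewrite /Q; ring.
have kn y : `|k y| <= 1 by rewrite ger0_norm; case/andP: (k01 y).
apply: HK3 => //; first by lra.
- by lra.
- by move=> y; rewrite mulf_eq0 negb_or => /andP[_ /ks].
- move=> y; have [->|/ks wy] := eqVneq (k y) 0; first by rewrite mulr0 normr0; lra.
  rewrite normrM; apply: (@le_trans _ _ (Q * 1)); last by lra.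
  by apply: ler_pM => //; apply: (le_trans (ps1 y)); apply: psB; lra.
move=> y z yz; have yz0 := dist_ge0 H y z.
have [|kyz] := boolP ((k y == 0) && (k z == 0)).
  case/andP=> /eqP -> /eqP ->; rewrite !mulr0 subrr normr0.
  by rewrite mulr_ge0 ?powR_ge0//; lra.
have wy : d w y <= 3 * del.
  rewrite negb_and in kyz; case/orP: kyz => /ks; first by lra.
  by have := dist_triangle H w z y; rewrite (distC H z y); lra.
set u := (d y z / del) `^ beta; have u0 : 0 <= u := powR_ge0 _ _.
have uu : d y z / del <= u.
  have q0 : 0 <= d y z / del <= 1.
    by rewrite divr_ge0 ?(ltW del0)//= ler_pdivrMr// mul1r; lra.
  rewrite -[leLHS]powRr1; [apply: ler_powR_le1 => //; lra|by case/andP: q0].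
have -> : psi z * k z - psi y * k y = (psi z - psi y) * k z + psi y * (k z - k y) by ring.
apply: (le_trans (ler_normD _ _)); rewrite !normrM.
have h1 : `|psi z - psi y| * `|k z| <= Q * u * 1.
  apply: ler_pM => //; apply: (le_trans (ps2 y z yz)).
  by rewrite ler_wpM2r//; exact: psB.
have h2 : `|psi y| * `|k z - k y| <= Q * (3 * u).
  apply: ler_pM => //; first by apply: (le_trans (ps1 y)); exact: psB.
  by apply: (le_trans (kL y z)); lra.
by lra.
Qed.

(** If [r < del] and [c] is close to the ball, [phi] may be concentrated inside it; its total
    integral is then at most of order [B], and the right-hand volume times size is of order 1.
    Otherwise [phi] has, on the whole ball, the size prescribed at [w] at scale [Num.max r del]. *)
Lemma integral_le_sizef : exists2 K, 1 <= K & forall del c r (phi : X -> R) B w A,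
  0 < del -> 0 < r -> Gbound d mu c r beta gam phi B -> measurable A ->
  A `<=` dball d w del ->
  (\int[mu]_(z in A) (`|phi z|)%:E <=
   (K * B * (sizef d mu c (Num.max r del) gam w * Vr d mu del w))%:E)%E.
Proof.
have [K1 K11 HK1] := sizef_compare H 3 gam ltac:(lra) (ltW g0).
have [K2 K21 HK2] := integrable_le_sizef H gam g0.
exists (K1 * K2); first exact: mulr_ege1.
move=> del c r phi B w A del0 r0 pB mA Aw; have [B0 [p1 _]] := pB.
have V0 := Vr_gt0 H w del del0.
have mphi := Gbound_measurable H c r beta gam phi B r0 b0 pB.
have mnphi : measurable_fun A (EFin \o (fun z => `|phi z|)).
  apply/measurable_EFinP; apply: measurable_funTS; exact: measurableT_comp.
have s0 : 0 < Num.max r del by rewrite lt_max r0.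
have rs : r <= Num.max r del by rewrite le_max lexx.
have ds : del <= Num.max r del by rewrite le_max lexx orbT.
set s := Num.max r del in s0 rs ds *.
have S0 := sizef_ge0 H c s gam w s0.
have [far|near] := boolP ((del <= r) || (2 * del <= d c w)).
  have sd z : dball d w del z -> s + d c w <= 3 * (r + d c z).
    rewrite /dball /= => wz; have := dist_triangle H c z w; rewrite (distC H z w) => h.
    have cz := dist_ge0 H c z; rewrite /s maxEle.
    by case/orP: far => far; case: ifPn; rewrite -?ltNge; lra.
  apply: (@le_trans _ _ (\int[mu]_(z in A) (B * (K1 * sizef d mu c s gam w))%:E)%E).
    apply: ge0_le_integral => //.
    move=> z /Aw wz; rewrite lee_fin; apply: (le_trans (p1 z)).
    rewrite ler_wpM2l//; have cz := dist_ge0 H c z.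
    by apply: HK1; rewrite ?(dist_xx H) ?sd//; lra.
  rewrite integral_cst//.
  apply: (@le_trans _ _ ((B * (K1 * sizef d mu c s gam w))%:E * mu (dball d w del))%E).
    rewrite lee_wpmul2l ?lee_fin//; first by rewrite mulr_ge0// mulr_ge0//; lra.
    by apply: le_measure; rewrite ?inE//; exact: (measurable_dball H).
  rewrite (mu_dball H) -EFinM lee_fin.
  have : 0 <= B * K1 * (sizef d mu c s gam w * Vr d mu del w).
    by rewrite mulr_ge0//; [rewrite mulr_ge0//; lra|rewrite mulr_ge0// ltW].
  set t := B * K1 * _ => t0.
  have -> : B * (K1 * sizef d mu c s gam w) * Vr d mu del w = t by rewrite /t; ring.
  have -> : K1 * K2 * B * (sizef d mu c s gam w * Vr d mu del w) = K2 * t by rewrite /t; ring.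
  by rewrite ler_peMl.
rewrite negb_or -!ltNge in near; have /andP[rd cw] := near.
have sE : s = del by rewrite /s maxEle ltW.
have [i1 i2] := HK2 phi c r c r B 0 r0 r0 B0 (lexx 0) mphi ltac:(by move=> y; rewrite mul0r addr0).
have i3 : (\int[mu]_(z in A) (`|phi z|)%:E <= (K2 * B)%:E)%E.
  apply: (@le_trans _ _ (\int[mu]_z (`|phi z|)%:E)%E).
    apply: ge0_subset_integral => //.
    by apply/measurable_EFinP; exact: measurableT_comp.
  have ifin := integrable_fin_num measurableT (integrable_norm i1).
  by move: i2; rewrite addr0 -lee_fin /Rintegral fineK.
apply: (le_trans i3); rewrite lee_fin.
have h : 1 <= K1 * (sizef d mu c s gam w * Vr d mu del w).
  rewrite mulrA -ler_pdivrMr// mul1r -(sizef_center H w del gam del0).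
  have cw0 := dist_ge0 H c w.
  by apply: HK1; rewrite ?(dist_xx H) ?(distC H w c) ?sE//; lra.
have -> : K1 * K2 * B * (sizef d mu c s gam w * Vr d mu del w) =
  (K2 * B) * (K1 * (sizef d mu c s gam w * Vr d mu del w)) by ring.
by rewrite ler_peMr// mulr_ge0//; lra.
Qed.

End Localization.
Arguments tent {R dX X} d w s j y.
Arguments tentmax {R dX X} d w s j y.

(** All that the estimates use about the size of [L]: one number per ball, valid for functions that
    are test functions about every point of that ball. The infimum of the localised maximal function
    is an instance, since such a function competes at each of these points. *)
Record sampled_bound {R : realType} {dX : measure_display} {X : measurableType dX}
    (d : X -> X -> R) (mu : {measure set X -> \bar R}) (x1 : X) (eps beta gam del : R)
    (L : (X -> R) -> R) (w : nat -> X) (m : nat -> R) : Prop := {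
  sb_cover : forall x, exists j, d (w j) x < del ;
  sb_far : forall c rho, exists J, forall j, (J <= j)%N -> rho <= d c (w j) ;
  sb_ge0 : forall j, 0 <= m j ;
  sb_bound : forall j f C, 0 < C -> G0 d mu x1 eps beta gam f ->
    (forall x, d (w j) x < del -> Gbound d mu x del beta gam f C) -> `|L f| <= C * m j }.
Arguments sb_cover {R dX X d mu x1 eps beta gam del L w m} _.
Arguments sb_far {R dX X d mu x1 eps beta gam del L w m} _.
Arguments sb_ge0 {R dX X d mu x1 eps beta gam del L w m} _.
Arguments sb_bound {R dX X d mu x1 eps beta gam del L w m} _.

(** * Pointwise bounds by sums over the net *)

Section Pointwise.
Context {R : realType} {dX : measure_display} {X : measurableType dX}.
Context {d : X -> X -> R} {mu : {measure set X -> \bar R}} {n C1 : R}.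
Context (H : doubling_space d mu n C1) (muX : mu [set: X] = +oo%E).
Implicit Types (x y z c : X) (s r a : R).
Context {eps1 eps2 eps3 C4 : R} {x1 : X} {eps beta gam : R}.
Context (b0 : 0 < beta) (be : beta <= eps) (e1 : eps < eps1) (e11 : eps1 <= 1).
Context (g0 : 0 < gam) (ge : gam < eps) (e2 : eps < eps2) (C40 : 0 < C4).

(** For [r >= del], up to constants, the integral of the size function over the [j]-th ball. *)
Let weight (w : nat -> X) del c r j := sizef d mu c r gam (w j) * Vr d mu del (w j).

Lemma sizef_gt0 c s a y : 0 < s -> 0 < sizef d mu c s a y.
Proof.
by move=> s0; have := bump_le_sizef H c s a y s0; have := bump_gt0 H c s a y s0; lra.
Qed.

(** Without cancellation: after recentring, [T z] is a test function about every point of the ball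
    that contains [z], so [L (T z)] is at most a multiple of [m j] there, and it remains to
    integrate [phi] cell by cell. *)
Lemma dual_kernel_integral_le : exists2 K, 1 <= K & forall del (T : X -> X -> R) L w m,
  approx_kernel d mu eps1 eps2 eps3 C4 del T -> in_dual d mu x1 eps beta gam L ->
  sampled_bound d mu x1 eps beta gam del L w m -> forall c r (phi : X -> R) B t,
  0 < r -> Gbound d mu c r beta gam phi B ->
  (forall J, \sum_(0 <= j < J) m j * weight w del c (Num.max r del) j <= t) ->
  mu.-integrable [set: X] (EFin \o (fun z => L (T z) * phi z)) /\
  `|Rintegral mu [set: X] (fun z => L (T z) * phi z)| <= K * B * t.
Proof.
have hb0 := b0; have hbe := be; have he1 := e1; have he11 := e11.
have hg0 := g0; have hge := ge; have he2 := e2; have hC4 := C40.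
have [K1 K11 HK1] := Gbound_recenter H 2 beta gam ltac:(lra) (ltW b0) (ltW g0).
have [K2 K21 HK2] := integral_le_sizef H b0 g0.
exists (1 + K1 * C4 * K2) => [|del T L w m HT dL Hw c r phi B t r0 pB ht].
  by rewrite lerDl mulr_ge0 ?mulr_ge0//; lra.
have del0 := ak_scale HT; have [B0 _] := pB.
have gm z j : d (w j) z < del -> `|L (T z)| <= K1 * C4 * m j.
  move=> wz; apply: (sb_bound Hw); first by rewrite mulr_gt0//; lra.
    exact: (kernel_G0 H HT b0 be e1 ge e2).
  move=> x wx; apply: (HK1 z del) => //; try lra.
    by have := dist_triangle H z (w j) x; rewrite (distC H z (w j)); lra.
  by apply: (kernel_Gbound H HT); lra.
have mphi := Gbound_measurable H c r beta gam phi B r0 b0 pB.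
have mg := measurable_kernel_dual H HT b0 be e1 g0 ge e2 dL.
have mgp : measurable_fun [set: X] (fun z => L (T z) * phi z) by exact: measurable_funM.
pose A := seqDU (fun j => dball d (w j) del).
have mA j : measurable (A j) by exact: (measurable_seqDU_dball H).
have AX : \bigcup_k A k = [set: X].
  apply/seteqP; split => // z _; rewrite -seqDU_bigcup_eq.
  by have [j jz] := sb_cover Hw z; exists j.
have K0 : 0 <= K1 * C4 by rewrite mulr_ge0//; lra.
have m0 := sb_ge0 Hw.
have s0 : 0 < Num.max r del by rewrite lt_max r0.
have W0 j : 0 <= weight w del c (Num.max r del) j.
  by rewrite /weight mulr_ge0 ?(sizef_ge0 H)//; exact: (Vr_ge0 H).
have t0 : 0 <= t by have := ht 0%N; rewrite big_geq.
have piece j : (\int[mu]_(z in A j) (`|L (T z) * phi z|)%:E <=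
    (K1 * C4 * K2 * B * (m j * weight w del c (Num.max r del) j))%:E)%E.
  have mn : measurable_fun (A j) (EFin \o (fun z => `|phi z|)).
    by apply/measurable_EFinP/measurable_funTS; exact: measurableT_comp.
  apply: (@le_trans _ _ (\int[mu]_(z in A j) ((K1 * C4 * m j)%:E * (`|phi z|)%:E))%E).
    apply: ge0_le_integral => //.
    - by apply/measurable_EFinP/measurable_funTS; exact: measurableT_comp.
    - exact: measurable_funeM.
    move=> z /(@subset_seqDU _ (fun j => dball d (w j) del)) wz.
    by rewrite -EFinM lee_fin normrM ler_wpM2r//; exact: gm.
  rewrite ge0_integralZl//; last by rewrite lee_fin mulr_ge0.
  have := HK2 del c r phi B (w j) (A j) del0 r0 pB (mA j)
    (@subset_seqDU _ (fun j => dball d (w j) del) j).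
  move=> h; apply: (le_trans (lee_wpmul2l _ h)); first by rewrite lee_fin mulr_ge0.
  by rewrite -EFinM lee_fin /weight le_eqVlt; apply/orP; left; apply/eqP; ring.
have bound : (\int[mu]_z (`|L (T z) * phi z|)%:E <= (K1 * C4 * K2 * B * t)%:E)%E.
  rewrite -AX ge0_integral_bigcup//; last 2 first.
  - by rewrite AX; apply/measurable_EFinP; exact: measurableT_comp.
  - exact: trivIset_seqDU.
  apply: nneseries_le_bound => [j|N]; first by apply: integral_ge0 => z _; rewrite lee_fin.
  apply: (@le_trans _ _ (\sum_(0 <= j < N)
    (K1 * C4 * K2 * B * (m j * weight w del c (Num.max r del) j))%:E)%E).
    exact: lee_sum.
  rewrite sumEFin lee_fin -big_distrr/= ler_wpM2l//.
  by rewrite mulr_ge0// mulr_ge0//; lra.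
have igp : mu.-integrable [set: X] (EFin \o (fun z => L (T z) * phi z)).
  apply/integrableP; split; first exact/measurable_EFinP.
  by apply: le_lt_trans (ltry (K1 * C4 * K2 * B * t)).
split => //; apply: (le_trans (le_normr_Rintegral _ igp)) => //.
apply: (@le_trans _ _ (K1 * C4 * K2 * B * t)).
  have ifin := integrable_fin_num measurableT (integrable_norm igp).
  by rewrite -lee_fin /Rintegral fineK.
have : 0 <= B * t by rewrite mulr_ge0.
by lra.
Qed.

(** Two truncations are needed: [phi] is cut at radius [N] so that [L] passes through the adjoint,
    and [psi] at radius [M] so that finitely many tents decompose it. Each piece is estimated by
    [Gbound_localized] and [sb_bound]. Three limiting errors arise, hence [e = e0 / 3]. *)
Lemma dual_difference_le : exists2 K, 1 <= K & forall del (T : X -> X -> R) L w m,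
  approx_kernel d mu eps1 eps2 eps3 C4 del T -> in_dual d mu x1 eps beta gam L ->
  sampled_bound d mu x1 eps beta gam del L w m -> forall c r (phi : X -> R) B t,
  del <= r -> 0 < B -> G0 d mu x1 eps beta gam phi -> Gbound d mu c r beta gam phi B ->
  (forall J, \sum_(0 <= j < J) m j * weight w del c r j <= t) ->
  `|L phi - Rintegral mu [set: X] (fun z => L (T z) * phi z)| <=
  K * B * ((del / r) `^ beta * t).
Proof.
have hb0 := b0; have hbe := be; have he1 := e1; have he11 := e11.
have hg0 := g0; have hge := ge; have he2 := e2; have hC4 := C40.
have e'1 : eps <= 1 by lra.
have b01 : 0 < beta <= 1 by rewrite b0; lra.
have [K1 K11 HK1] := Gbound_localized (eps3 := eps3) H b0 be e1 e11 g0 ge e2 C40.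
have [K2 K21 HK2] := dual_kernel_integral_le.
have [K3 K31 HK3] := integrable_le_sizef H gam g0.
exists (7 * K1) => [|del T L w m HT dL Hw c r phi B t dr B0 phiG pB ht]; first by lra.
have del0 := ak_scale HT; have r0 : 0 < r by lra.
have rE : Num.max r del = r by rewrite maxEle; case: ifPn; rewrite -?ltNge; lra.
have [igp _] := HK2 del T L w m HT dL Hw c r phi B t r0 pB ltac:(by rewrite rE).
have m0 := sb_ge0 Hw.
set q := (del / r) `^ beta; have q0 : 0 < q by rewrite powR_gt0 ?divr_gt0.
have W0 j : 0 < weight w del c r j.
  by rewrite /weight mulr_gt0 ?sizef_gt0//; exact: (Vr_gt0 H).
apply/ler_addgt0Pr => e0 e00; pose e : R := e0 / 3; have epos : 0 < e by rewrite divr_gt0.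
have [N1 HN1] := dual_cutoff_limit H b0 be e'1 ge dL phi e phiG epos.
have [N2 HN2] := Rintegral_cutoff_limit H x1 _ e igp epos.
have cx := dist_ge0 H c x1.
(* [N] is large for the convergence of [L], for that of the integral, and for the uniform bound 7 on
   truncation about the centre [c]. *)
have [N NN NI] := HN2 (Num.max N2 (Num.max N1 (r + d c x1))) ltac:(by rewrite le_max lexx).
have NN1 : N1 <= N by apply: le_trans NN; rewrite !le_max lexx orbT.
have NN3 : r + d c x1 <= N by apply: le_trans NN; rewrite !le_max lexx !orbT.
have N0 : 0 < N by lra.
pose phi' y := phi y * cutoff d x1 N y.
have phi'B : Gbound d mu c r beta gam phi' (7 * B) by exact: (Gbound_cutoff H).
have phi'G : G0 d mu x1 eps beta gam phi' by exact: (G0_cutoff H b0 be e'1 ge).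
have iphi' : mu.-integrable [set: X] (EFin \o phi').
  have [p0 [p1 _]] := phi'B.
  apply: (HK3 phi' c r c r (7 * B) 0 r0 r0 p0 (lexx 0) _ _).1.
    exact: (Gbound_measurable H c r beta gam phi' (7 * B)).
  by move=> y; rewrite mul0r addr0.
have phi'S y : phi' y != 0 -> d x1 y <= 2 * N.
  by rewrite mulf_eq0 negb_or => /andP[_]; exact: cutoff_support.
have [_ Ladj] := dual_adjoint H HT b0 be e1 g0 ge e2 dL phi' (2 * N) muX iphi' phi'S.
have adjG := adjoint_G0 H HT b0 be e1 ge e2 phi' (2 * N) iphi' phi'S.
pose psi y := phi' y - adjoint (mu := mu) (T := T) phi' y.
have psiG : G0 d mu x1 eps beta gam psi by exact: (G0_sub H b0 be ge).
have Lpsi : L psi = L phi' - Rintegral mu [set: X] (fun z => L (T z) * phi z * cutoff d x1 N z).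
  rewrite /psi (dual_sub dL)// Ladj; congr (_ - _).
  by apply: eq_Rintegral => z _; rewrite /phi' mulrA.
have [M0 HM] := dual_cutoff_limit H b0 be e'1 ge dL psi e psiG epos.
pose M := Num.max M0 del.
have Mdel : del <= M by rewrite le_max lexx orbT.
have Mpos : 0 < M by lra.
have hM := HM M ltac:(by rewrite le_max lexx).
have [J HJ] := sb_far Hw x1 (2 * M + del).
pose k j y := cutoff d x1 M y * tent d w del j y.
have k01 j y : 0 <= k j y <= 1.
  have /andP[c1 c2] := cutoff01 (d := d) (x1 := x1) M y.
  have /andP[c3 c4] := tent01 (d := d) w del j y.
  by rewrite mulr_ge0//= mulr_ile1.
(* The tent contributes 2 and the cutoff 1, because [del <= M]. *)
have kL j y z : `|k j z - k j y| <= 3 * (d y z / del).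
  have /andP[c1 c2] := cutoff01 (d := d) (x1 := x1) M y.
  have /andP[c3 c4] := tent01 (d := d) w del j z.
  have -> : k j z - k j y = (cutoff d x1 M z - cutoff d x1 M y) * tent d w del j z +
     cutoff d x1 M y * (tent d w del j z - tent d w del j y) by rewrite /k; ring.
  apply: (le_trans (ler_normD _ _)); rewrite !normrM (ger0_norm c1) (ger0_norm c3).
  have h1 : `|cutoff d x1 M z - cutoff d x1 M y| * tent d w del j z <= d y z / M * 1.
    by apply: ler_pM => //; exact: (cutoff_lipschitz H).
  have h2 : cutoff d x1 M y * `|tent d w del j z - tent d w del j y| <= 1 * (2 * (d y z / del)).
    by apply: ler_pM => //; exact: (tent_lipschitz H).
  have h3 : d y z / M <= d y z / del.
    by rewrite ler_wpM2l ?(dist_ge0 H)// lef_pV2 ?posrE.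
  by lra.
have ks1 j y : k j y != 0 -> d x1 y <= 2 * M.
  by rewrite mulf_eq0 negb_or => /andP[h _]; exact: cutoff_support h.
have ks2 j y : k j y != 0 -> d (w j) y <= 2 * del.
  by rewrite mulf_eq0 negb_or => /andP[_]; exact: tent_support.
have kG j : G0 d mu x1 eps beta gam (fun y => psi y * k j y).
  apply: (G0_mul_cutoff H b0 be e'1 ge psi (k j) (2 * M) (del / 3) psiG _ (k01 j) _ (ks1 j)).
    by rewrite divr_gt0.
  move=> y z; apply: (le_trans (kL j y z)); rewrite le_eqVlt; apply/orP; left; apply/eqP.
  by field; lra.
have sumk : (fun y => psi y * cutoff d x1 M y) = (fun y => \sum_(0 <= j < J) psi y * k j y).
  apply/funext => y; rewrite -big_distrr/=; congr (_ * _).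
  rewrite /k -big_distrr/= sum_tent.
  have [->|/cutoff_support h] := eqVneq (cutoff d x1 M y) 0; first by rewrite mul0r.
  rewrite tentmax1 ?mulr1//; have [j wj] := sb_cover Hw y; exists j; last exact: ltW.
  rewrite ltnNge; apply/negP => /HJ; have := dist_triangle H x1 y (w j).
  by rewrite (distC H y (w j)); have := h Mpos; lra.
have piece j : `|L (fun y => psi y * k j y)| <= 7 * K1 * B * q * (m j * weight w del c r j).
  have -> : 7 * K1 * B * q * (m j * weight w del c r j) =
    K1 * (7 * B * q * weight w del c r j) * m j by ring.
  apply: (sb_bound Hw) => //.
    by apply: mulr_gt0; [lra|rewrite mulr_gt0// mulr_gt0//; lra].
  move=> x wx; apply: (HK1 del T HT c r phi' (7 * B) dr phi'B (w j) (k j) x (k01 j) (kL j) (ks2 j)).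
  by rewrite (distC H) ltW.
have hsum : `|L (fun y => psi y * cutoff d x1 M y)| <= 7 * K1 * B * q * t.
  rewrite sumk (dual_sum H b0 be ge dL _ _ kG); apply: (le_trans (ler_norm_sum _ _ _)).
  apply: (le_trans (ler_sum _ (fun j _ => piece j))).
  rewrite -big_distrr/= ler_wpM2l//.
  by rewrite !mulr_ge0 ?(ltW q0) ?(ltW B0)//; lra.
have h1 := HN1 N NN1.
have -> : L phi - Rintegral mu [set: X] (fun z => L (T z) * phi z) =
  (L phi - L phi') + L psi - (Rintegral mu [set: X] (fun z => L (T z) * phi z) -
   Rintegral mu [set: X] (fun z => L (T z) * phi z * cutoff d x1 N z)) by rewrite Lpsi; ring.
apply: (le_trans (ler_normB _ _)); apply: (le_trans (lerD (ler_normD _ _) (lexx _))).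
have h4 : `|L psi| <= e + 7 * K1 * B * q * t.
  have -> : L psi = (L psi - L (fun y => psi y * cutoff d x1 M y)) +
    L (fun y => psi y * cutoff d x1 M y) by ring.
  by apply: (le_trans (ler_normD _ _)); apply: lerD.
have -> : 7 * K1 * B * (q * t) + e0 = e + (e + 7 * K1 * B * q * t) + e.
  by rewrite /e; field.
by apply: lerD => //; apply: lerD.
Qed.

End Pointwise.

(** * Sampling the localised grand maximal function *)

Section GrandMaximal.
Context {R : realType} {dX : measure_display} {X : measurableType dX}.
Context {d : X -> X -> R} {mu : {measure set X -> \bar R}} {n C1 : R}.
Context (H : doubling_space d mu n C1).
Implicit Types (x y z c : X) (s r a : R).
Context {x1 : X} {eps beta gam : R}.
Context (b0 : 0 < beta) (be : beta <= eps) (ge : gam < eps).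
Context {L : (X -> R) -> R} (dL : in_dual d mu x1 eps beta gam L).

Lemma tpow_gt0 (l : int) : 0 < tpow l :> R.
Proof. by rewrite /tpow powR_gt0. Qed.

Lemma grand_max_ge0 o (F : (X -> R) -> R) x : (0 <= grand_max d mu x1 eps beta gam o F x)%E.
Proof.
have zG : G0 d mu x1 eps beta gam (fun=> 0) by exact: (G0_0 H b0 be ge).
apply: (@le_trans _ _ (`|F (fun=> 0)|)%:E); first by rewrite lee_fin.
apply: ereal_sup_ubound; exists (fun=> 0) => //; split => //.
have zB r : Gbound d mu x r beta gam (fun=> 0) 0 by exact: Gbound0.
have zn r : Gnorm d mu x r beta gam (fun=> 0) <= 1 by apply: le_trans (Gnorm_le _ _ _ _ _ _ (zB r)) _.
have zi r : inG d mu x r beta gam (fun=> 0) by exists 0.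
by case: o => [l|]; [exists (tpow l); rewrite tpow_gt0 lexx|exists 1; rewrite ltr01].
Qed.

(** Homogeneity: [C^-1 * f] is normalised. It is written as a linear combination with the zero
    function, the form in which linearity of [L] is available. *)
Lemma dual_le_grand_max (l : int) x r f C : 0 < C -> 0 < r -> r <= tpow l ->
  G0 d mu x1 eps beta gam f -> Gbound d mu x r beta gam f C ->
  ((C^-1 * `|L f|)%:E <= grand_max d mu x1 eps beta gam (Some l) L x)%E.
Proof.
move=> C0 r0 rl fG fC; apply: ereal_sup_ubound.
have zG : G0 d mu x1 eps beta gam (fun=> 0) by exact: (G0_0 H b0 be ge).
have zB : Gbound d mu x r beta gam (fun=> 0) 0 by exact: Gbound0.
have gB : Gbound d mu x r beta gam (fun y => C^-1 * f y + 0 * 0) 1.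
  have -> : 1 = `|C^-1| * C + `|0 : R| * 0 :> R.
    by rewrite mulr0 addr0 gtr0_norm ?invr_gt0// mulVf ?gt_eqF.
  exact: (Gbound_lin x r beta gam f (fun=> 0)).
exists (fun y => C^-1 * f y + 0 * 0).
  split; first exact: (G0_lin H b0 be ge _ _ f (fun=> 0)).
  exists r; split => //; split => //; split; [by exists 1|exact: Gnorm_le].
rewrite (dual_lin dL C^-1 0 f (fun=> 0))// mul0r addr0 normrM.
by rewrite gtr0_norm ?invr_gt0.
Qed.

Context (l : int) {p : R} (p0 : 0 < p).
Let del : R := tpow l.
Let G := grand_max d mu x1 eps beta gam (Some l) L.
Context (Gfin : (\int[mu]_x (G x `^ p) < +oo)%E).
Context {w : nat -> X} (wsep : forall i j, i <> j -> del <= d (w i) (w j)).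
Context (wcov : forall x, exists j, d (w j) x < del).
Context (wfar : forall c rho, exists J, forall j, (J <= j)%N -> rho <= d c (w j)).

(** [fine] sends [+oo] to 0, so this is the infimum only once the latter is known to be finite,
    which is what [grand_max_finite] provides. *)
Definition ball_inf j : R := fine (ereal_inf [set G x | x in dball d (w j) del]).

Let del0 : 0 < del. Proof. exact: tpow_gt0. Qed.

(** If [G] were infinite on the ball, the lower integral of its [p]-th power would exceed [t] times
    the volume for every [t]; the chosen [t] gives the value of the integral plus 1. *)
Lemma grand_max_finite j : exists2 x, dball d (w j) del x & (G x < +oo)%E.
Proof.
apply: contrapT => hx.
have Gy x : dball d (w j) del x -> G x = +oo%E.
  by move=> xB; apply/eqP; rewrite -leye_eq leNgt; apply/negP => Gx; apply: hx; exists x.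
have V0 := Vr_gt0 H (w j) del del0.
have mB := measurable_dball H (w j) del.
have Ilt := Gfin; set I := (\int[mu]_x (G x `^ p))%E in Ilt.
have I0 : (0 <= I)%E by apply: integral_ge0 => x _; exact: poweR_ge0.
have If : I \is a fin_num by rewrite ge0_fin_numE.
pose t := (fine I + 1) / Vr d mu del (w j).
have I0' : 0 <= fine I by exact: fine_ge0.
have t0 : 0 <= t by rewrite divr_ge0 ?(ltW V0)//; lra.
have : (\int[mu]_x (t%:E * (\1_(dball d (w j) del) x)%:E) <= I)%E.
  apply: le_lower_integral => x; first by rewrite mule_ge0// lee_fin.
  rewrite indicE; have [/set_mem xB|_] := boolP (x \in _).
    by rewrite (Gy _ xB) poweRyr ?leey// gt_eqF.
  by rewrite mule0 poweR_ge0.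
rewrite ge0_integralZl//; last exact/measurable_EFinP/measurable_indic.
rewrite integral_indic// setIT (mu_dball H) -EFinM /t divfK ?gt_eqF// => hI.
have : fine I + 1 <= fine I by rewrite -lee_fin (fineK If).
by lra.
Qed.

Lemma ball_inf_EFin j : (ball_inf j)%:E = ereal_inf [set G x | x in dball d (w j) del].
Proof.
rewrite /ball_inf fineK// ge0_fin_numE; last first.
  by apply: le_ereal_inf_tmp => _ [x _ <-]; exact: grand_max_ge0.
have [x xB Gx] := grand_max_finite j.
by apply: le_lt_trans Gx; apply: ereal_inf_lbound; exists x.
Qed.

Lemma ball_inf_le j x : d (w j) x < del -> ((ball_inf j)%:E <= G x)%E.
Proof. by move=> xB; rewrite ball_inf_EFin; apply: ereal_inf_lbound; exists x. Qed.

Lemma ball_inf_ge (j : nat) (t : R) :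
  (forall x, d (w j) x < del -> (t%:E <= G x)%E) -> t <= ball_inf j.
Proof.
move=> h; rewrite -lee_fin ball_inf_EFin; apply: le_ereal_inf_tmp => _ [x xB <-].
exact: h.
Qed.

Lemma sampled_ball_inf : sampled_bound d mu x1 eps beta gam del L w ball_inf.
Proof.
split => //.
- by move=> j; apply: ball_inf_ge => x _; exact: grand_max_ge0.
move=> j f C C0 fG fB; rewrite -ler_pdivrMl//; apply: ball_inf_ge => x xB.
by apply: (dual_le_grand_max l x del) => //; exact: fB.
Qed.

(** The balls of half the radius are disjoint by separation, so the step function with values
    [ball_inf j]^ p[on them lies below the power of]G[. Doubling returns to the full balls at the
    cost]C1 * 2 [^ n]. *)
Lemma sum_ball_inf_le : (\sum_(j <oo) (ball_inf j `^ p * Vr d mu del (w j))%:E <=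
  (C1 * 2 `^ n)%:E * \int[mu]_x (G x `^ p))%E.
Proof.
have C11 := ds_C1 H; have K0 : 0 <= C1 * 2 `^ n by rewrite mulr_ge0 ?powR_ge0//; lra.
have m0 := sb_ge0 sampled_ball_inf.
pose B j := dball d (w j) (del / 2).
have mB j : measurable (B j) by exact: (measurable_dball H).
pose u j x : \bar R := ((ball_inf j `^ p)%:E * (\1_(B j) x)%:E)%E.
have u0 j x : (0 <= u j x)%E by rewrite mule_ge0// lee_fin powR_ge0.
have mu_ j : measurable_fun [set: X] (u j).
  by apply: measurable_funeM; exact/measurable_EFinP/measurable_indic.
apply: (@le_trans _ _ ((C1 * 2 `^ n)%:E * \int[mu]_x \sum_(j <oo) u j x)%E); last first.
  rewrite lee_wpmul2l ?lee_fin//; apply: le_lower_integral => x.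
    by apply: nneseries_ge0.
  apply: nneseries_le_bound => // N.
  have [[j xj]|nx] := pselect (exists j, B j x).
    have uj i : u i x = if i == j then u j x else 0%E.
      case: eqVneq => [->//|/eqP ij]; rewrite /u indicE memNset ?mule0// => xi.
      have := wsep i j ij; have := dist_triangle H (w i) x (w j).
      move: xi xj; rewrite /B /dball /= (distC H x (w j)).
      by move=> ? ? ? ?; lra.
    apply: (@le_trans _ _ (u j x)).
      rewrite (eq_bigr (fun i => if i == j then u j x else 0%E)) => [|i _]; last exact: uj.
      by rewrite -big_mkcond/= big_nat1_eq; case: ifPn.
    rewrite /u indicE mem_set// mule1 -poweR_EFin.
    apply: gt0_ler_poweR; rewrite ?(ltW p0) ?in_itv/= ?leey ?andbT ?lee_fin//.
      exact: grand_max_ge0.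
    by apply: ball_inf_le; move: xj; rewrite /B /dball /=; have := del0; lra.
  rewrite big1 ?poweR_ge0// => i _; rewrite /u indicE memNset ?mule0// => xi.
  by apply: nx; exists i.
rewrite integral_nneseries// -nneseriesZl; last by move=> j _; apply: integral_ge0 => x _; exact: u0.
apply: lee_nneseries => [j _ _|j _].
  by rewrite lee_fin mulr_ge0 ?powR_ge0//; exact: (Vr_ge0 H).
rewrite ge0_integralZl//; last 2 first.
- exact/measurable_EFinP/measurable_indic.
- by rewrite lee_fin powR_ge0.
rewrite integral_indic// setIT (mu_dball H) -!EFinM lee_fin mulrCA ler_wpM2l ?powR_ge0//.
by apply: (Vr_doubling H) => //; rewrite ?(dist_xx H); have := del0; lra.
Qed.

End GrandMaximal.

(** * One integrable majorant for all scales of test functions *)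

Section Majorant.
Context {R : realType} {dX : measure_display} {X : measurableType dX}.
Context {d : X -> X -> R} {mu : {measure set X -> \bar R}} {n C1 : R}.
Context (H : doubling_space d mu n C1).
Implicit Types (x y z c : X) (s r a : R).
Context {beta gam p : R} (p0 : 0 < p) (p1 : p <= 1).
Context (bp : n * (1 - p) < beta * p) (gp : n * (1 - p) < gam * p) (b0 : 0 < beta) (g0 : 0 < gam).

Definition majorant_coef (w : nat -> X) (m : nat -> R) del (k j : nat) : R :=
  (2 ^- k) `^ (beta * p) * (m j `^ p * Vr d mu del (w j) `^ p).

Definition majorant (w : nat -> X) (m : nat -> R) del x : \bar R :=
  (\sum_(k <oo) \sum_(j <oo) (majorant_coef w m del k j)%:E *
     dyadic (d := d) (mu := mu) p (w j) (2 ^+ k * del) gam x)%E.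

Lemma majorant_coef_ge0 w m del k j : 0 <= majorant_coef w m del k j.
Proof. by rewrite /majorant_coef !mulr_ge0 ?powR_ge0. Qed.

Lemma majorant_term_ge0 w m del k j x : (0 <= (majorant_coef w m del k j)%:E *
     dyadic (d := d) (mu := mu) p (w j) (2 ^+ k * del) gam x)%E.
Proof. by rewrite mule_ge0 ?lee_fin ?majorant_coef_ge0 ?dyadic_ge0. Qed.

Lemma majorant_ge0 w m del x : (0 <= majorant w m del x)%E.
Proof.
apply: nneseries_ge0 => k _ _; apply: nneseries_ge0 => j _ _; exact: majorant_term_ge0.
Qed.

Lemma measurable_majorant_term w m del k j : measurable_fun [set: X]
  (fun x => (majorant_coef w m del k j)%:E *
     dyadic (d := d) (mu := mu) p (w j) (2 ^+ k * del) gam x)%E.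
Proof. by apply: measurable_funeM; exact: (measurable_dyadic H). Qed.

Lemma measurable_majorant w m del : measurable_fun [set: X] (majorant w m del).
Proof.
apply: ge0_emeasurable_sum => [k x _ _|k _].
  by apply: nneseries_ge0 => j _ _; exact: majorant_term_ge0.
apply: ge0_emeasurable_sum => [j x _ _|j _]; first exact: majorant_term_ge0.
exact: measurable_majorant_term.
Qed.

Lemma integral_majorant_le : exists2 K, 0 <= K & forall w m del s, 0 < del ->
  (forall j, 0 <= m j) ->
  (\sum_(j <oo) (m j `^ p * Vr d mu del (w j))%:E <= s%:E)%E ->
  (\int[mu]_x majorant w m del x <= (K * s)%:E)%E.
Proof.
have hp0 := p0; have hp1 := p1; have hbp := bp; have hgp := gp; have C11 := ds_C1 H.
have [K K1 HK] := integral_dyadic_le H p gam ltac:(by rewrite p0) gp.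
pose q : R := 2 `^ (- (beta * p - n * (1 - p))).
have q0 : 0 <= q := powR_ge0 _ _.
have q1 : q < 1.
  rewrite /q powRN invf_lt1 ?powR_gt0//.
  rewrite ltNge; apply/negP => h; have : (2 : R) `^ 0 < 2 `^ (beta * p - n * (1 - p)).
    by rewrite /powR pnatr_eq0/= ltr_expR mul0r mulr_gt0 ?ln_gt0//; lra.
  by rewrite powRr0 ltNge h.
pose Kc := K * C1 `^ (1 - p).
have Kc0 : 0 <= Kc by rewrite mulr_ge0 ?powR_ge0//; lra.
exists (Kc * (1 - q)^-1).
  by rewrite mulr_ge0// invr_ge0; lra.
move=> w m del s del0 m0 hs.
have V0 j := Vr_gt0 H (w j) del del0.
have s0 : 0 <= s.
  rewrite -lee_fin; apply: le_trans hs; apply: nneseries_ge0 => j _ _.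
  by rewrite lee_fin mulr_ge0 ?powR_ge0// ltW.
rewrite integral_nneseries//; last 2 first.
- move=> k; apply: ge0_emeasurable_sum => [j x _ _|j _]; first exact: majorant_term_ge0.
  exact: measurable_majorant_term.
- by move=> k x _; apply: nneseries_ge0 => j _ _; exact: majorant_term_ge0.
apply: (@le_trans _ _ ((Kc * s)%:E * \sum_(k <oo) (q ^+ k)%:E)%E); last first.
  rewrite (_ : Kc * (1 - q)^-1 * s = (Kc * s) * (1 - q)^-1); last by ring.
  rewrite [leRHS]EFinM; apply: lee_wpmul2l; first by rewrite lee_fin mulr_ge0.
  by apply: nneseries_geometric_le; rewrite q0.
rewrite -nneseriesZl; last by move=> i _; rewrite lee_fin exprn_ge0.
apply: lee_nneseries => [k _ _|k _].
  apply: integral_ge0 => x _; apply: nneseries_ge0 => j _ _; exact: majorant_term_ge0.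
rewrite integral_nneseries//; last 2 first.
- by move=> j; exact: measurable_majorant_term.
- by move=> j x _; exact: majorant_term_ge0.
apply: (@le_trans _ _ ((Kc * q ^+ k)%:E * \sum_(j <oo) (m j `^ p * Vr d mu del (w j))%:E)%E); last first.
  rewrite -EFinM (_ : Kc * s * q ^+ k = (Kc * q ^+ k) * s); last by ring.
  by rewrite [leRHS]EFinM lee_wpmul2l// lee_fin mulr_ge0// exprn_ge0.
rewrite -nneseriesZl; last by move=> j _; rewrite lee_fin mulr_ge0 ?powR_ge0// ltW.
apply: lee_nneseries => [j _ _|j _].
  by apply: integral_ge0 => x _; exact: majorant_term_ge0.
rewrite ge0_integralZl//; last 3 first.
- exact: (measurable_dyadic H).
- by move=> x _; exact: dyadic_ge0.
- by rewrite lee_fin majorant_coef_ge0.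
have k0 : 0 < (2 : R) ^+ k by rewrite exprn_gt0.
have k1 : 1 <= (2 : R) ^+ k by rewrite exprn_ege1//; lra.
have := HK (w j) (2 ^+ k * del) (mulr_gt0 k0 del0) => h.
apply: (le_trans (lee_wpmul2l _ h)); first by rewrite lee_fin majorant_coef_ge0.
rewrite -!EFinM lee_fin.
have hV : Vr d mu (2 ^+ k * del) (w j) `^ (1 - p) <=
    C1 `^ (1 - p) * ((2 ^+ k) `^ (n * (1 - p)) * Vr d mu del (w j) `^ (1 - p)).
  apply: (@le_trans _ _ ((C1 * (2 ^+ k) `^ n * Vr d mu del (w j)) `^ (1 - p))).
    apply: ge0_ler_powR; rewrite ?nnegrE ?subr_ge0//; first exact: (Vr_ge0 H).
      by rewrite !mulr_ge0 ?powR_ge0 ?(ltW (V0 j))//; lra.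
    by apply: (Vr_doubling H) => //; rewrite (dist_xx H); lra.
  rewrite powRM; [|by rewrite mulr_ge0 ?powR_ge0//; lra|exact: ltW].
  rewrite powRM; [|lra|exact: powR_ge0].
  by rewrite -powRrM mulrA.
have mp := powR_ge0 (m j) p.
apply: (@le_trans _ _ (majorant_coef w m del k j * (K * (C1 `^ (1 - p) *
    ((2 ^+ k) `^ (n * (1 - p)) * Vr d mu del (w j) `^ (1 - p)))))).
  by rewrite ler_wpM2l ?majorant_coef_ge0// ler_wpM2l//; lra.
rewrite le_eqVlt; apply/orP; left; apply/eqP.
have -> : q ^+ k = (2 ^- k) `^ (beta * p) * (2 ^+ k) `^ (n * (1 - p)).
  rewrite -powR_mulrn// -!powR_mulrn; try lra.
  rewrite -powRN /q -!powRrM -powRD; last by rewrite (_ : 2 == 0 = false) ?implybT//; apply/eqP; lra.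
  by congr (_ `^ _); ring.
have VE : Vr d mu del (w j) = Vr d mu del (w j) `^ p * Vr d mu del (w j) `^ (1 - p).
  rewrite -powRD; last by rewrite (gt_eqF (V0 j)) implybT.
  by rewrite addrC subrK powRr1// ltW.
rewrite [in RHS]VE /majorant_coef /Kc; ring.
Qed.

Lemma majorant_dominates : exists2 K, 1 <= K & forall w m del c r M, 0 < del -> 0 < r ->
  (forall j, 0 <= m j) -> majorant w m del c = M%:E ->
  exists t, (forall J, \sum_(0 <= j < J) m j *
      (sizef d mu c (Num.max r del) gam (w j) * Vr d mu del (w j)) <= t) /\
    (del / Num.max r del) `^ beta * t <= K * M `^ p^-1.
Proof.
have hp0 := p0; have hp1 := p1; have hb0 := b0.
have [K2 K21 HK2] := sizef_compare H 5 gam ltac:(lra) (ltW g0).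
have [K3 K31 HK3] := sizef_powR_le_dyadic H p gam (ltW p0) (ltW g0).
pose K4 := K2 `^ p * K3.
have K41 : 1 <= K4 by rewrite mulr_ege1// powR_ge1// ltW.
have pV : 0 < p^-1 by rewrite invr_gt0.
have B4 : 1 <= (4 : R) `^ beta by rewrite powR_ge1//; lra.
exists (4 `^ beta * K4 `^ p^-1).
  by rewrite mulr_ege1// powR_ge1// ltW.
move=> w m del c r M del0 r0 m0 cM.
have M0 : 0 <= M by rewrite -lee_fin -cM majorant_ge0.
set s := Num.max r del.
have s0 : 0 < s by rewrite lt_max r0.
have dels : del <= s by rewrite le_max lexx orbT.
have [i [i1 i2]] := exists_dyadic_scale del s del0 (ltW s0).
have i0 : 0 < (2 : R) ^+ i by rewrite exprn_gt0.
set s' := 2 ^+ i * del in i1 i2.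
have s'0 : 0 < s' by rewrite mulr_gt0.
pose q := (2 ^- i) `^ (beta * p) : R; pose q' := (2 ^+ i) `^ (beta * p) : R.
have qq : q' * q = 1.
  by rewrite /q /q' -powRM ?divff ?powR1 ?gt_eqF ?invr_ge0 ?(ltW i0).
have q'0 : 0 <= q' := powR_ge0 _ _.
pose T := K4 * q' * M.
have T0 : 0 <= T by rewrite mulr_ge0// mulr_ge0//; lra.
have term j : (((m j * (sizef d mu c s gam (w j) * Vr d mu del (w j))) `^ p)%:E <=
    (K4 * q')%:E * ((majorant_coef w m del i j)%:E * dyadic (d := d) (mu := mu) p (w j) s' gam c))%E.
  have V0 := Vr_gt0 H (w j) del del0.
  have cw := dist_ge0 H c (w j).
  have h1 : sizef d mu c s gam (w j) <= K2 * sizef d mu (w j) s' gam c.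
    by apply: HK2 => //; rewrite ?(distC H (w j) c); lra.
  have S0 := sizef_ge0 H c s gam (w j) s0.
  have S'0 := sizef_ge0 H (w j) s' gam c s'0.
  have h2 : (m j * (sizef d mu c s gam (w j) * Vr d mu del (w j))) `^ p <=
      K2 `^ p * (m j `^ p * Vr d mu del (w j) `^ p) * sizef d mu (w j) s' gam c `^ p.
    have hs : sizef d mu c s gam (w j) `^ p <= K2 `^ p * sizef d mu (w j) s' gam c `^ p.
      rewrite -powRM//; last lra.
      by apply: ge0_ler_powR; rewrite ?nnegrE ?(ltW p0)// mulr_ge0//; lra.
    have -> : (m j * (sizef d mu c s gam (w j) * Vr d mu del (w j))) `^ p =
        (m j `^ p * Vr d mu del (w j) `^ p) * sizef d mu c s gam (w j) `^ p.
      rewrite powRM//; last by rewrite mulr_ge0// ltW.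
      by rewrite [in LHS]powRM ?(ltW V0)//; ring.
    have -> : K2 `^ p * (m j `^ p * Vr d mu del (w j) `^ p) * sizef d mu (w j) s' gam c `^ p =
      (m j `^ p * Vr d mu del (w j) `^ p) * (K2 `^ p * sizef d mu (w j) s' gam c `^ p) by ring.
    by apply: ler_wpM2l => //; rewrite mulr_ge0 ?powR_ge0.
  apply: (@le_trans _ _ ((K2 `^ p * (m j `^ p * Vr d mu del (w j) `^ p))%:E *
     (sizef d mu (w j) s' gam c `^ p)%:E)%E); first by rewrite -EFinM lee_fin.
  have h3 := HK3 (w j) s' c s'0.
  apply: (le_trans (lee_wpmul2l _ h3)); first by rewrite lee_fin !mulr_ge0 ?powR_ge0.
  rewrite !muleA -!EFinM /K4 /majorant_coef -/q.
  rewrite le_eqVlt; apply/orP; left; apply/eqP; congr (_%:E * _)%E.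
  by rewrite -[LHS]mulr1 -qq; ring.
have sumT J : \sum_(0 <= j < J) (m j * (sizef d mu c s gam (w j) * Vr d mu del (w j))) `^ p <= T.
  rewrite -lee_fin -sumEFin /T [leRHS]EFinM -cM.
  apply: (@le_trans _ _ (\sum_(0 <= j < J) ((K4 * q')%:E * ((majorant_coef w m del i j)%:E *
      dyadic (d := d) (mu := mu) p (w j) s' gam c)))%E); first exact: lee_sum.
  rewrite -ge0_sume_distrr; last by move=> j _; exact: majorant_term_ge0.
  rewrite lee_wpmul2l//; first by rewrite lee_fin mulr_ge0//; lra.
  apply: le_trans (nneseries_ge_term _ i _); last first.
    by move=> k; apply: nneseries_ge0 => j _ _; exact: majorant_term_ge0.
  by apply: nneseries_lim_ge => j _ _; exact: majorant_term_ge0.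
exists (T `^ p^-1); split=> [J|].
  have a0 j : 0 <= m j * (sizef d mu c s gam (w j) * Vr d mu del (w j)).
    by rewrite mulr_ge0// mulr_ge0 ?(sizef_ge0 H)//; exact: (Vr_ge0 H).
  have sum0 : 0 <= \sum_(0 <= j < J) m j * (sizef d mu c s gam (w j) * Vr d mu del (w j)).
    exact: sumr_ge0.
  rewrite (_ : (\sum_(0 <= j < J) _) = ((\sum_(0 <= j < J) m j *
     (sizef d mu c s gam (w j) * Vr d mu del (w j))) `^ p) `^ p^-1); last first.
    by rewrite -powRrM mulfV ?gt_eqF// powRr1.
  apply: ge0_ler_powR; rewrite ?nnegrE ?powR_ge0 ?(ltW pV)//.
  by apply: le_trans (powR_sum_le p _ J _ a0) (sumT J); rewrite p0.
have -> : T `^ p^-1 = K4 `^ p^-1 * (2 ^+ i) `^ beta * M `^ p^-1.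
  rewrite /T powRM//; last by rewrite mulr_ge0//; lra.
  rewrite powRM//; last lra.
  by rewrite /q' -powRrM mulfK ?gt_eqF.
have -> : (del / s) `^ beta * (K4 `^ p^-1 * (2 ^+ i) `^ beta * M `^ p^-1) =
  ((del / s) `^ beta * (2 ^+ i) `^ beta) * (K4 `^ p^-1 * M `^ p^-1) by ring.
rewrite -[leRHS]mulrA; apply: ler_wpM2r; first by rewrite mulr_ge0 ?powR_ge0.
rewrite -powRM ?(ltW i0)//; last by rewrite divr_ge0// ltW.
apply: ge0_ler_powR; rewrite ?nnegrE ?(ltW b0)//.
  by rewrite mulr_ge0 ?(ltW i0)// divr_ge0// ltW.
rewrite mulrAC ler_pdivrMr// mulrC; apply: (le_trans i2); lra.
Qed.

End Majorant.

(** * Assembly of the estimates *)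

Lemma poweR_subadd {R : realType} (p : R) (u v : \bar R) : 0 < p <= 1 ->
  (0 <= u)%E -> (0 <= v)%E -> ((u + v) `^ p <= u `^ p + v `^ p)%E.
Proof.
move=> p01; have pn0 : p != 0 by case/andP: p01 => ? _; rewrite gt_eqF.
case: u => [u| |]// u0; case: v => [v| |]// v0.
- by rewrite -EFinD !poweR_EFin -EFinD lee_fin powR_subadd// -lee_fin.
- by rewrite poweRyr// addey ?leey// poweR_EFin.
- by rewrite poweRyr// addye ?leey// poweR_EFin.
- by rewrite poweRyr// addye ?leey.
Qed.

Lemma RD_doubling_space {R : realType} {dX : measure_display} {X : measurableType dX}
    (d : X -> X -> R) (mu : {measure set X -> \bar R}) (n : R) :
  RD_space d mu n -> exists C1, doubling_space d mu n C1.
Proof.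
move=> [md [bd [bf [[n0 [C1 C11 hC1]] _]]]]; exists C1; split => // A.
by move/bd.
Qed.

Lemma AOTI_approx_kernel {R : realType} {dX : measure_display} {X : measurableType dX}
    (d : X -> X -> R) (mu : {measure set X -> \bar R}) (eps1 eps2 eps3 : R)
    (S : int -> X -> X -> R) : AOTI d mu eps1 eps2 eps3 S ->
  exists2 C4, 0 < C4 & forall l, approx_kernel d mu eps1 eps2 eps3 C4 (tpow l) (S l).
Proof.
move=> [he1 [he2 [he3 [mS [C4 C40 [h1 [h2 [h3 [h4 [h5 h6]]]]]]]]]]; exists C4 => // l.
split => //.
- by rewrite /tpow powR_gt0.
- exact: h2.
- exact: h3.
- exact: h4.
- by move=> y; apply: (measurableT_comp (mS l) (measurable_pair2 y)).
Qed.

Theorem theorem3p3 (R : realType) (dX : measure_display) (X : measurableType dX)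
  (d : X -> X -> R) (mu : {measure set X -> \bar R}) (x1 : X) (n : R)
  (eps1 eps2 eps3 : R) (S : int -> X -> X -> R) (eps p beta gam : R) :
  RD_space d mu n ->
  mu [set: X] = +oo%E ->
  AOTI d mu eps1 eps2 eps3 S ->
  0 < eps -> eps < Num.min eps1 eps2 ->
  n / (n + eps) < p -> p <= 1 ->
  n * (p^-1 - 1) < beta -> beta < eps ->
  n * (p^-1 - 1) < gam -> gam < eps ->
  exists2 C : R, 0 < C &
    forall (l : int) (f : (X -> R) -> R),
      in_dual d mu x1 eps beta gam f ->
      (Lnorm mu p%:E (grand_max d mu x1 eps beta gam None (f_minus_Sf mu S l f))
        <= C%:E * Lnorm mu p%:E (grand_max d mu x1 eps beta gam (Some l) f))%E.
Proof.
move=> hRD muX hS eps0; rewrite lt_min => /andP[e1 e2] np p1 nb be ng ge.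
have [C1 H] := RD_doubling_space d mu n hRD.
have /andP[_ e11] : 0 < eps1 <= 1 by case: hS.
have [C4 C40 HT] := AOTI_approx_kernel d mu eps1 eps2 eps3 S hS.
have n0 := ds_n H; have C11 := ds_C1 H.
have p0 : 0 < p by apply: le_lt_trans np; rewrite divr_ge0//; lra.
have p01 : 0 < p <= 1 by rewrite p0.
have pV : 0 < p^-1 by rewrite invr_gt0.
have pV1 : 1 <= p^-1 by rewrite invf_ge1.
have np0 : 0 <= n * (p^-1 - 1) by rewrite mulr_ge0//; lra.
have b0 : 0 < beta by lra.
have g0 : 0 < gam by lra.
have eps_le1 : eps <= 1 by lra.
have npE : n * (p^-1 - 1) * p = n * (1 - p) by rewrite -mulrA mulrBl mulVf ?gt_eqF// mul1r.
have bp : n * (1 - p) < beta * p by rewrite -npE ltr_pM2r.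
have gp : n * (1 - p) < gam * p by rewrite -npE ltr_pM2r.
have ble := ltW be.
have [Ka Ka1 HKa] := dual_kernel_integral_le (eps3 := eps3) (x1 := x1) H b0 ble e1 e11 g0 ge e2 C40.
have [Kb Kb1 HKb] := dual_difference_le (eps3 := eps3) (x1 := x1) H muX b0 ble e1 e11 g0 ge e2 C40.
have [K1 K10 HK1] := integral_majorant_le H p0 p1 bp gp.
have [K2 K21 HK2] := majorant_dominates H p0 p1 b0 g0.
(* The 2 is the [Gbound] constant of a test function of norm at most 1. *)
pose E := (Ka + Kb) * 2 * K2.
have E0 : 0 < E by rewrite !mulr_gt0//; lra.
pose C := 1 + E `^ p * (K1 * (C1 * 2 `^ n)).
have C12 : 0 <= C1 * 2 `^ n by rewrite mulr_ge0 ?powR_ge0//; lra.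
have C0 : 0 < C.
  have : 0 <= E `^ p * (K1 * (C1 * 2 `^ n)) by rewrite mulr_ge0 ?powR_ge0// mulr_ge0.
  by rewrite /C; lra.
exists (C `^ p^-1); first exact: powR_gt0.
move=> l L dL.
set F := grand_max d mu x1 eps beta gam None _; set G := grand_max d mu x1 eps beta gam (Some l) L.
have F0 x : (0 <= F x)%E by exact: (grand_max_ge0 H b0 ble ge).
have G0' x : (0 <= G x)%E by exact: (grand_max_ge0 H b0 ble ge).
rewrite !Lnorm.unlock /=.
under eq_integral do rewrite gee0_abs//.
under [X in (_ <= _ * X `^ _)%E]eq_integral do rewrite gee0_abs//.
set I := (\int[mu]_x (G x `^ p))%E.
have I0 : (0 <= I)%E by apply: integral_ge0 => x _; exact: poweR_ge0.
(* An infinite right-hand side is set aside first: the sampled values require a finite integral. *)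
have [Iy|Ify] := eqVneq I +oo%E.
  by rewrite Iy poweRyr ?gt_eqF// gt0_muley ?leey// lte_fin powR_gt0.
have Ilt : (I < +oo)%E by rewrite ltey.
have Ifin : I \is a fin_num by rewrite ge0_fin_numE.
have del0 : 0 < tpow l :> R by rewrite /tpow powR_gt0.
have [w [wsep [wcov wfar]]] := exists_net H (tpow l) x1 muX del0.
pose m := ball_inf (mu := mu) (d := d) (x1 := x1) (eps := eps) (beta := beta) (gam := gam)
  (L := L) l (w := w).
have hw : sampled_bound d mu x1 eps beta gam (tpow l) L w m.
  exact: (sampled_ball_inf H b0 ble ge dL l p0 Ilt wcov wfar).
have hm : (\sum_(j <oo) (m j `^ p * Vr d mu (tpow l) (w j))%:E <= (C1 * 2 `^ n * fine I)%:E)%E.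
  rewrite EFinM fineK//.
  exact: (sum_ball_inf_le H b0 ble ge dL l p0 Ilt wsep wcov wfar).
have m0 := sb_ge0 hw.
pose Maj := majorant (d := d) (mu := mu) (beta := beta) (gam := gam) (p := p) w m (tpow l).
have Maj0 x : (0 <= Maj x)%E by exact: majorant_ge0.
have mMaj : measurable_fun [set: X] Maj by exact: (measurable_majorant H).
have intMaj : (\int[mu]_x Maj x <= (K1 * (C1 * 2 `^ n * fine I))%:E)%E.
  exact: (HK1 w m (tpow l) _ del0 m0 hm).
have pointwise x : (F x <= G x + E%:E * (Maj x `^ p^-1))%E.
  have [My|Mfy] := eqVneq (Maj x) +oo%E.
    rewrite My poweRyr ?gt_eqF// gt0_muley ?lte_fin// addey ?leey//.
    by rewrite gt_eqF//; apply: lt_le_trans (G0' x); rewrite ltNye.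
  have Mfin : Maj x \is a fin_num by rewrite ge0_fin_numE// ltey.
  have Mx : Maj x = (fine (Maj x))%:E by rewrite fineK.
  apply: ge_ereal_sup => _ [phi [phiG [r [r0 [_ [pG pN]]]]] <-].
  (* The norm bound 1 yields [Gbound] for every constant above 1. *)
  have pB : Gbound d mu x r beta gam phi 2.
    by apply: (Gbound_gt_Gnorm H) => //; lra.
  have [t [t1 t2]] := HK2 w m (tpow l) x r (fine (Maj x)) del0 r0 m0 Mx.
  have t0 : 0 <= t by have := t1 0%N; rewrite big_geq.
  set Mp := fine (Maj x) `^ p^-1 in t2.
  have Mp0 : 0 <= Mp := powR_ge0 _ _.
  rewrite Mx poweR_EFin -/Mp -EFinM /f_minus_Sf /Sop.
  (* For small [r] the two terms of [f - S_l f] are bounded separately, the first by [G x]; for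
     large [r] only their difference is under control. *)
  have [rd|dr] := leP r (tpow l).
    have sE : Num.max r (tpow l) = tpow l by rewrite maxEle rd.
    have [_ h2] := HKa (tpow l) (S l) L w m (HT l) dL hw x r phi 2 t r0 pB t1.
    have h1 : ((`|L phi|)%:E <= G x)%E.
      by apply: ereal_sup_ubound; exists phi => //; split => //; exists r; split.
    rewrite sE divff ?gt_eqF// powR1 mul1r in t2.
    apply: (@le_trans _ _ ((`|L phi|)%:E + (E * Mp)%:E)%E); last exact: leeD.
    rewrite -EFinD lee_fin; apply: (le_trans (ler_normB _ _)); rewrite lerD2l.
    apply: (le_trans h2); apply: (@le_trans _ _ (Ka * 2 * (K2 * Mp))).
      by rewrite ler_wpM2l//; lra.
    rewrite /E; have : 0 <= K2 * Mp by rewrite mulr_ge0//; lra.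
    by move=> h; have : 0 <= Kb * (K2 * Mp); [rewrite mulr_ge0//; lra|lra].
  have dr' := ltW dr.
  have sE : Num.max r (tpow l) = r by rewrite maxEle leNgt dr.
  rewrite sE in t1 t2.
  have h2 := HKb (tpow l) (S l) L w m (HT l) dL hw x r phi 2 t dr' ltac:(lra) phiG pB t1.
  apply: (@le_trans _ _ (E * Mp)%:E); last by rewrite leeDr.
  rewrite lee_fin; apply: (le_trans h2); apply: (@le_trans _ _ (Kb * 2 * (K2 * Mp))).
    by rewrite ler_wpM2l//; lra.
  rewrite /E; have : 0 <= K2 * Mp by rewrite mulr_ge0//; lra.
  by move=> h; have : 0 <= Ka * (K2 * Mp); [rewrite mulr_ge0//; lra|lra].
have EM0 x : (0 <= (E `^ p)%:E * Maj x)%E by rewrite mule_ge0// lee_fin powR_ge0.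
have step x : (F x `^ p <= G x `^ p + (E `^ p)%:E * Maj x)%E.
  have R0 : (0 <= E%:E * (Maj x `^ p^-1))%E by rewrite mule_ge0 ?poweR_ge0// lee_fin ltW.
  apply: (@le_trans _ _ ((G x + E%:E * (Maj x `^ p^-1)) `^ p)%E).
    apply: gt0_ler_poweR; rewrite ?(ltW p0) ?in_itv/= ?leey ?andbT//.
    by rewrite adde_ge0.
  apply: (le_trans (poweR_subadd p _ _ p01 (G0' x) R0)); rewrite leeD2l//.
  rewrite poweRM ?poweR_ge0 ?lee_fin ?(ltW E0)// poweR_EFin -poweRrM mulVf ?gt_eqF//.
  by rewrite poweRe1.
have total : (\int[mu]_x (F x `^ p) <= C%:E * I)%E.
  apply: (@le_trans _ _ (I + \int[mu]_x ((E `^ p)%:E * Maj x))%E).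
    (* Of the two summands only the majorant is known to be measurable, and that is the one which is
       split off. *)
    apply: le_lower_integralD => // [x|x|]; try exact: poweR_ge0.
    exact: measurable_funeM.
  rewrite ge0_integralZl// ?lee_fin ?powR_ge0//.
  rewrite -(fineK Ifin) -EFinM.
  apply: (@le_trans _ _ ((fine I)%:E + (E `^ p * (K1 * (C1 * 2 `^ n * fine I)))%:E)%E).
    by rewrite leeD2l// [leRHS]EFinM lee_wpmul2l ?lee_fin ?powR_ge0.
  by rewrite -EFinD lee_fin le_eqVlt; apply/orP; left; apply/eqP; rewrite /C; ring.
rewrite -poweR_EFin -poweRM//; last by rewrite lee_fin ltW.
apply: gt0_ler_poweR; rewrite ?(ltW pV) ?in_itv/= ?leey ?andbT//.
  by apply: integral_ge0 => x _; exact: poweR_ge0.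
by rewrite mule_ge0// lee_fin ltW.
Qed.
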